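(* Let $n\ge 2$, $\lambda\in\mathfrak h^*$, $\sigma\in S_n$, $\bar\lambda=\lambda+(0,-1,\dots,-n+1)$ and $G=G(T_\sigma(\bar\lambda))$. If $\lambda$ is a $\sigma$-relation weight, then the simple highest weight module $L(\lambda)$ is a $\sigma$-relation module; more precisely, $$L(\lambda)\simeq [V_G(T_\sigma(\bar\lambda))]^\sigma .$$
   Context: $\mathfrak h$ is the standard (diagonal) Cartan subalgebra of $\mathfrak{gl}_n(\mathbb C)$, $E_{ij}$ are the matrix units, and $\lambda\in\mathfrak h^*$ is identified with $(\lambda_1,\dots,\lambda_n)\in\mathbb C^n$, $\lambda_i=\lambda(E_{ii})$. $L(\lambda)$ is the simple quotient of the Verma module $M(\lambda)$ of highest weight $\lambda$ (standard Borel subalgebra). **Graphs $G_\sigma$.** Let $\mathfrak V=\{(i,j): 1\le j\le i\le n\}$; $(k,1),\dots,(k,k)$ form row $k$, row $n$ being the top row. $\Sigma$ is the set of directed graphs on $\mathfrak V$ having, for each $1\le s<r\le n$, exactly one of the arrows $(r,s)\to(r-1,s)$ (then $A_{(r,s)}(G)=1$) or $(r-1,s)\to(r,s)$ (then $A_{(r,s)}(G)=-1$), and no other arrows. Let $\alpha_{ij}=\varepsilon_i-\varepsilon_j$ ($i\ne j$), $\Delta^+=\{\alpha_{ij}: i<j\}$, $\sigma(\alpha_{ij})=\alpha_{\sigma(i)\sigma(j)}$, and for $G\in\Sigma$ put $\mathcal Q_G=\{\alpha_{ij}: i<j, A_{(j,i)}(G)=1\}\cup\{\alpha_{ji}: i<j,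 A_{(j,i)}(G)=-1\}$. $G_\sigma$ is the unique element of $\Sigma$ with $\mathcal Q_{G_\sigma}=\sigma(\Delta^+)$. **Tableaux.** A Gelfand-Tsetlin tableau $T(L)$ is a triangular array of complex numbers $l_{ij}$ indexed by $(i,j)\in\mathfrak V$. For $X\in\mathbb C^n$, $T_\sigma(X)=T(Y)$ is defined by $y_{n,i}=x_{\sigma^{-1}(i)}$ and, recursively for $k=n,\dots,2$ and $1\le i\le k-1$, $y_{k-1,i}=y_{k,i}$ if $G_\sigma$ has an arrow $(k,i)\to(k-1,i)$, and $y_{k-1,i}=y_{k,i}+1$ if $G_\sigma$ has an arrow $(k-1,i)\to(k,i)$. **Relation graphs.** All graphs are directed graphs on $\mathfrak V$ whose arrows connect only vertices in consecutive rows or vertices of row $n$, without oriented cycles or multiple arrows. $G$ is non-critical if any two vertices in the same row $k<n$ lying in the same connected component of the underlying unoriented graph are joined by an oriented path from one to the other. $T(L)$ satisfies $G$ if for each arrow $(i,j)\to(r,s)$ one has $l_{ij}-l_{rs}\in\mathbb Z_{\ge0}$ when the arrow is horizontal or points down ($r=i-1$), and $l_{ij}-l_{rs}\in\mathbb Z_{>0}$ when it points up ($r=i+1$). $T(L)$ is a $G$-realization if it satisfies $G$ and, for all $1\le k\le n-1$, $l_{ki}-l_{kj}\in\mathbb Z$ only if $(k,i),(k,j)$ are in the same connected component. For a $G$-realization $T(L)$, $V_G(T(L))$ is the complex vector space with basis all $G$-realizations $T(L+z)$, $z$ an integer array with $z_{ni}=0$ for all $i$. A non-critical $G$ is a relation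 graph if for every $G$-realization $T(L)$ the Gelfand-Tsetlin formulas $$E_{k,k+1}T(L)=-\sum_{i=1}^k\frac{\prod_{j=1}^{k+1}(l_{ki}-l_{k+1,j})}{\prod_{j\ne i}(l_{ki}-l_{kj})}T(L+\delta^{ki}),\quad E_{k+1,k}T(L)=\sum_{i=1}^k\frac{\prod_{j=1}^{k-1}(l_{ki}-l_{k-1,j})}{\prod_{j\ne i}(l_{ki}-l_{kj})}T(L-\delta^{ki}),$$ $$E_{kk}T(L)=\Big(k-1+\sum_{i=1}^kl_{ki}-\sum_{i=1}^{k-1}l_{k-1,i}\Big)T(L)$$ define a $\mathfrak{gl}_n$-module structure on $V_G(T(L))$; here $T(L\pm\delta^{ki})$ is $T(L)$ with $\pm1$ added to entry $(k,i)$, and a summand is $0$ by definition if the new tableau is not a $G$-realization. Modules isomorphic to $V_G(T(L))$ for some relation graph $G$ are called relation modules. **Graph of a tableau.** $G(T(L))$ is the transitive reduction (same reachability, minimal set of arrows) of the graph on $\mathfrak V$ with an arrow $(i,j)\to(r,s)$ if: (i) $i=r+1$ and $l_{ij}-l_{rs}\in\mathbb Z_{\ge0}$; or (ii) $i=r-1$ and $l_{ij}-l_{rs}\in\mathbb Z_{>0}$; or (iii) $i=r=n$, $j\neq s$, and $l_{nj}-l_{ns}\in\mathbb Z_{\ge0}$, where if $l_{nj}=l_{ns}$ only the arrow from the smaller to the larger index is taken. **$\sigma$-relation.** $\lambda$ is a $\sigma$-relation weight if $G(T_\sigma(\bar\lambda))$ is a relation graph. For a $\mathfrak{gl}_n$-module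 $M$, $M^\sigma$ is the same vector space with action $x\cdot_\sigma m=\varphi_\sigma(x)\cdot m$, where $\varphi_\sigma(E_{ij})=E_{\sigma(i)\sigma(j)}$ (extended to $U(\mathfrak{gl}_n)$). A $\mathfrak{gl}_n$-module is a $\sigma$-relation module if it is isomorphic to $N^\sigma$ for some relation module $N$. *)

(* Defs.v *)
From HB Require Import structures.
From mathcomp Require Import all_boot all_order all_algebra all_fingroup.
From mathcomp Require Import boolp.
From mathcomp.multinomials Require Import monalg.

Set Implicit Arguments.
Unset Strict Implicit.
Unset Printing Implicit Defensive.

Import GRing.Theory.
Local Open Scope ring_scope.
Local Open Scope quotient_scope.

(* Indices are 0-based: the row k (resp. E_{kk}, lambda_k) of the usual
   1-based notation is the element k - 1 of 'I_n. *)

Section GlModules.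
Variables (C : fieldType) (n : nat).

Definition gl_bracket (x y : 'M[C]_n) : 'M[C]_n := x *m y - y *m x.

Definition gl_action (V : lmodType C) (a : 'M[C]_n -> V -> V) : Prop :=
  [/\ forall v, linear (a^~ v),
      forall x, linear (a x)
    & forall x y v, a (gl_bracket x y) v = a x (a y v) - a y (a x v)].

Record glModule := GlModule {
  gl_carrier :> lmodType C;
  gl_act : 'M[C]_n -> gl_carrier -> gl_carrier;
  gl_actP : gl_action gl_act }.

Definition gl_iso (M N : glModule) : Prop :=
  exists2 f : {linear M -> N}, bijective f
    & forall x v, f (gl_act x v) = gl_act x (f v).

Definition gl_submodule (M : glModule) (P : M -> Prop) : Prop :=
  [/\ P 0, forall c u v, P u -> P v -> P (c *: u + v)
    & forall x v, P v -> P (gl_act x v)].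

Definition gl_proper_submodule (M : glModule) (P : M -> Prop) : Prop :=
  gl_submodule P /\ exists v, ~ P v.

End GlModules.

Arguments glModule : clear implicits.

Section Twist.
Variables (C : fieldType) (n : nat) (s : 'S_n).

Definition phi_perm (x : 'M[C]_n) : 'M[C]_n :=
  \sum_i \sum_j x i j *: delta_mx (s i) (s j).

Lemma phi_permE (x : 'M[C]_n) i j : phi_perm x (s i) (s j) = x i j.
Proof.
rewrite /phi_perm summxE (bigD1 i) //= summxE (bigD1 j) //= !mxE !eqxx mulr1.
rewrite big1 ?addr0 => [|j' ne]; last first.
  by rewrite !mxE !(inj_eq perm_inj) [j == j']eq_sym (negPf ne) andbF mulr0.
rewrite big1 ?addr0 // => i' ne; rewrite summxE big1 // => j' _.
by rewrite !mxE !(inj_eq perm_inj) [i == i']eq_sym (negPf ne) mulr0.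
Qed.

Lemma phi_perm_is_linear : linear phi_perm.
Proof.
move=> c x y; apply/matrixP=> i j.
by rewrite -[i](permKV s) -[j](permKV s) phi_permE !mxE !phi_permE.
Qed.

Lemma phi_permM (x y : 'M[C]_n) : phi_perm (x *m y) = phi_perm x *m phi_perm y.
Proof.
apply/matrixP=> i j; rewrite -[i](permKV s) -[j](permKV s) phi_permE !mxE.
rewrite [RHS](reindex_inj (@perm_inj _ s)).
by apply: eq_bigr => k _; rewrite !phi_permE.
Qed.

Lemma phi_perm_bracket (x y : 'M[C]_n) :
  phi_perm (gl_bracket x y) = gl_bracket (phi_perm x) (phi_perm y).
Proof.
rewrite /gl_bracket -!phi_permM -scaleN1r addrC phi_perm_is_linear.
by rewrite scaleN1r addrC.
Qed.

Lemma twist_actP (M : glModule C n) :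
  gl_action (fun (x : 'M[C]_n) (v : M) => gl_act (phi_perm x) v).
Proof.
case: M => V a [/= aL aR aB]; split=> [v c x y|x|x y v] /=.
- by rewrite phi_perm_is_linear aL.
- exact: aR.
- by rewrite phi_perm_bracket aB.
Qed.

Definition gl_twist (M : glModule C n) : glModule C n := GlModule (twist_actP M).

End Twist.

Section LmodQuotient.
Variables (C : fieldType) (V : lmodType C) (N : {pred V}).
Hypothesis NP : submod_closed N.

Definition quot_zmodClosed : zmodClosed V :=
  HB.pack N (GRing.isZmodClosed.Build V N (GRing.submod_closedB NP)).

Definition lquot : Type := Quotient.quot quot_zmodClosed.

HB.instance Definition _ := GRing.Zmodule.on lquot.

Definition lpi (v : V) : lquot := \pi_(Quotient.quot quot_zmodClosed) v.
Definition lrepr (q : lquot) : V := generic_quotient.repr (q : Quotient.quot quot_zmodClosed).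

Lemma lreprK : cancel lrepr lpi. Proof. exact: reprK. Qed.

Lemma lpi_eq u v : (lpi u = lpi v) <-> (u - v \in N).
Proof. by rewrite (Quotient.idealrBE quot_zmodClosed); split=> [e|/eqP//]; apply/eqP. Qed.

Lemma lpiD u v : lpi (u + v) = lpi u + lpi v.
Proof. by rewrite /lpi (raddfD (\pi_(Quotient.quot quot_zmodClosed))). Qed.

Definition lquot_scale (c : C) (q : lquot) : lquot := lpi (c *: lrepr q).

Lemma lpiZ c v : lpi (c *: v) = lquot_scale c (lpi v).
Proof.
apply/lpi_eq; rewrite -scalerBr -[_ *: _]addr0.
have [N0 NL] := NP; apply: NL => //.
by apply/lpi_eq; rewrite lreprK.
Qed.

Fact lquot_scaleA a b q : lquot_scale a (lquot_scale b q) = lquot_scale (a * b) q.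
Proof. by rewrite -[q]lreprK -!lpiZ scalerA. Qed.
Fact lquot_scale1 : left_id 1 lquot_scale.
Proof. by move=> q; rewrite -[q]lreprK -!lpiZ scale1r. Qed.
Fact lquot_scaleDr : right_distributive lquot_scale +%R.
Proof. by move=> c q r; rewrite -[q]lreprK -[r]lreprK -lpiD -!lpiZ -lpiD scalerDr. Qed.
Fact lquot_scaleDl q : {morph lquot_scale^~ q : a b / a + b}.
Proof. by move=> a b; rewrite -[q]lreprK -!lpiZ -lpiD scalerDl. Qed.

HB.instance Definition _ := GRing.Zmodule_isLmodule.Build C lquot
  lquot_scaleA lquot_scale1 lquot_scaleDr lquot_scaleDl.

Lemma lpi_is_linear : linear lpi.
Proof. by move=> c u v; rewrite lpiD lpiZ. Qed.

Variables (n : nat) (a : 'M[C]_n -> V -> V).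
Hypothesis a_linl : forall v, linear (a^~ v).
Hypothesis a_linr : forall x, linear (a x).
Hypothesis a_stable : forall x v, v \in N -> a x v \in N.
Hypothesis a_bracket : forall x y v,
  a (gl_bracket x y) v - (a x (a y v) - a y (a x v)) \in N.

Definition quot_act (x : 'M[C]_n) (q : lquot) : lquot := lpi (a x (lrepr q)).

Lemma quot_actE x v : quot_act x (lpi v) = lpi (a x v).
Proof.
apply/lpi_eq; have -> : a x (lrepr (lpi v)) - a x v = a x (lrepr (lpi v) - v).
  by rewrite -scaleN1r addrC -a_linr scaleN1r addrC.
by apply/a_stable/lpi_eq; rewrite lreprK.
Qed.

Lemma quot_actP : gl_action quot_act.
Proof.
split=> [q c x y|x c q r|x y q].
- by rewrite -[q]lreprK !quot_actE a_linl lpi_is_linear.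
- by rewrite -[q]lreprK -[r]lreprK -lpi_is_linear !quot_actE a_linr lpi_is_linear.
- rewrite -[q]lreprK !quot_actE -[in X in _ = _ + X]scaleN1r addrC -lpi_is_linear.
  by apply/lpi_eq; rewrite scaleN1r [- _ + _]addrC; exact: a_bracket.
Qed.

Definition quot_glModule : glModule C n := GlModule quot_actP.

End LmodQuotient.

Section Verma.
Variables (C : fieldType) (n : nat).

Definition gl_free_alg := {malg C[{fmonom ('I_n * 'I_n)%type}]}.

HB.instance Definition _ := GRing.Lalgebra.on gl_free_alg.

Definition gl_gen (x : 'M[C]_n) : gl_free_alg :=
  \sum_i \sum_j x i j *: (<< fmu (i, j) >> : gl_free_alg).

Variable lam : 'rV[C]_n.

(* The left ideal of the free algebra on the E_ij which is the preimage of the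
   left ideal of U(gl_n) generated by the E_ij, i < j, and the
   E_ii - lam_i; thus the quotient by it is
   M(lam) = U(gl_n) / (U(gl_n) n^+ + sum_i U(gl_n) (E_ii - lam_i)). *)
Inductive verma_ideal : gl_free_alg -> Prop :=
| verma_ideal0 : verma_ideal 0
| verma_idealD f g : verma_ideal f -> verma_ideal g -> verma_ideal (f + g)
| verma_idealM f g : verma_ideal g -> verma_ideal (f * g)
| verma_ideal_lie x y f :
    verma_ideal ((gl_gen x * gl_gen y - gl_gen y * gl_gen x
                    - gl_gen (gl_bracket x y)) * f)
| verma_ideal_nil (i j : 'I_n) :
    (i < j)%N -> verma_ideal (gl_gen (delta_mx i j))
| verma_ideal_cartan (i : 'I_n) :
    verma_ideal (gl_gen (delta_mx i i) - lam 0 i *: 1).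

Definition verma_pred : {pred gl_free_alg} := fun f => `[< verma_ideal f >].

Fact verma_pred_closed : submod_closed verma_pred.
Proof.
split=> [|c f g /asboolP If /asboolP Ig]; apply/asboolP; first exact: verma_ideal0.
apply: verma_idealD => //; rewrite -[f]mul1r scalerAl; exact: verma_idealM.
Qed.

Definition free_act (x : 'M[C]_n) (f : gl_free_alg) : gl_free_alg :=
  gl_gen x * f.

Lemma gl_free_scalerAr (c : C) (f g : gl_free_alg) : f * (c *: g) = c *: (f * g).
Proof.
rewrite -[c *: g]mul_malgC -[c *: (f * g)]mul_malgC !mulrA; congr (_ * g).
rewrite (malgM_def f) (malgM_def _ f) fgmulgU fgmulUg.
by apply: eq_bigr => k _; rewrite mulrC mulm1 mul1m.
Qed.

Fact free_act_linl f : linear (free_act^~ f).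
Proof.
move=> c x y; rewrite /free_act scalerAl -mulrDl; congr (_ * f).
rewrite /gl_gen scaler_sumr -big_split; apply: eq_bigr => i _ /=.
rewrite scaler_sumr -big_split; apply: eq_bigr => j _ /=.
by rewrite !mxE scalerDl scalerA.
Qed.

Fact free_act_linr x : linear (free_act x).
Proof. by move=> c f g; rewrite /free_act mulrDr gl_free_scalerAr. Qed.

Fact free_act_stable x f : f \in verma_pred -> free_act x f \in verma_pred.
Proof. by move=> /asboolP If; apply/asboolP; apply: verma_idealM. Qed.

Fact free_act_bracket x y f :
  free_act (gl_bracket x y) f
    - (free_act x (free_act y f) - free_act y (free_act x f)) \in verma_pred.
Proof.
have e (A : nzRingType) (u v w g : A) :
  w * g - (u * (v * g) - v * (u * g)) = (u * v - v * u - w) * - g.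
  by rewrite mulrN !mulrBl !opprB !mulrA.
by apply/asboolP; rewrite /free_act e; exact: verma_ideal_lie.
Qed.

Definition verma : glModule C n :=
  quot_glModule verma_pred_closed free_act_linl free_act_linr
     free_act_stable free_act_bracket.

End Verma.

Section Radical.
Variables (C : fieldType) (n : nat) (M : glModule C n).

(* The sum of all proper submodules; for a Verma module this is the unique
   maximal submodule, so that the quotient by it is the simple quotient. *)
Definition gl_rad : {pred M} := fun v => `[< exists r : seq M,
  (forall u, u \in r -> exists2 P : M -> Prop, gl_proper_submodule P & P u)
  /\ v = \sum_(u <- r) u >].

Fact gl_rad_closed : submod_closed gl_rad.
Proof.
split=> [|c u v /asboolP[r [rP ->]] /asboolP[t [tP ->]]]; apply/asboolP.
  by exists [::]; rewrite big_nil.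
exists (map ( *:%R c) r ++ t); split=> [w|].
  rewrite mem_cat => /orP[/mapP[w' /rP[P [sP pP] Pw'] ->]|/tP//].
  exists P => //; case: sP => P0 PL _.
  by rewrite -[_ *: _]addr0; apply: PL.
by rewrite big_cat big_map scaler_sumr.
Qed.

Fact gl_rad_stable x v : v \in gl_rad -> gl_act x v \in gl_rad.
Proof.
have [_ aR _] := gl_actP M.
have a0 : gl_act x (0 : M) = 0.
  by have := aR x (-1) 0 0; rewrite !scaleN1r addr0 oppr0 addNr.
have aD u w : gl_act x (u + w : M) = gl_act x u + gl_act x w.
  by rewrite -[u]scale1r aR !scale1r.
move=> /asboolP[r [rP ->]]; apply/asboolP; exists (map (gl_act x) r); split.
  move=> w /mapP[w' /rP[P pP Pw'] ->]; exists P => //.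
  by case: pP => -[_ _ Pa] _; apply: Pa.
by rewrite big_map; apply: (big_morph _ aD a0).
Qed.

Fact gl_act_bracket x y (v : M) :
  gl_act (gl_bracket x y) v - (gl_act x (gl_act y v) - gl_act y (gl_act x v))
    \in gl_rad.
Proof. by have [_ _ ->] := gl_actP M; rewrite subrr; case: gl_rad_closed. Qed.

Definition gl_head : glModule C n :=
  quot_glModule gl_rad_closed (let: And3 aL _ _ := gl_actP M in aL)
    (let: And3 _ aR _ := gl_actP M in aR) gl_rad_stable gl_act_bracket.

End Radical.

Definition simple_hw (C : fieldType) (n : nat) (lam : 'rV[C]_n) : glModule C n :=
  gl_head (verma lam).

Section Graphs.
Variable n : nat.

Definition vertex := {p : 'I_n * 'I_n | (p.2 <= p.1)%N}.
Definition vrow (v : vertex) : 'I_n := (val v).1.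
Definition vcol (v : vertex) : 'I_n := (val v).2.
Definition top_row (v : vertex) : bool := (vrow v).+1 == n.

Definition graph := {set vertex * vertex}.
Definition arrow (G : graph) : rel vertex := fun u v => (u, v) \in G.
Definition reachable (G : graph) : rel vertex := connect (arrow G).
Definition same_component (G : graph) : rel vertex :=
  connect [rel u v | arrow G u v || arrow G v u].

Definition admissible_graph (G : graph) : Prop :=
  (forall u v, arrow G u v ->
     [|| vrow u == (vrow v).+1 :> nat, vrow v == (vrow u).+1 :> nat
       | top_row u && top_row v])
  /\ (forall u v, arrow G u v -> ~~ reachable G v u).

Definition noncritical (G : graph) : Prop :=
  forall u v, vrow u = vrow v -> ~~ top_row u -> same_component G u v ->
    reachable G u v || reachable G v u.

Definition same_reachability (G H : graph) : bool :=
  [forall u, forall v, reachable G u v == reachable H u v].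

(* For acyclic graphs the minimum is attained exactly once. *)
Definition transitive_reduction (G : graph) : graph :=
  [arg min_(H < G | same_reachability H G) #|H|].

(* u = (r, c) and v = (r - 1, c). *)
Definition just_above (u v : vertex) : bool :=
  (vcol u == vcol v) && (vrow u == (vrow v).+1 :> nat).

Definition Sigma_graphs : {set graph} :=
  [set G : graph |
    [forall u, forall v, just_above u v ==> arrow G u v (+) arrow G v u] &&
    [forall u, forall v, arrow G u v ==> just_above u v || just_above v u]].

(* A_{(r,c)}(G) = 1, resp. A_{(r,c)}(G) = -1. *)
Definition A_down (G : graph) (r c : nat) : bool :=
  [exists u, exists v, [&& just_above u v, vrow u == r :> nat,
    vcol u == c :> nat & arrow G u v]].
Definition A_up (G : graph) (r c : nat) : bool :=
  [exists u, exists v, [&& just_above u v, vrow u == r :> nat,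
    vcol u == c :> nat & arrow G v u]].

(* The root alpha_ij is represented by the pair (i, j). *)
Definition positive_roots : {set 'I_n * 'I_n} :=
  [set p : 'I_n * 'I_n | (p.1 < p.2)%N].
Definition perm_roots (s : 'S_n) (D : {set 'I_n * 'I_n}) : {set 'I_n * 'I_n} :=
  [set (s p.1, s p.2) | p in D].
Definition Q_graph (G : graph) : {set 'I_n * 'I_n} :=
  [set p : 'I_n * 'I_n | ((p.1 < p.2)%N && A_down G p.2 p.1)
        || ((p.2 < p.1)%N && A_up G p.1 p.2)].

Definition G_perm (s : 'S_n) : graph :=
  odflt set0
    [pick G in Sigma_graphs | Q_graph G == perm_roots s positive_roots].

Lemma mem_perm_roots (s : 'S_n) i j :
  ((i, j) \in perm_roots s positive_roots) = (s^-1%g i < s^-1%g j)%N.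
Proof.
apply/imsetP/idP => [[[a b]]|lt_ij].
  by rewrite inE => /= lt_ab [-> ->]; rewrite !permK.
by exists (s^-1%g i, s^-1%g j); rewrite ?inE //= !permKV.
Qed.

Lemma vertex_eqP (u v : vertex) : vrow u = vrow v -> vcol u = vcol v -> u = v.
Proof.
by move: u v => [[a b] ?] [[c d] ?]; rewrite /vrow /vcol /= => ? ?; apply: val_inj => /=; congr pair.
Qed.

Lemma just_above_inj u v u' v' : just_above u v -> just_above u' v' ->
  vrow u = vrow u' -> vcol u = vcol u' -> u = u' /\ v = v'.
Proof.
move=> /andP[/eqP c1 /eqP r1] /andP[/eqP c2 /eqP r2] er ec.
split; apply: vertex_eqP => //; last by rewrite -c1 -c2.
by apply: val_inj; apply: succn_inj; rewrite -r1 -r2 er.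
Qed.

Lemma just_above_col u v : just_above u v -> (vcol u < vrow u)%N.
Proof. by case/andP=> /eqP -> /eqP ->; rewrite ltnS; exact: (valP v). Qed.

Lemma A_downE G u v : just_above u v -> A_down G (vrow u) (vcol u) = arrow G u v.
Proof.
move=> uv; apply/existsP/idP => [[u' /existsP[v']]|Guv].
  case/and4P=> uv' /eqP/val_inj er /eqP/val_inj ec.
  by have [-> ->] := just_above_inj uv' uv er ec.
by exists u; apply/existsP; exists v; rewrite uv !eqxx.
Qed.

Lemma A_upE G u v : just_above u v -> A_up G (vrow u) (vcol u) = arrow G v u.
Proof.
move=> uv; apply/existsP/idP => [[u' /existsP[v']]|Guv].
  case/and4P=> uv' /eqP/val_inj er /eqP/val_inj ec.
  by have [-> ->] := just_above_inj uv' uv er ec.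
by exists u; apply/existsP; exists v; rewrite uv !eqxx.
Qed.

Lemma just_above_pair (i j : 'I_n) : (i < j)%N ->
  exists u v, [/\ just_above u v, vrow u = j & vcol u = i].
Proof.
move=> ij; have lt1 : (j.-1 < n)%N by exact: leq_ltn_trans (leq_pred j) (ltn_ord j).
have le1 : (i <= Ordinal lt1)%N by rewrite /= -ltnS prednK // (leq_ltn_trans _ ij).
exists (exist _ (j, i) (ltnW ij)), (exist _ (Ordinal lt1, i) le1).
by split=> //; rewrite /just_above eqxx /= prednK // (leq_ltn_trans _ ij).
Qed.

Lemma just_above_asym u v : just_above u v -> just_above v u = false.
Proof.
move=> /andP[_ /eqP e]; apply/negP => /andP[_ /eqP e'].
have : (vrow u < vrow v)%N by rewrite e'.
by rewrite e ltnNge leqnSn.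
Qed.

Lemma Sigma_graphsP (G : graph) : reflect
  ((forall u v, just_above u v -> arrow G u v (+) arrow G v u) /\
   (forall u v, arrow G u v -> just_above u v || just_above v u))
  (G \in Sigma_graphs).
Proof.
rewrite inE; apply: (iffP andP) => -[h1 h2]; split.
- by move=> u v; move/forallP/(_ u)/forallP/(_ v)/implyP: h1.
- by move=> u v; move/forallP/(_ u)/forallP/(_ v)/implyP: h2.
- by apply/forallP=> u; apply/forallP=> v; apply/implyP/h1.
- by apply/forallP=> u; apply/forallP=> v; apply/implyP/h2.
Qed.

Lemma Sigma_down (s : 'S_n) (G : graph) u v : just_above u v ->
  Q_graph G = perm_roots s positive_roots ->
  arrow G u v = (s^-1%g (vcol u) < s^-1%g (vrow u))%N.
Proof.
move=> uv QG; rewrite -mem_perm_roots -QG inE /= (just_above_col uv).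
by rewrite ltnNge ltnW ?(just_above_col uv) //= orbF (A_downE _ uv).
Qed.

Lemma G_perm_exists (s : 'S_n) :
  exists2 G, G \in Sigma_graphs & Q_graph G = perm_roots s positive_roots.
Proof.
pose G : graph := [set a |
  (just_above a.1 a.2 && (s^-1%g (vcol a.1) < s^-1%g (vrow a.1))%N)
  || (just_above a.2 a.1 && (s^-1%g (vrow a.2) < s^-1%g (vcol a.2))%N)].
have dn u v : just_above u v -> arrow G u v = (s^-1%g (vcol u) < s^-1%g (vrow u))%N.
  by move=> uv; rewrite /arrow inE /= uv (just_above_asym uv) orbF.
have up u v : just_above u v -> arrow G v u = (s^-1%g (vrow u) < s^-1%g (vcol u))%N.
  by move=> uv; rewrite /arrow inE /= uv (just_above_asym uv).
exists G.
  apply/Sigma_graphsP; split=> [u v uv|u v]; last first.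
    by rewrite /arrow inE => /orP[] /andP[->]; rewrite ?orbT.
  rewrite (dn _ _ uv) (up _ _ uv) ltn_neqAle [X in _ (+) X]ltnNge eq_sym.
  case: eqP => [/val_inj/perm_inj e|_] /=; last by case: leqP.
  by have := just_above_col uv; rewrite e ltnn.
apply/setP=> -[i j]; rewrite mem_perm_roots inE /=.
have [lt|lt|/val_inj ->] := ltngtP i j; last by rewrite ltnn.
- have [u [v [uv <- <-]]] := just_above_pair lt.
  by rewrite (A_downE _ uv) (dn _ _ uv) orbF.
- have [u [v [uv <- <-]]] := just_above_pair lt.
  by rewrite (A_upE _ uv) (up _ _ uv).
Qed.

Lemma G_permP (s : 'S_n) :
  G_perm s \in Sigma_graphs /\ Q_graph (G_perm s) = perm_roots s positive_roots.
Proof.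
rewrite /G_perm; case: pickP => [G /andP[SG /eqP QG]//|no].
by have [G SG QG] := G_perm_exists s; have := no G; rewrite SG QG eqxx.
Qed.

Lemma G_perm_unique (s : 'S_n) (G : graph) :
  G \in Sigma_graphs -> Q_graph G = perm_roots s positive_roots -> G = G_perm s.
Proof.
move=> SG QG; have [SH QH] := G_permP s.
have dn u v : just_above u v -> arrow G u v = arrow (G_perm s) u v.
  by move=> uv; rewrite (Sigma_down uv QG) (Sigma_down uv QH).
have up u v : just_above u v -> arrow G v u = arrow (G_perm s) v u.
  move=> uv; move/Sigma_graphsP: SG => [/(_ _ _ uv) + _].
  move/Sigma_graphsP: SH => [/(_ _ _ uv) + _]; rewrite dn //.
  by case: (arrow _ u v); case: (arrow _ v u); case: (arrow _ v u).
apply/setP=> -[u v]; rewrite -[LHS]/(arrow G u v) -[RHS]/(arrow (G_perm s) u v).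
case uv: (just_above u v); first exact: dn.
case vu: (just_above v u); first exact: up.
have no (H : graph) : H \in Sigma_graphs -> arrow H u v = false.
  by case/Sigma_graphsP=> _ h; apply/negP => /h; rewrite uv vu.
by rewrite !no.
Qed.

End Graphs.

Section Tableaux.
Variables (C : fieldType) (n : nat).

Definition tableau := {ffun vertex n -> C}.

Definition is_nat (x : C) : Prop := exists m : nat, x = m%:R.
Definition is_pos_nat (x : C) : Prop := exists m : nat, x = m.+1%:R.
Definition is_int (x : C) : Prop := exists m : int, x = m%:~R.

(* T_perm_col s X i d is the entry of column i in the d-th row below the
   top one. *)
Fixpoint T_perm_col (s : 'S_n) (X : 'rV[C]_n) (i : 'I_n) (d : nat) : C :=
  if d is d'.+1 then
    if A_down (G_perm s) (n.-1 - d') i then T_perm_col s X i d'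
    else T_perm_col s X i d' + 1
  else X 0 (s^-1%g i).

Definition T_perm (s : 'S_n) (X : 'rV[C]_n) : tableau :=
  [ffun v => T_perm_col s X (vcol v) (n.-1 - vrow v)].

Definition satisfies (G : graph n) (T : tableau) : Prop :=
  forall u v, arrow G u v ->
    if vrow v == (vrow u).+1 :> nat then is_pos_nat (T u - T v)
    else is_nat (T u - T v).

Definition realization (G : graph n) (T : tableau) : Prop :=
  satisfies G T /\
  forall u v, vrow u = vrow v -> ~~ top_row u ->
    is_int (T u - T v) -> same_component G u v.

Definition int_translate (T T' : tableau) : Prop :=
  exists2 z : {ffun vertex n -> int},
    forall v, top_row v -> z v = 0
  & forall v, T' v = T v + (z v)%:~R.

Definition full_tableau_graph (T : tableau) : graph n :=
  [set a | let: (u, v) := a in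
    [|| (vrow u == (vrow v).+1 :> nat) && `[< is_nat (T u - T v) >],
        ((vrow u).+1 == vrow v :> nat) && `[< is_pos_nat (T u - T v) >]
      | [&& top_row u, top_row v, u != v, `[< is_nat (T u - T v) >]
          & (T u == T v) ==> (vcol u < vcol v)%N]]].

Definition tableau_graph (T : tableau) : graph n :=
  transitive_reduction (full_tableau_graph T).

Definition add_delta (T : tableau) (v : vertex n) : tableau :=
  [ffun w => T w + (w == v)%:R].
Definition sub_delta (T : tableau) (v : vertex n) : tableau :=
  [ffun w => T w - (w == v)%:R].

Section GTModule.
Variables (G : graph n) (T0 : tableau).

Definition gt_basis : Type :=
  {T : tableau | `[< int_translate T0 T /\ realization G T >]}.

HB.instance Definition _ := Choice.on gt_basis.

Definition V_G := {malg C[gt_basis]}.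

HB.instance Definition _ := GRing.Lmodule.on V_G.

Definition gt_vec (T : tableau) : V_G :=
  if (insub T : option gt_basis) is Some b then << b >> else 0.

Definition row_denom (T : tableau) (v : vertex n) : C :=
  \prod_(w | (vrow w == vrow v) && (w != v)) (T v - T w).

Definition gt_formulas (a : 'M[C]_n -> V_G -> V_G) : Prop :=
  forall b : gt_basis, let T := val b in
  [/\ forall k k' : 'I_n, k' = k.+1 :> nat ->
        a (delta_mx k k') (gt_vec T) =
        - \sum_(v | vrow v == k)
            ((\prod_(w | vrow w == k') (T v - T w)) / row_denom T v)
              *: gt_vec (add_delta T v),
      forall k k' : 'I_n, k' = k.+1 :> nat ->
        a (delta_mx k' k) (gt_vec T) =
        \sum_(v | vrow v == k)
            ((\prod_(w | (vrow w).+1 == k :> nat) (T v - T w)) / row_denom T v)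
              *: gt_vec (sub_delta T v)
    & forall k : 'I_n,
        a (delta_mx k k) (gt_vec T) =
        (k%:R + \sum_(v | vrow v == k) T v
              - \sum_(w | (vrow w).+1 == k :> nat) T w) *: gt_vec T].

(* There is at most one such a, since the matrices occurring in gt_formulas
   generate gl_n as a Lie algebra. *)
Definition is_gt_action (a : 'M[C]_n -> V_G -> V_G) : Prop :=
  gl_action a /\ gt_formulas a.

Definition V_G_module (a : 'M[C]_n -> V_G -> V_G) (aP : is_gt_action a) :
  glModule C n := GlModule aP.1.

End GTModule.

Definition relation_graph (G : graph n) : Prop :=
  [/\ admissible_graph G, noncritical G
    & forall T, realization G T -> exists a, is_gt_action (G := G) (T0 := T) a].

Definition relation_module (M : glModule C n) : Prop :=
  exists (G : graph n) (T : tableau),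
    [/\ relation_graph G, realization G T
      & exists a (aP : is_gt_action (G := G) (T0 := T) a),
          gl_iso M (V_G_module aP)].

Definition perm_relation_module (s : 'S_n) (M : glModule C n) : Prop :=
  exists2 N : glModule C n, relation_module N & gl_iso M (gl_twist s N).

Definition lam_bar (lam : 'rV[C]_n) : 'rV[C]_n := \row_i (lam 0 i - i%:R).

Definition perm_relation_weight (s : 'S_n) (lam : 'rV[C]_n) : Prop :=
  relation_graph (tableau_graph (T_perm s (lam_bar lam))).

End Tableaux.

(* Main.v *)
(**
Every tableau of [V_G] is an eigenvector of the Cartan subalgebra and of the
elements [S_k = sum_(j < k) E_kj E_jk], the eigenvalue of [S_k] being half of
[sum_i l_ki^2 - sum_i l_(k-1)i^2 - (sum_i l_ki - sum_i l_(k-1)i)^2].  This is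
proved by induction on [k]: [E_(k+1)k E_kk - [S_k, E_(k+1)k]] is the operator
[E_(k+1)k] with the term [T(L - delta^ki)] multiplied by [l_ki + k - 1], and
[S_(k+1)] is read off from its commutator with [E_k(k+1)], a sum of residues of
[prod_y (t - y) / prod_x (t - x)] with [x = l_ki, l_ki + 1] and
[y = l_(k+1)j + 1, l_(k-1)j].  Double poles occur when [l_ki = l_kj + 1]; they
cancel, since otherwise a stretched realization of [G] would violate the
residue theorem, hence the relation [[E_k(k+1), E_(k+1)k] = E_kk - E_(k+1)(k+1)].

Since [S_k] separates the tableaux [T(L +- delta^ki)], [i = 1..k], and the
coefficients of the Gelfand-Tsetlin formulas do not vanish inside [V_G] for
[G = G(T(L))], the tableau [T_sigma] generates [V_G], and dually a submodule
on which the coefficient of [T_sigma] vanishes is zero.  The height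
[sum_k sigma^-1(k) E_kk] is minimal at [T_sigma], so [T_sigma] is a highest
weight vector for the twisted action, and [V_G] twisted by [sigma] is the
quotient of the Verma module by its largest proper submodule.
*)
From HB Require Import structures.
Require Import Defs.
From mathcomp Require Import all_boot all_order all_algebra all_fingroup.
From mathcomp Require Import finmap boolp ring zify ssrAC.
From mathcomp.multinomials Require Import monalg.
From mathcomp Require Import reals complex.

Set Implicit Arguments.
Unset Strict Implicit.
Unset Printing Implicit Defensive.
Import Order.TTheory GRing.Theory Num.Theory.
Local Open Scope ring_scope.

(** * Sums of residues *)

(** The hypothesis supplies, for each realization of [G], only some action obeying the
    Gelfand-Tsetlin formulas, so identities between coefficients are extracted from the relations of
    gl_n rather than proved from the formulas. Having an action for every realization is essential:
    stretching also moves the top row, so the stretched tableau need not lie in the module generated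
    from T_sigma.

    The quadratic elements S_k can replace the whole Gelfand-Tsetlin subalgebra because a single
    raising or lowering operator changes one entry of one row, and S_k then moves by an affine
    function of that entry; non-criticality makes the entries of a row below the top pairwise
    distinct.

    The height is needed because no formulas are at hand for E_pq with p and q not adjacent: such an
    operator would send T_sigma to a vector of too small a height, hence to zero.

    On the Verma side neither a PBW basis nor a weight space decomposition is available. The part
    away from the highest weight is described by eigenvectors of sum_j j E_jj, and polynomials in
    this operator isolate the top component of a vector. *)

Section Interpolation.
Variable C : fieldType.
Implicit Types (X Y : seq C) (x y : C) (f : {poly C}).

Local Notation mono X := (\prod_(x <- X) ('X - x%:P)).

(** [rem] deletes a single copy of [x], so at a simple pole this is the residue of prod_Y (t - y) /
    prod_X (t - x). At a repeated [x] the denominator is 0 and so is the value, the inverse of 0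
    being 0. *)
Definition residue X Y x : C :=
  (\prod_(y <- Y) (x - y)) / (\prod_(x' <- rem x X) (x - x')).

Lemma prod_sub_eq0 x Y : (\prod_(y <- Y) (x - y) == 0) = (x \in Y).
Proof.
elim: Y => [|y Y IH]; first by rewrite big_nil oner_eq0.
by rewrite big_cons mulf_eq0 IH subr_eq0 in_cons.
Qed.

Lemma horner_mono Y x : (mono Y).[x] = \prod_(y <- Y) (x - y).
Proof. by rewrite horner_prod; apply: eq_bigr => y _; rewrite !hornerE. Qed.

(** Lagrange interpolation: [f] and [g] have degree below [size X] and agree on the distinct points
    of [X], so their top coefficients agree. Reading the coefficient off ['X * f] avoids a truncated
    index when [X] is empty. *)
Lemma lagrange_coef X f : uniq X -> (size f <= size X)%N ->
  \sum_(x <- X) f.[x] / (\prod_(x' <- rem x X) (x - x')) = ('X * f)`_(size X).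
Proof.
move=> uX szf.
pose c x := f.[x] / (\prod_(x' <- rem x X) (x - x')).
pose g := \sum_(x <- X) c x *: mono (rem x X).
have szm x : x \in X -> size (mono (rem x X)) = size X.
  move=> xX; rewrite size_prod_XsubC size_rem // prednK //.
  by case: (X) xX.
have fg : f = g.
  apply/eqP; rewrite -subr_eq0; apply/eqP/(roots_geq_poly_eq0 _ uX).
    apply/allP => x xX; rewrite rootE hornerD hornerN /g horner_sum.
    rewrite (bigD1_seq x) //= [X in _ - (_ + X)]big1_seq.
      rewrite addr0 hornerZ horner_mono divfK ?subrr // prod_sub_eq0.
      by rewrite mem_rem_uniq // inE eqxx.
    move=> x' /andP[ne x'X]; rewrite hornerZ horner_mono; apply/eqP.
    by rewrite mulf_eq0 prod_sub_eq0 mem_rem_uniq // inE xX [x == _]eq_sym ne orbT.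
  rewrite (leq_trans (size_polyD _ _)) // geq_max szf size_polyN.
  apply/leq_sizeP => i lei; rewrite coef_sum big1_seq // => x xX.
  by rewrite coefZ nth_default ?mulr0 // szm.
rewrite [in RHS]fg mulr_sumr coef_sum; apply: eq_big_seq => x xX.
rewrite -scalerAr coefZ coefXM.
case: eqP => [/size0nil X0|_]; first by rewrite X0 in xX.
have := lead_coef_prod_XsubC (rem x X) xpredT id.
by rewrite /lead_coef szm // => ->; rewrite mulr1.
Qed.

Lemma coef_mono1 Y : ('X * mono Y)`_(size Y) = - \sum_(y <- Y) y.
Proof.
elim: Y => [|y Y IH]; first by rewrite !big_nil mulr1 coefX oppr0.
rewrite /= !big_cons mulrCA mulrBl coefB coefXM /= IH coefCM coefXM /=.
have := lead_coef_prod_XsubC Y xpredT id.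
by rewrite /lead_coef size_prod_XsubC /= => ->; ring.
Qed.

(** Vieta together with Newton's identity 2 e_2 = p_1^2 - p_2; the factor 2 keeps the recursion free
    of division. *)
Lemma coef_mono2 Y :
  2%:R * ('X^2 * mono Y)`_(size Y) = (\sum_(y <- Y) y) ^+ 2 - \sum_(y <- Y) y ^+ 2.
Proof.
elim: Y => [|y Y IH]; first by rewrite !big_nil mulr1 coefXn /=; ring.
rewrite /= !big_cons mulrCA mulrBl coefB coefXM coefCM /= mulrBr IH.
have -> : ('X^2 * mono Y)`_(size Y).+1 = - \sum_(j <- Y) j.
  by rewrite expr2 -mulrA coefXM /= coef_mono1.
by ring.
Qed.

Lemma size_mono Y : size (mono Y) = (size Y).+1.
Proof. by rewrite size_prod_XsubC. Qed.

Lemma coef_mono_top Y : (mono Y)`_(size Y) = 1.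
Proof.
have := lead_coef_prod_XsubC Y xpredT id.
by rewrite /lead_coef size_prod_XsubC /=.
Qed.

Section Residues.
Variables (X Y : seq C).
Hypothesis szXY : size X = size Y.

Let c1 := \sum_(x <- X) x - \sum_(y <- Y) y.

Lemma residue_sum0_uniq : uniq X -> \sum_(x <- X) residue X Y x = c1.
Proof.
(* Both products are monic of the same degree, so the difference can be interpolated; at the poles
   it takes the values of [mono Y]. *)
move=> uX; have szf : (size (mono Y - mono X)%R <= size X)%N.
  apply/leq_sizeP => j; rewrite leq_eqVlt => /orP[/eqP <-|lt].
    by rewrite coefB coef_mono_top szXY coef_mono_top subrr.
  by rewrite coefB !nth_default ?subrr // ?size_mono -?szXY.
have := lagrange_coef uX szf.
rewrite mulrBr coefB coef_mono1 szXY coef_mono1 opprK => e; rewrite /c1 [RHS]addrC -e.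
apply: eq_big_seq => x xX; rewrite /residue; congr (_ / _).
rewrite hornerD hornerN !horner_mono.
by have /eqP -> : \prod_(x' <- X) (x - x') == 0; rewrite ?prod_sub_eq0 // subr0.
Qed.

Lemma residue_sum1_uniq : uniq X ->
  2%:R * \sum_(x <- X) x * residue X Y x
    = c1 ^+ 2 + \sum_(x <- X) x ^+ 2 - \sum_(y <- Y) y ^+ 2.
Proof.
(* ['X + c1%:P] is the quotient of ['X * mono Y] by [mono X], and [f] is the remainder. *)
move=> uX; pose f := 'X * mono Y - ('X + c1%:P) * mono X.
have top (Z : seq C) : ('X * mono Z)`_(size Z).+1 = 1 by rewrite coefXM /= coef_mono_top.
have szf : (size f <= size X)%N.
  apply/leq_sizeP => j; rewrite /f mulrDl !(coefB, coefD) coefCM.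
  rewrite leq_eqVlt => /orP[/eqP <-|].
    by rewrite coef_mono1 szXY coef_mono1 -szXY coef_mono_top /c1; ring.
  rewrite leq_eqVlt => /orP[/eqP <-|lt].
    rewrite top szXY top nth_default ?size_mono ?szXY //; ring.
  have z (Z : seq C) : size Z = size X -> ('X * mono Z)`_j = 0.
    by move=> e; rewrite coefXM; case: eqP => // _; rewrite nth_default // size_mono e; lia.
  by rewrite !z // nth_default ?size_mono ?(ltnW lt) //; ring.
have e := lagrange_coef uX szf.
have -> : \sum_(x <- X) x * residue X Y x = ('X * f)`_(size X).
  rewrite -e; apply: eq_big_seq => x xX; rewrite /residue mulrA; congr (_ / _).
  rewrite /f hornerD hornerN !hornerM !hornerE !horner_mono.
  by have /eqP -> : \prod_(x' <- X) (x - x') == 0; rewrite ?prod_sub_eq0 // mulr0 subr0.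
have -> : 'X * f = 'X^2 * mono Y - 'X^2 * mono X - c1 *: ('X * mono X).
  by rewrite /f -mul_polyC; ring.
rewrite coefB coefB coefZ coef_mono1 !mulrBr coef_mono2 [in X in X - _]szXY coef_mono2.
by rewrite /c1; ring.
Qed.

End Residues.

Lemma rem_cons_perm x X Y : perm_eq X (x :: Y) -> perm_eq (rem x X) Y.
Proof.
move=> p; rewrite -(perm_cons x); apply: perm_trans (p); rewrite perm_sym.
by apply: perm_to_rem; rewrite (perm_mem p) mem_head.
Qed.

Lemma residue_perm X X' Y Y' x :
  perm_eq X X' -> perm_eq Y Y' -> residue X Y x = residue X' Y' x.
Proof.
move=> pX pY; rewrite /residue (perm_big _ pY); congr (_ / _).
have [xX|nxX] := boolP (x \in X).
  apply: perm_big; apply: rem_cons_perm; apply: (perm_trans pX); apply: perm_to_rem.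
  by rewrite -(perm_mem pX).
by rewrite !rem_id -?(perm_mem pX) //; exact: perm_big.
Qed.

Lemma residue_cancel x0 X Y x : x != x0 -> x \in X ->
  residue (x0 :: X) (x0 :: Y) x = residue X Y x.
Proof.
move=> ne xX; have p : perm_eq (x0 :: X) (x :: x0 :: rem x X).
  apply/seq.permP => a; have /seq.permP/(_ a) /= -> := perm_to_rem xX; lia.
rewrite /residue (perm_big _ (rem_cons_perm p)) /= !big_cons invfM mulrACA.
by rewrite divff ?mul1r // subr_eq0.
Qed.

Lemma residue_dup X Y x : (1 < count_mem x X)%N -> residue X Y x = 0.
Proof.
move=> c; rewrite /residue; suff /eqP -> : \prod_(x' <- rem x X) (x - x') == 0.
  by rewrite invr0 mulr0.
rewrite prod_sub_eq0 -has_pred1 has_count count_mem_rem eqxx; lia.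
Qed.

Lemma residue_root X Y x : x \in Y -> residue X Y x = 0.
Proof. by rewrite -prod_sub_eq0 /residue => /eqP ->; rewrite mul0r. Qed.

(* A multiple pole of [prod_Y (t - y) / prod_X (t - x)] cancels against the
   numerator, so the junk value [residue X Y x = 0] at a repeated [x] is the
   true residue there. *)
Definition poles_cancel X Y :=
  forall x, (1 < count_mem x X)%N -> (count_mem x X <= count_mem x Y)%N.

Lemma residue_sum_reduce (w : C -> C) X Y : size X = size Y -> poles_cancel X Y ->
  exists X' Y', [/\ uniq X', size X' = size Y',
    exists Z, perm_eq X (Z ++ X') /\ perm_eq Y (Z ++ Y')
  & \sum_(x <- X) w x * residue X Y x = \sum_(x <- X') w x * residue X' Y' x].
Proof.
elim: {X}(size X) {-2}X (leqnn (size X)) Y => [|m IH] X szX Y sz dup.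
  move: szX sz; rewrite leqn0 => /nilP -> /=; case: Y {dup} => // _.
  by exists [::], [::]; split=> //; exists [::].
have [uX|nuX] := boolP (uniq X); first by exists X, Y; split=> //; exists [::].
have [x0 c0] : exists x0, (1 < count_mem x0 X)%N.
  move: nuX; elim: (X) => //= x X1 IH1; rewrite negb_and negbK => /orP[x1|/IH1 [x0 c]].
    by exists x; rewrite eqxx add1n ltnS -has_count has_pred1.
  by exists x0; lia.
have c0Y := dup _ c0.
have inX : x0 \in X by rewrite -has_pred1 has_count; lia.
have inY : x0 \in Y by rewrite -has_pred1 has_count; lia.
have pX := perm_to_rem inX; have pY := perm_to_rem inY.
set X1 := rem x0 X in pX *; set Y1 := rem x0 Y in pY *.
have cX x : count_mem x X = ((x0 == x) + count_mem x X1)%N by rewrite (seq.permP pX).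
have cY x : count_mem x Y = ((x0 == x) + count_mem x Y1)%N by rewrite (seq.permP pY).
have [|||X' [Y' [uX' szX' [Z [pZX pZY]] e]]] := IH X1 _ Y1.
- by have := perm_size pX => /= e; rewrite -ltnS -e.
- have := perm_size pX; have := perm_size pY; rewrite /= sz; lia.
- by move=> x; move: (dup x); rewrite cX cY; lia.
exists X', Y'; split=> //.
  exists (x0 :: Z); split; [apply: perm_trans pX _ | apply: perm_trans pY _];
    by rewrite /= perm_cons.
rewrite -e; have z0 : residue X1 Y1 x0 = 0.
  by apply: residue_root; rewrite -has_pred1 has_count; have := cY x0; rewrite eqxx; lia.
rewrite (perm_big _ pX) /= big_cons (residue_dup _ c0) mulr0 add0r.
apply: eq_big_seq => x xX1; have [->|ne] := eqVneq x x0; last first.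
  by rewrite (residue_perm _ pX pY) residue_cancel.
by rewrite z0 residue_dup.
Qed.

Lemma residue_sum0 X Y : size X = size Y -> poles_cancel X Y ->
  \sum_(x <- X) residue X Y x = \sum_(x <- X) x - \sum_(y <- Y) y.
Proof.
move=> sz dup; have [X' [Y' [uX' sz' [Z [pX pY]] e]]] := residue_sum_reduce (fun=> 1) sz dup.
under eq_bigr do rewrite -[residue _ _ _]mul1r.
rewrite e; under eq_bigr do rewrite mul1r.
rewrite residue_sum0_uniq // !(perm_big _ pX) !(perm_big _ pY) /= !big_cat /=; ring.
Qed.

Lemma residue_sum1 X Y : size X = size Y -> poles_cancel X Y ->
  2%:R * \sum_(x <- X) x * residue X Y x
    = (\sum_(x <- X) x - \sum_(y <- Y) y) ^+ 2
      + \sum_(x <- X) x ^+ 2 - \sum_(y <- Y) y ^+ 2.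
Proof.
move=> sz dup; have [X' [Y' [uX' sz' [Z [pX pY]] e]]] := residue_sum_reduce id sz dup.
rewrite e residue_sum1_uniq // !(perm_big _ pX) !(perm_big _ pY) /= !big_cat /=; ring.
Qed.

(* If exactly one double pole fails to cancel, its true residue is missing from
   the sum and the residue theorem fails. *)
Lemma residue_sum0_bad X Y x0 : size X = size Y ->
  (forall x, (1 < count_mem x X)%N -> x = x0) ->
  count_mem x0 X = 2%N -> count_mem x0 Y = 1%N ->
  \sum_(x <- X) residue X Y x <> \sum_(x <- X) x - \sum_(y <- Y) y.
Proof.
move=> sz only cX cY.
have inX : x0 \in X by rewrite -has_pred1 has_count cX.
have inY : x0 \in Y by rewrite -has_pred1 has_count cY.
have pX := perm_to_rem inX; have pY := perm_to_rem inY.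
set X1 := rem x0 X in pX *; set Y1 := rem x0 Y in pY *.
have c1X x : count_mem x X = ((x0 == x) + count_mem x X1)%N by rewrite (seq.permP pX).
have c1Y x : count_mem x Y = ((x0 == x) + count_mem x Y1)%N by rewrite (seq.permP pY).
have uX1 : uniq X1.
  apply: count_mem_uniq => x; have le1 : (count_mem x X1 <= 1)%N.
    have [e|ne] := eqVneq x0 x; first by move: (c1X x0) cX; rewrite -e eqxx; lia.
    rewrite leqNgt; apply/negP => lt; have := only x; rewrite c1X (negPf ne) add0n => /(_ lt) e.
    by rewrite e eqxx in ne.
  by rewrite -has_pred1 has_count; lia.
have sz1 : size X1 = size Y1 by have := perm_size pX; have := perm_size pY; rewrite /= sz; lia.
have x0X1 : x0 \in X1 by rewrite -has_pred1 has_count; have := c1X x0; rewrite eqxx; lia.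
(* With one copy of [x0] removed from both lists all poles are simple and the right-hand side is the
   same. Comparing the two sums term by term would force [residue X1 Y1 x0 = 0], although [x0] is no
   longer in [Y1]. *)
have e1 := residue_sum0_uniq sz1 uX1.
rewrite (perm_big _ pX) [in X in _ = X](perm_big _ pX) (perm_big _ pY) /= !big_cons.
rewrite (@residue_dup X Y x0) ?cX // add0r => e.
have {e} : \sum_(j <- X1) residue X Y j = \sum_(j <- X1) residue X1 Y1 j.
  by rewrite e e1; ring.
rewrite (bigD1_seq x0) //= [in X in _ = X](bigD1_seq x0) //=.
rewrite (@residue_dup X Y x0) ?cX // add0r.
have -> : \sum_(i <- X1 | i != x0) residue X Y i = \sum_(i <- X1 | i != x0) residue X1 Y1 i.
  rewrite big_seq_cond [RHS]big_seq_cond; apply: eq_bigr => x /andP[xX1 ne].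
  by rewrite (residue_perm _ pX pY) residue_cancel.
move/eqP; rewrite eq_sym -subr_eq0 addrK => /eqP/eqP.
rewrite /residue mulf_eq0 invr_eq0 !prod_sub_eq0 (mem_rem_uniq _ uX1) inE eqxx /= orbF.
by rewrite -has_pred1 has_count; have := c1Y x0; rewrite eqxx; lia.
Qed.
End Interpolation.

(** * Rows and realizations *)

Section Rows.
Variable n : nat.

Definition in_row (k : 'I_n) : pred (vertex n) := fun v => vrow v == k.
Definition below_row (k : 'I_n) : pred (vertex n) := fun v => (vrow v).+1 == k :> nat.

Lemma card_row (k : 'I_n) : #|in_row k| = k.+1.
Proof.
have ltnc (c : 'I_k.+1) : (c < n)%N by exact: leq_trans (ltn_ord c) (ltn_ord k).
have lek (c : 'I_k.+1) : (Ordinal (ltnc c) <= k)%N by rewrite /= -ltnS ltn_ord.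
pose f (c : 'I_k.+1) : vertex n := exist _ (k, Ordinal (ltnc c)) (lek c).
have f_inj : injective f by move=> c d [] /val_inj.
rewrite -[RHS](card_ord k.+1) -(card_codom f_inj); apply: eq_card => v.
rewrite unfold_in; apply/eqP/codomP => [vk|[c ->] //].
have lt : (vcol v < k.+1)%N by rewrite ltnS -vk; exact: (valP v).
by exists (Ordinal lt); apply: vertex_eqP => //; apply: val_inj.
Qed.

Lemma card_below_row (k : 'I_n) : #|below_row k| = k.
Proof.
case: k => -[|j] lt; first by apply: eq_card0 => v; rewrite unfold_in.
have lt' : (j < n)%N by lia.
have e := card_row (Ordinal lt').
by rewrite -[RHS]e; apply: eq_card => v; rewrite !unfold_in.
Qed.

End Rows.

Section Realizations.
Variables (C : numFieldType) (n : nat).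
Implicit Types (T : tableau C n) (G : graph n) (u v w : vertex n).

Lemma is_intD (x y : C) : is_int x -> is_int y -> is_int (x + y).
Proof. by move=> [a ->] [b ->]; exists (a + b); rewrite rmorphD. Qed.

Lemma is_intN (x : C) : is_int x -> is_int (- x).
Proof. by move=> [a ->]; exists (- a); rewrite rmorphN. Qed.

Lemma is_int_sym (x y : C) : is_int (x - y) -> is_int (y - x).
Proof. by move/is_intN; rewrite opprB. Qed.

Lemma is_int_trans (y x z : C) : is_int (x - y) -> is_int (y - z) -> is_int (x - z).
Proof. by move=> h1 h2; have := is_intD h1 h2; rewrite addrA subrK. Qed.

Lemma nat_is_int (m : nat) : is_int (m%:R : C).
Proof. by exists m%:Z. Qed.

(* [gap T u v] bounds the difference along an oriented path by its number of
   upward arrows. *)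
Definition gap T u v := exists2 m : nat, T u - T v = m%:R & (vrow v <= vrow u + m)%N.

Lemma gap_refl T u : gap T u u.
Proof. by exists 0%N; rewrite ?subrr ?addn0. Qed.

Lemma gap_trans T v u w : gap T u v -> gap T v w -> gap T u w.
Proof.
move=> [m e l] [m' e' l']; exists (m + m')%N; last by lia.
by rewrite natrD -e -e' addrA subrK.
Qed.

Lemma gap_connect T (e : rel (vertex n)) :
  (forall u v, e u v -> gap T u v) -> forall u v, connect e u v -> gap T u v.
Proof.
move=> he u v /connectP[p pth ->] {v}; elim: p u pth => [|w p IH] u /=.
  by move=> _; exact: gap_refl.
by move=> /andP[/he g /IH]; exact: gap_trans.
Qed.

Lemma reachable_gap G T u v :
  admissible_graph G -> satisfies G T -> reachable G u v -> gap T u v.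
Proof.
move=> [adm _] sat; apply: gap_connect => {}u {}v uv; have := sat _ _ uv.
case: eqP => [e|ne] [m em]; first by exists m.+1 => //; lia.
exists m => //; case/or3P: (adm _ _ uv) => [/eqP|/eqP|] //; first by lia.
by rewrite /top_row => /andP[/eqP e1 /eqP e2]; lia.
Qed.

Lemma full_graph_gap T u v : arrow (full_tableau_graph T) u v -> gap T u v.
Proof.
rewrite /arrow inE => /or3P[/andP[/eqP e /asboolP[m em]]|/andP[/eqP e /asboolP[m em]]|].
- by exists m => //; lia.
- by exists m.+1 => //; lia.
case/and5P=> /eqP tu /eqP tv _ /asboolP[m em] _; exists m => //; lia.
Qed.

Lemma tableau_graph_reachable T u v :
  reachable (tableau_graph T) u v = reachable (full_tableau_graph T) u v.
Proof.
rewrite /tableau_graph /transitive_reduction; case: arg_minnP => [|H sH _].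
  by apply/forallP => x; apply/forallP => y.
by apply/eqP; move/forallP/(_ u)/forallP/(_ v): sH.
Qed.

Lemma reachable_component G u v : reachable G u v -> same_component G u v.
Proof. by apply: connect_sub => x y xy; apply: connect1; rewrite /= xy. Qed.

Lemma same_component_sym G u v : same_component G u v = same_component G v u.
Proof. by apply: sym_connect_sym => x y; rewrite /= orbC. Qed.

Lemma component_is_int G T u v :
  satisfies G T -> same_component G u v -> is_int (T u - T v).
Proof.
move=> sat; have arr x y : arrow G x y -> is_int (T x - T y).
  by move/sat; case: ifP => _ [m ->]; apply: nat_is_int.
move=> /connectP[p pth ->] {v}; elim: p u pth => [|w p IH] u /=.
  by rewrite subrr => _; exists 0.
move=> /andP[/orP[] /arr h /IH]; apply: is_int_trans => //.
exact: is_int_sym.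
Qed.

(* The first arrow of an oriented path inside a row leaves the row, hence
   forces the strict inequality. *)
Lemma reachable_row G T u v :
  admissible_graph G -> satisfies G T -> vrow u = vrow v -> ~~ top_row u ->
  u != v -> reachable G u v ->
  exists2 w, gap T w v &
    (vrow w = (vrow u).+1 :> nat /\ exists m : nat, T u - T w = m.+1%:R) \/
    (vrow u = (vrow w).+1 :> nat /\ exists m : nat, T u - T w = m%:R).
Proof.
move=> adm sat row ntop ne /connectP[[|w p] /=]; first by move=> _ e; rewrite e eqxx in ne.
case/andP=> uw pth e; exists w.
  by apply: (reachable_gap adm sat); apply/connectP; exists p.
have := sat _ _ uw; case/or3P: (adm.1 _ _ uw) => [/eqP e1|/eqP e1|].
- by case: eqP => [e2|_ [m em]]; [lia|right; split=> //; exists m].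
- by rewrite e1 eqxx => -[m em]; left; split=> //; exists m.
- by rewrite (negPf ntop).
Qed.

Lemma reachable_row_pos G T u v :
  admissible_graph G -> satisfies G T -> vrow u = vrow v -> ~~ top_row u ->
  u != v -> reachable G u v -> exists m : nat, T u - T v = m.+1%:R.
Proof.
move=> adm sat row ntop ne uv; have [w [m' em' lm']] := reachable_row adm sat row ntop ne uv.
have row' : vrow u = vrow v :> nat by rewrite row.
case=> -[e1 [m em]].
  by exists (m + m')%N; rewrite -addSn natrD -em -em'; ring.
by exists (m + m').-1; rewrite prednK ?natrD -?em -?em'; [ring|lia].
Qed.

(** Equal entries have an integral difference, so they share a component and, by non-criticality,
    are joined by a path; a path between distinct vertices of one row forces a strict inequality. *)
Lemma row_distinct G T u v : admissible_graph G -> noncritical G ->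
  realization G T -> vrow u = vrow v -> ~~ top_row u -> u != v -> T u != T v.
Proof.
move=> adm nc [sat int] row ntop ne; apply/eqP => e.
have ntopv : ~~ top_row v by move: ntop; rewrite /top_row row.
have pos x y : vrow x = vrow y -> ~~ top_row x -> x != y -> T x = T y -> ~~ reachable G x y.
  move=> r nt nxy exy; apply/negP => /(reachable_row_pos adm sat r nt nxy)[m].
  by rewrite exy subrr => /esym/eqP; rewrite pnatr_eq0.
have h : is_int (T u - T v) by rewrite e subrr; exists 0.
case/orP: (nc _ _ row ntop (int _ _ row ntop h)).
  by apply/negP; apply: pos.
by apply/negP; apply: pos => //; rewrite eq_sym.
Qed.

Section TableauGraph.
Variable T0 : tableau C n.
Let G := tableau_graph T0.

Lemma tableau_graph_gap u v : reachable G u v -> gap T0 u v.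
Proof.
rewrite tableau_graph_reachable; apply: gap_connect; exact: full_graph_gap.
Qed.

(** The transitive reduction is controlled only through reachability, so an arrow of [G] is treated
    as a path of the full graph. The row bound in [gap] recovers strictness for an arrow pointing
    up. *)
Lemma tableau_graph_satisfies : satisfies G T0.
Proof.
move=> u v uv; have [m em lm] := tableau_graph_gap (connect1 uv).
case: eqP => [e|_]; last by exists m.
by exists m.-1; rewrite prednK //; lia.
Qed.

Lemma consecutive_reachable u v : vrow u = (vrow v).+1 :> nat ->
  is_int (T0 u - T0 v) -> reachable G u v || reachable G v u.
Proof.
move=> row [m em]; rewrite !tableau_graph_reachable /reachable.
case: m em => m em; [rewrite (@connect1 _ (arrow _) u v) //|
                     rewrite (@connect1 _ (arrow _) v u) ?orbT //];
  rewrite /arrow inE row eqxx /=.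
  by apply/orP; left; apply/asboolP; exists m.
apply/orP; right; apply/orP; left; apply/asboolP; exists m.
by rewrite -opprB em NegzE rmorphN opprK.
Qed.

Lemma top_reachable u v : top_row u -> top_row v ->
  is_int (T0 u - T0 v) -> reachable G u v || reachable G v u.
Proof.
move=> tu tv h; have [->|ne] := eqVneq u v; first by rewrite /reachable connect0.
rewrite !tableau_graph_reachable.
have dir x y : top_row x -> top_row y -> x != y -> is_nat (T0 x - T0 y) ->
    (T0 x == T0 y) ==> (vcol x < vcol y)%N -> reachable (full_tableau_graph T0) x y.
  move=> tx ty nxy hn ht; apply: connect1; rewrite /arrow inE tx ty nxy ht.
  by rewrite asboolT ?orbT.
have row : vrow u = vrow v.
  by move: tu tv; rewrite /top_row => /eqP e1 /eqP e2; apply: ord_inj; lia.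
have [e|neT] := eqVneq (T0 u) (T0 v).
  have n0 : is_nat (0 : C) by exists 0%N.
  have [lt|lt|/val_inj ec] := ltngtP (vcol u) (vcol v).
  - by apply/orP; left; apply: dir => //; [rewrite e subrr | rewrite e eqxx lt].
  - apply/orP; right; apply: dir => //; first by rewrite eq_sym.
      by rewrite e subrr.
    by rewrite e eqxx lt.
  - by move: ne; rewrite (vertex_eqP row ec) eqxx.
case: h => -[m em|m em].
  apply/orP; left; apply: dir => //; first by exists m.
  by rewrite (negPf neT).
apply/orP; right; apply: dir => //; first by rewrite eq_sym.
  by exists m.+1; rewrite -opprB em NegzE rmorphN opprK.
by rewrite eq_sym (negPf neT).
Qed.

End TableauGraph.

End Realizations.

(** * Modules over gl_n and the Gelfand-Tsetlin coefficients *)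

Section GlModuleTheory.
Variables (C : fieldType) (n : nat) (M : glModule C n).
Implicit Types (x y : 'M[C]_n) (u v : M) (i j k l : 'I_n).

Lemma gl_actP_l v : linear (fun x => gl_act x v). Proof. by case: (gl_actP M). Qed.
Lemma gl_actP_r x : linear (@gl_act _ _ M x). Proof. by case: (gl_actP M). Qed.

Lemma gl_actD x u v : gl_act x (u + v) = gl_act x u + gl_act x v.
Proof. by rewrite -[u]scale1r gl_actP_r !scale1r. Qed.
Lemma gl_act0 x : gl_act x (0 : M) = 0.
Proof. by apply: (@addrI _ (gl_act x 0)); rewrite -gl_actD !addr0. Qed.
Lemma gl_actZ x c v : gl_act x (c *: v) = c *: gl_act x v.
Proof. by rewrite -[c *: v]addr0 gl_actP_r gl_act0 addr0. Qed.
Lemma gl_actN x v : gl_act x (- v) = - gl_act x v.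
Proof. by rewrite -scaleN1r gl_actZ scaleN1r. Qed.
Lemma gl_actB x u v : gl_act x (u - v) = gl_act x u - gl_act x v.
Proof. by rewrite gl_actD gl_actN. Qed.
Lemma gl_act_sum x (I : Type) (r : seq I) (P : pred I) (F : I -> M) :
  gl_act x (\sum_(i <- r | P i) F i) = \sum_(i <- r | P i) gl_act x (F i).
Proof. exact: (big_morph _ (@gl_actD x) (gl_act0 x)). Qed.

Lemma gl_actDl x y v : gl_act (x + y) v = gl_act x v + gl_act y v.
Proof. by rewrite -[x]scale1r gl_actP_l !scale1r. Qed.
Lemma gl_act0l v : gl_act (0 : 'M[C]_n) v = 0.
Proof. by apply: (@addrI _ (gl_act 0 v)); rewrite -gl_actDl !addr0. Qed.
Lemma gl_actZl c x v : gl_act (c *: x) v = c *: gl_act x v.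
Proof. by rewrite -[c *: x]addr0 gl_actP_l gl_act0l addr0. Qed.
Lemma gl_actNl x v : gl_act (- x) v = - gl_act x v.
Proof. by rewrite -(scaleN1r x) gl_actZl scaleN1r. Qed.
Lemma gl_act_suml v (I : Type) (r : seq I) (P : pred I) (F : I -> 'M[C]_n) :
  gl_act (\sum_(i <- r | P i) F i) v = \sum_(i <- r | P i) gl_act (F i) v.
Proof. exact: (big_morph (fun x => gl_act x v) (fun x y => gl_actDl x y v) (gl_act0l v)). Qed.

Lemma gl_act_comm x y v :
  gl_act x (gl_act y v) = gl_act y (gl_act x v) + gl_act (gl_bracket x y) v.
Proof. by case: (gl_actP M) => _ _ ->; rewrite addrC subrK. Qed.

Lemma delta_bracket i j k l : gl_bracket (delta_mx i j) (delta_mx k l)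
  = (j == k)%:R *: delta_mx i l - (l == i)%:R *: delta_mx k j :> 'M[C]_n.
Proof.
rewrite /gl_bracket; congr (_ - _).
  by have [->|ne] := eqVneq j k; rewrite ?mul_delta_mx ?scale1r // mul_delta_mx_0 ?scale0r.
by have [->|ne] := eqVneq l i; rewrite ?mul_delta_mx ?scale1r // mul_delta_mx_0 ?scale0r.
Qed.

Definition unit_act i j v : M := gl_act (delta_mx i j) v.

Lemma unit_act_comm i j k l v : unit_act i j (unit_act k l v) =
  unit_act k l (unit_act i j v) + (j == k)%:R *: unit_act i l v
    - (l == i)%:R *: unit_act k j v.
Proof.
by rewrite /unit_act gl_act_comm delta_bracket gl_actDl gl_actNl !gl_actZl addrA.
Qed.

Lemma unit_actD i j u v : unit_act i j (u + v) = unit_act i j u + unit_act i j v.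
Proof. exact: gl_actD. Qed.
Lemma unit_actB i j u v : unit_act i j (u - v) = unit_act i j u - unit_act i j v.
Proof. exact: gl_actB. Qed.
Lemma unit_actZ i j c v : unit_act i j (c *: v) = c *: unit_act i j v.
Proof. exact: gl_actZ. Qed.
Lemma unit_act_sum i j (I : Type) (r : seq I) (P : pred I) (F : I -> M) :
  unit_act i j (\sum_(i <- r | P i) F i) = \sum_(k <- r | P k) unit_act i j (F k).
Proof. exact: gl_act_sum. Qed.

(** Two instances matter: [d = sigma^-1] gives the height on tableaux, and [d j = j] the grading of
    highest weight modules. *)
Definition cartan_act (d : 'I_n -> C) v : M := \sum_k d k *: unit_act k k v.

Lemma cartan_act_comm d i j v : cartan_act d (unit_act i j v)
  = unit_act i j (cartan_act d v) + (d i - d j) *: unit_act i j v.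
Proof.
rewrite /cartan_act unit_act_sum.
have term k : d k *: unit_act k k (unit_act i j v) = unit_act i j (d k *: unit_act k k v)
    + (((k == i)%:R * d k) *: unit_act k j v - ((j == k)%:R * d k) *: unit_act i k v).
  rewrite unit_act_comm unit_actZ -addrA scalerDr; congr (_ + _).
  by rewrite scalerBr !scalerA ![_%:R * d k]mulrC.
rewrite (eq_bigr _ (fun k _ => term k)) big_split /=; congr (_ + _).
rewrite sumrB (bigD1 i) //= eqxx mul1r big1 ?addr0 => [|k /negPf ->]; last first.
  by rewrite mul0r scale0r.
rewrite (bigD1 j) //= eqxx mul1r big1 ?addr0 => [|k]; first by rewrite scalerBl.
by rewrite eq_sym => /negPf ->; rewrite mul0r scale0r.
Qed.

End GlModuleTheory.

(** * Poles and zeros attached to a row *)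

Section RowPolynomials.
Variables (C : fieldType) (n : nat).
Implicit Types (T : tableau C n) (v w : vertex n).

(** The pole [T v] belongs to lowering and then raising [v], the pole [T v + 1] to raising and then
    lowering it. The zeros are the values at which a neighbour in an adjacent row makes the
    corresponding product vanish. *)
Definition row_poles T (k : 'I_n) : seq C :=
  [seq T v | v <- enum (in_row k)] ++ [seq T v + 1 | v <- enum (in_row k)].
Definition row_zeros T (k k' : 'I_n) : seq C :=
  [seq T w + 1 | w <- enum (in_row k')] ++ [seq T w | w <- enum (below_row k)].

Definition gt_raise T (k' : 'I_n) v : C :=
  - ((\prod_(w | vrow w == k') (T v - T w)) / row_denom T v).
Definition gt_lower T (k : 'I_n) v : C :=
  (\prod_(w | (vrow w).+1 == k :> nat) (T v - T w)) / row_denom T v.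
Definition gt_weight T (k : 'I_n) : C :=
  k%:R + \sum_(v | vrow v == k) T v - \sum_(w | (vrow w).+1 == k :> nat) T w.

Variables (T : tableau C n) (k k' : 'I_n).
Hypothesis kk' : k' = k.+1 :> nat.

Lemma below_next v : ((vrow v).+1 == k' :> nat) = (vrow v == k).
Proof. by rewrite kk' eqSS. Qed.

Lemma size_poles_zeros : size (row_poles T k) = size (row_zeros T k k').
Proof.
by rewrite !size_cat !size_map -!cardE !card_row card_below_row kk'; lia.
Qed.

Lemma big_poles (F : C -> C) : \sum_(x <- row_poles T k) F x =
  \sum_(v | vrow v == k) F (T v) + \sum_(v | vrow v == k) F (T v + 1).
Proof. by rewrite /row_poles big_cat !big_map !big_enum. Qed.

Lemma big_zeros (F : C -> C) : \sum_(x <- row_zeros T k k') F x =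
  \sum_(v | vrow v == k') F (T v + 1) + \sum_(v | (vrow v).+1 == k :> nat) F (T v).
Proof. by rewrite /row_zeros big_cat !big_map !big_enum. Qed.

Lemma prod_zeros (F : C -> C) : \prod_(x <- row_zeros T k k') F x =
  (\prod_(v | vrow v == k') F (T v + 1)) * \prod_(v | (vrow v).+1 == k :> nat) F (T v).
Proof. by rewrite /row_zeros big_cat !big_map !big_enum. Qed.

Lemma sum_const_row (j : 'I_n) (c : C) : \sum_(v | vrow v == j) c = c *+ j.+1.
Proof. by rewrite sumr_const -(card_row j). Qed.

Lemma weight_diff : \sum_(x <- row_poles T k) x - \sum_(y <- row_zeros T k k') y
  = gt_weight T k - gt_weight T k'.
Proof.
rewrite (big_poles id) (big_zeros id) /gt_weight (eq_bigl _ _ below_next).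
(* The shifts by 1 contribute [k.+1] for the poles and [k.+2] for the zeros; the surplus -1 is the
   difference of the constants [k] and [k'] in the weights. *)
by rewrite !big_split /= !sum_const_row kk' -[k.+2]addn1 -addn1 !mulrnDr; ring.
Qed.

Lemma poles_perm_lower v : vrow v == k -> perm_eq (row_poles T k)
  (T v :: [seq T w | w <- enum (in_row k) & w != v] ++ [seq T w + 1 | w <- enum (in_row k)]).
Proof.
move=> vk; rewrite -cat_cons perm_cat2r -map_cons; apply: perm_map.
have vE : v \in enum (in_row k) by rewrite mem_enum.
by rewrite -rem_filter ?enum_uniq //; apply: perm_to_rem.
Qed.

Lemma poles_perm_raise v : vrow v == k -> perm_eq (row_poles T k)
  (T v + 1 :: [seq T w | w <- enum (in_row k)] ++ [seq T w + 1 | w <- enum (in_row k) & w != v]).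
Proof.
move=> vk; have vE : v \in enum (in_row k) by rewrite mem_enum.
have p := perm_map (fun w => T w + 1) (perm_to_rem vE).
apply/seq.permP => a; rewrite -rem_filter ?enum_uniq // /row_poles count_cat (seq.permP p).
by rewrite /= count_cat addnCA.
Qed.

Lemma prod_enum_row (F : vertex n -> C) :
  \prod_(w <- enum (in_row k)) F w = \prod_(w | vrow w == k) F w.
Proof. by rewrite big_enum. Qed.

Lemma prod_enum_row1 v (F : vertex n -> C) :
  \prod_(w <- enum (in_row k) | w != v) F w = \prod_(w | (vrow w == k) && (w != v)) F w.
Proof. by rewrite big_enum_cond. Qed.

(** Among the remaining poles, the factor [T v - (T v + 1) = -1] absorbs the sign of [gt_raise]. In
    [residue_raise] the corresponding factor is 1, which is why a sign survives there. *)
Lemma residue_lower v : vrow v == k ->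
  gt_lower T k v * gt_raise (sub_delta T v) k' v
    = residue (row_poles T k) (row_zeros T k k') (T v).
Proof.
move=> vk; have ne w j : vrow w == j -> j != k -> (w == v) = false.
  by move=> /eqP wj nj; apply/negP => /eqP e; rewrite -wj e vk in nj.
rewrite /residue (perm_big _ (rem_cons_perm (poles_perm_lower vk))) /=.
rewrite prod_zeros big_cat /= !big_map big_filter prod_enum_row prod_enum_row1 /=.
rewrite (bigD1 v (P := fun w => vrow w == k)) //= opprD addrA subrr add0r.
rewrite /gt_lower /gt_raise /row_denom.
have -> : \prod_(w | vrow w == k') (sub_delta T v v - sub_delta T v w)
   = \prod_(w | vrow w == k') (T v - (T w + 1)).
  apply: eq_bigr => w wk; have -> : sub_delta T v w = T w.
    by rewrite ffunE (ne _ _ wk) ?subr0 //; apply/eqP => e; move: kk'; rewrite e; lia.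
  by rewrite ffunE eqxx /=; ring.
have -> : \prod_(w | (vrow w == vrow v) && (w != v)) (sub_delta T v v - sub_delta T v w)
   = \prod_(i | (vrow i == k) && (i != v)) (T v - (T i + 1)).
  rewrite (eqP vk); apply: eq_bigr => w /andP[_ nw].
  by rewrite !ffunE eqxx (negPf nw) /= subr0; ring.
by rewrite (eqP vk) mulN1r !mulrN invrN !invfM; ring.
Qed.

Lemma residue_raise v : vrow v == k ->
  gt_raise T k' v * gt_lower (add_delta T v) k v
    = - residue (row_poles T k) (row_zeros T k k') (T v + 1).
Proof.
move=> vk.
rewrite /residue (perm_big _ (rem_cons_perm (poles_perm_raise vk))) /=.
rewrite prod_zeros big_cat /= !big_map big_filter prod_enum_row prod_enum_row1 /=.
rewrite (bigD1 v (P := fun w => vrow w == k)) //= [T v + 1 - T v]addrC addKr mul1r.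
rewrite /gt_lower /gt_raise /row_denom.
have -> : \prod_(w | (vrow w).+1 == k :> nat) (add_delta T v v - add_delta T v w)
   = \prod_(w | (vrow w).+1 == k :> nat) (T v + 1 - T w).
  apply: eq_bigr => w wk; rewrite !ffunE eqxx; case: eqP => [e|_]; last by rewrite /= addr0.
  by move: wk; rewrite e (eqP vk) => /eqP; lia.
have -> : \prod_(w | (vrow w == vrow v) && (w != v)) (add_delta T v v - add_delta T v w)
   = \prod_(i | (vrow i == k) && (i != v)) (T v + 1 - T i).
  rewrite (eqP vk); apply: eq_bigr => w /andP[_ nw].
  by rewrite !ffunE eqxx (negPf nw) addr0.
have -> : \prod_(w | vrow w == k') (T v + 1 - (T w + 1)) = \prod_(w | vrow w == k') (T v - T w).
  by apply: eq_bigr => w _; ring.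
have -> : \prod_(i | (vrow i == k) && (i != v)) (T v + 1 - (T i + 1))
    = \prod_(i | (vrow i == k) && (i != v)) (T v - T i).
  by apply: eq_bigr => w _; ring.
by rewrite (eqP vk) !invfM /in_row; ring.
Qed.

End RowPolynomials.

(** * Unit moves and membership in the basis *)

Section Neighbours.
Variables (C : numFieldType) (n : nat).
Implicit Types (T : tableau C n) (G : graph n) (u v w : vertex n).

Lemma delta_comm T v w : sub_delta (add_delta T v) w = add_delta (sub_delta T w) v.
Proof. by apply/ffunP => x; rewrite !ffunE; ring. Qed.

Lemma add_deltaK T v : sub_delta (add_delta T v) v = T.
Proof. by apply/ffunP => x; rewrite !ffunE; ring. Qed.

Lemma sub_deltaK T v : add_delta (sub_delta T v) v = T.
Proof. by rewrite -delta_comm add_deltaK. Qed.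

Lemma delta_inj T v w v' w' : v != w ->
  sub_delta (add_delta T v') w' = sub_delta (add_delta T v) w -> v' = v /\ w' = w.
Proof.
move=> nvw /ffunP e; have := e v; have := e w; rewrite !ffunE !eqxx (negPf nvw).
rewrite [w == v]eq_sym (negPf nvw) /= => /eqP ew /eqP ev; split.
  apply/eqP; apply: contraTT ev => nv; rewrite [v == v']eq_sym (negPf nv) /=.
  rewrite -subr_eq0.
  have -> : T v + 0 - (v == w')%:R - (T v + 1 - 0) = - ((v == w') + 1)%:R :> C.
    by rewrite natrD; ring.
  by rewrite oppr_eq0 pnatr_eq0 addn1.
apply/eqP; apply: contraTT ew => nw; rewrite [w == w']eq_sym (negPf nw) /=.
rewrite -subr_eq0.
have -> : T w + (w == v')%:R - 0 - (T w + 0 - 1) = ((w == v') + 1)%:R :> C.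
  by rewrite natrD; ring.
by rewrite pnatr_eq0 addn1.
Qed.

Lemma realization_translate G T (z : vertex n -> int) T' :
  (forall v, T' v = T v + (z v)%:~R) -> satisfies G T' -> realization G T -> realization G T'.
Proof.
move=> eT' sat [_ int]; split=> // u v row ntop h; apply: int => //.
have -> : T u - T v = (T' u - T' v) + (z v - z u)%:~R.
  by rewrite !eT' rmorphB /=; ring.
by apply: is_intD => //; exists (z v - z u).
Qed.

Variables (G : graph n) (k k' : 'I_n).
Hypotheses (adm : admissible_graph G) (kk' : k' = k.+1 :> nat).

Lemma mem_row_zeros T x : reflect
  (exists w, (vrow w = k' /\ x = T w + 1) \/ ((vrow w).+1 = k :> nat /\ x = T w))
  (x \in row_zeros T k k').
Proof.
rewrite mem_cat; apply: (iffP orP) => [[]/mapP[w]|[w [] [ew ->]]].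
- by rewrite mem_enum => /eqP ew ->; exists w; left.
- by rewrite mem_enum => /eqP ew ->; exists w; right.
- by left; apply/mapP; exists w => //; rewrite mem_enum; apply/eqP.
- by right; apply/mapP; exists w => //; rewrite mem_enum; apply/eqP.
Qed.

Lemma nontop v : vrow v = k -> ~~ top_row v.
Proof. by move=> e; apply/eqP; rewrite e => e'; have := ltn_ord k'; lia. Qed.

(** Raising [v] can only break an arrow into [v] whose inequality is tight. Tightness means
    [T x = T v] for [x] above and [T x = T v + 1] for [x] below, and either makes [T v + 1] a zero.
    So a move that leaves the basis has residue 0. *)
Lemma raise_satisfies T v : satisfies G T -> vrow v = k ->
  T v + 1 \notin row_zeros T k k' -> satisfies G (add_delta T v).
Proof.
move=> sat vk nz x y xy; rewrite !ffunE; have := sat _ _ xy.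
have neq : x != y by apply/eqP => e; move: (adm.2 _ _ xy); rewrite e /reachable connect0.
have [ey|nyv] := eqVneq y v; last first.
  have [ex|nxv] /= := eqVneq x v; last by rewrite !addr0.
  have -> : T x + 1 - (T y + 0) = T x - T y + 1 by ring.
  by case: ifP => _ [m ->]; exists m.+1; rewrite natr1.
have -> /= : (x == v) = false by rewrite -ey (negPf neq).
have -> : T x + 0 - (T y + 1) = T x - T y - 1 by ring.
move: xy neq; rewrite {}ey => xy neq.
case/or3P: (adm.1 _ _ xy) => [/eqP e1|/eqP e1|/andP[_]]; last by rewrite (negPf (nontop vk)).
  have -> : (vrow v == (vrow x).+1 :> nat) = false by apply/eqP; lia.
  case=> -[|m] em; last by exists m; rewrite em -natr1 addrK.
  case/negP: nz; apply/mem_row_zeros; exists x; left; split.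
    by apply: ord_inj; rewrite e1 vk kk'.
  by congr (_ + 1); apply/eqP; rewrite eq_sym -subr_eq0 em.
rewrite e1 eqxx; case=> -[|m] em; last by exists m; rewrite em -natr1 addrK.
case/negP: nz; apply/mem_row_zeros; exists x; right; split; first by rewrite -e1 vk.
by apply/eqP; rewrite eq_sym -subr_eq0 opprD addrA em subrr.
Qed.

Lemma lower_satisfies T v : satisfies G T -> vrow v = k ->
  T v \notin row_zeros T k k' -> satisfies G (sub_delta T v).
Proof.
move=> sat vk nz x y xy; rewrite !ffunE; have := sat _ _ xy.
have neq : x != y by apply/eqP => e; move: (adm.2 _ _ xy); rewrite e /reachable connect0.
have [ex|nxv] := eqVneq x v; last first.
  have [ey|nyv] /= := eqVneq y v; last by rewrite !subr0.
  have -> : T x - 0 - (T y - 1) = T x - T y + 1 by ring.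
  by case: ifP => _ [m ->]; exists m.+1; rewrite natr1.
have -> /= : (y == v) = false by rewrite -ex eq_sym (negPf neq).
have -> : T x - 1 - (T y - 0) = T x - T y - 1 by ring.
move: xy neq; rewrite {}ex => xy neq.
case/or3P: (adm.1 _ _ xy) => [/eqP e1|/eqP e1|/andP[]]; last by rewrite (negPf (nontop vk)).
  have -> : (vrow y == (vrow v).+1 :> nat) = false by apply/eqP; lia.
  case=> -[|m] em; last by exists m; rewrite em -natr1 addrK.
  case/negP: nz; apply/mem_row_zeros; exists y; right; split; first by rewrite -e1 vk.
  by apply/eqP; rewrite -subr_eq0 em.
rewrite e1 eqxx; case=> -[|m] em; last by exists m; rewrite em -natr1 addrK.
case/negP: nz; apply/mem_row_zeros; exists y; left; split.
  by apply: ord_inj; rewrite e1 vk kk'.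
by apply/eqP; rewrite -subr_eq0 opprD addrA em subrr.
Qed.

Lemma add_delta_translate T0 T v : ~~ top_row v ->
  int_translate T0 T -> int_translate T0 (add_delta T v).
Proof.
move=> nt [z z0 zE]; exists [ffun w => z w + (w == v)%:Z] => w.
  by move=> tw; rewrite ffunE z0 //; case: eqP => // e; rewrite -e tw in nt.
by rewrite !ffunE zE rmorphD /= addrA; case: eqP.
Qed.

Lemma sub_delta_translate T0 T v : ~~ top_row v ->
  int_translate T0 T -> int_translate T0 (sub_delta T v).
Proof.
move=> nt [z z0 zE]; exists [ffun w => z w - (w == v)%:Z] => w.
  by move=> tw; rewrite ffunE z0 //; case: eqP => // e; rewrite -e tw in nt.
by rewrite !ffunE zE rmorphB /= addrA; case: eqP.
Qed.

Definition in_gt_basis T0 T : bool := `[< int_translate T0 T /\ realization G T >].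

Lemma raise_in_basis T0 T v : in_gt_basis T0 T -> vrow v = k ->
  T v + 1 \notin row_zeros T k k' -> in_gt_basis T0 (add_delta T v).
Proof.
move=> /asboolP[tr re] vk nz; apply/asboolP; split.
  exact: add_delta_translate (nontop vk) tr.
apply: (@realization_translate G T (fun w => (w == v)%:Z)) => // [w|].
  by rewrite ffunE; case: eqP.
by apply: raise_satisfies => //; case: re.
Qed.

Lemma lower_in_basis T0 T v : in_gt_basis T0 T -> vrow v = k ->
  T v \notin row_zeros T k k' -> in_gt_basis T0 (sub_delta T v).
Proof.
move=> /asboolP[tr re] vk nz; apply/asboolP; split.
  exact: sub_delta_translate (nontop vk) tr.
apply: (@realization_translate G T (fun w => - (w == v)%:Z)) => // [w|].
  by rewrite ffunE rmorphN; case: eqP.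
by apply: lower_satisfies => //; case: re.
Qed.

End Neighbours.

(** * Commutators of raising and lowering operators *)

Section GTModel.
Variables (C : numFieldType) (n : nat) (G : graph n) (T0 : tableau C n).
Notation basis := (gt_basis G T0).
Implicit Types (T : tableau C n) (v w : vertex n) (b : basis).

(* The interface of [V_G_module] used below; keeping the module abstract
   prevents unification from unfolding the monoid algebra. *)
Record gt_model (M : glModule C n) (vec : tableau C n -> M) (coef : basis -> M -> C)
    : Prop := GtModel {
  model_coefP : forall b c x y, coef b (c *: x + y) = c * coef b x + coef b y;
  model_ext : forall x y, (forall b, coef b x = coef b y) -> x = y;
  model_vec : forall b T, coef b (vec T) = (val b == T)%:R;
  model_expand : forall x, exists s : seq basis,
    x = \sum_(b <- s) coef b x *: vec (val b);
  model_raise : forall (k k' : 'I_n) b, k' = k.+1 :> nat ->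
    unit_act k k' (vec (val b))
      = \sum_(v | vrow v == k) gt_raise (val b) k' v *: vec (add_delta (val b) v);
  model_lower : forall (k k' : 'I_n) b, k' = k.+1 :> nat ->
    unit_act k' k (vec (val b))
      = \sum_(v | vrow v == k) gt_lower (val b) k v *: vec (sub_delta (val b) v);
  model_weight : forall (k : 'I_n) b,
    unit_act k k (vec (val b)) = gt_weight (val b) k *: vec (val b) }.

Variables (a : 'M[C]_n -> V_G G T0 -> V_G G T0) (aP : is_gt_action a).

Lemma V_G_model : @gt_model (V_G_module aP) (gt_vec G T0)
  (fun b (x : V_G G T0) => mcoeff b (x : {malg C[basis]})).
Proof.
have vec_val b : gt_vec G T0 (val b) = << b >> by rewrite /gt_vec valK.
split.
- by move=> b c x y; rewrite [LHS]mcoeffD [X in X + _]mcoeffZ.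
- by move=> x y h; apply/malgP.
- move=> b T; rewrite /gt_vec; case: insubP => [b' _ <-|h].
    by rewrite mcoeffU (inj_eq val_inj) eq_sym.
  rewrite mcoeff0; case: eqP => // e; move: h; rewrite -e => /negP; case; exact: (valP b).
- move=> x; exists (finmap.enum_fset (msupp (x : {malg C[basis]}))).
  rewrite [LHS](monalgE (x : {malg C[basis]})); apply: eq_bigr => b _; apply/malgP => b'.
  rewrite vec_val mcoeffU [RHS](mcoeffZ _ (<< b >> : {malg C[basis]}) b') mcoeffU.
  by rewrite mulr_natr.
- move=> k k' b kk'; have [h _ _] := aP.2 b; rewrite /unit_act /= h // -sumrN.
  by apply: eq_bigr => v _; rewrite scaleNr.
- by move=> k k' b kk'; have [_ h _] := aP.2 b; exact: h.
- by move=> k b; have [_ _ h] := aP.2 b; exact: h.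
Qed.

End GTModel.

Section GTAction.
Variables (C : numFieldType) (n : nat) (G : graph n) (T0 : tableau C n).
Variables (M : glModule C n) (vec : tableau C n -> M) (coef : gt_basis G T0 -> M -> C).
Hypothesis modelP : gt_model vec coef.
Hypothesis adm : admissible_graph G.

Notation basis := (gt_basis G T0).
Notation inb := (in_gt_basis G T0).
Implicit Types (T : tableau C n) (v w : vertex n) (b : basis) (x y : M).
Notation E i j := (@unit_act C n M i j).

Lemma gt_coefD b x y : coef b (x + y) = coef b x + coef b y.
Proof. by rewrite -[x]scale1r (model_coefP modelP) mul1r scale1r. Qed.
Lemma gt_coef0 b : coef b 0 = 0.
Proof. by apply: (@addrI _ (coef b 0)); rewrite -gt_coefD !addr0. Qed.
Lemma gt_coefZ b c x : coef b (c *: x) = c * coef b x.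
Proof. by rewrite -[c *: x]addr0 (model_coefP modelP) gt_coef0 addr0. Qed.
Lemma gt_coefN b x : coef b (- x) = - coef b x.
Proof. by rewrite -scaleN1r gt_coefZ mulN1r. Qed.
Lemma gt_coefB b x y : coef b (x - y) = coef b x - coef b y.
Proof. by rewrite gt_coefD gt_coefN. Qed.
Lemma gt_coef_sum b (I : Type) (r : seq I) (P : pred I) (F : I -> M) :
  coef b (\sum_(i <- r | P i) F i) = \sum_(i <- r | P i) coef b (F i).
Proof. exact: (big_morph _ (@gt_coefD b) (gt_coef0 b)). Qed.

Lemma gt_coef_ext x y : (forall b, coef b x = coef b y) -> x = y.
Proof. exact: (model_ext modelP). Qed.

Lemma gt_coef_vec b T : coef b (vec T) = (val b == T)%:R.
Proof. exact: (model_vec modelP). Qed.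

Lemma basis_inb b : inb (val b). Proof. exact: (valP b). Qed.

Lemma vec_out T : ~~ inb T -> vec T = 0.
Proof.
move=> h; apply: gt_coef_ext => b; rewrite gt_coef_vec gt_coef0; case: eqP => // e.
by move: h; rewrite -e basis_inb.
Qed.

Lemma raise_vec (k k' : 'I_n) b : k' = k.+1 :> nat ->
  E k k' (vec (val b)) = \sum_(v | vrow v == k) gt_raise (val b) k' v *: vec (add_delta (val b) v).
Proof. exact: (model_raise modelP). Qed.

Lemma lower_vec (k k' : 'I_n) b : k' = k.+1 :> nat ->
  E k' k (vec (val b)) = \sum_(v | vrow v == k) gt_lower (val b) k v *: vec (sub_delta (val b) v).
Proof. exact: (model_lower modelP). Qed.

Lemma weight_vec (k : 'I_n) b :
  E k k (vec (val b)) = gt_weight (val b) k *: vec (val b).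
Proof. exact: (model_weight modelP). Qed.

Lemma linear_vec (L : M -> M) T b : linear L ->
  coef b (L (vec T)) = (inb T)%:R * coef b (L (vec T)).
Proof.
move=> L_lin; have [h|h] := boolP (inb T); first by rewrite mul1r.
have L0 : L 0 = 0 by have := L_lin (-1) 0 0; rewrite scaler0 addr0 scaleN1r addNr.
by rewrite vec_out // L0 gt_coef0 mul0r.
Qed.

Section Commutator.
Variables (k k' : 'I_n).
Hypothesis kk' : k' = k.+1 :> nat.

(** Operators with the same terms as E_(k+1)k, each rescaled by a function of the entry that moves.
    [phi = 1] is E_(k+1)k itself, [phi t = t + k] is [lower_casimir]. *)
Definition lowers_with (phi : C -> C) (L : M -> M) := linear L /\ forall b,
  L (vec (val b)) = \sum_(w | vrow w == k)
    (phi (val b w) * gt_lower (val b) k w) *: vec (sub_delta (val b) w).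

(** The indicator records that the intermediate tableau is dropped when it is not in the basis. *)
Let up_down T v w := gt_raise T k' v * (inb (add_delta T v))%:R * gt_lower (add_delta T v) k w.
Let down_up T v w := gt_lower T k w * (inb (sub_delta T w))%:R * gt_raise (sub_delta T w) k' v.

Lemma lowers_sum phi L (I : Type) (r : seq I) (P : pred I) (F : I -> M) (c : I -> C) :
  lowers_with phi L ->
  L (\sum_(i <- r | P i) c i *: F i) = \sum_(i <- r | P i) c i *: L (F i).
Proof.
move=> [L_lin _].
have L0 : L 0 = 0 by have := L_lin (-1) 0 0; rewrite scaler0 addr0 scaleN1r addNr.
elim: r => [|i r IH]; first by rewrite !big_nil.
by rewrite !big_cons; case: ifP => _ //; rewrite L_lin IH.
Qed.

Lemma coef_comm phi L b b' : lowers_with phi L ->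
  coef b' (L (E k k' (vec (val b))) - E k k' (L (vec (val b)))) =
  \sum_(v | vrow v == k) \sum_(w | vrow w == k)
    (phi (add_delta (val b) v w) * up_down (val b) v w - phi ((val b) w) * down_up (val b) v w)
      * (val b' == sub_delta (add_delta (val b) v) w)%:R.
Proof.
move=> LP; have [L_lin LE] := LP.
have lin_E : linear (E k k') by move=> c x y; rewrite unit_actD unit_actZ.
rewrite raise_vec // (lowers_sum _ _ _ _ LP) LE unit_act_sum gt_coefB !gt_coef_sum; set T := val b.
rewrite [X in _ - X](eq_bigr (fun w => \sum_(v | vrow v == k) phi (T w) * down_up T v w
      * (val b' == sub_delta (add_delta T v) w)%:R)); last first.
  move=> w wk; rewrite unit_actZ gt_coefZ (linear_vec _ _ lin_E).
  have [h|h] := boolP (inb (sub_delta T w)); last first.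
    rewrite mul0r mulr0 big1 // => v _; rewrite /down_up (negPf h) mulr0n; ring.
  have eT : sub_delta T w = val (Sub (sub_delta T w) h : basis) by rewrite SubK.
  rewrite {1}eT raise_vec // gt_coef_sum SubK !mulr_sumr; apply: eq_bigr => v vk.
  rewrite gt_coefZ gt_coef_vec delta_comm /down_up h mulr1n; ring.
rewrite [X in _ - X]exchange_big /= -sumrB; apply: eq_bigr => v vk.
rewrite gt_coefZ (linear_vec _ _ L_lin) -/T.
have [h|h] := boolP (inb (add_delta T v)); last first.
  rewrite mul0r mulr0 sub0r -sumrN; apply: eq_bigr => w _; rewrite /up_down (negPf h) mulr0n; ring.
have eT : add_delta T v = val (Sub (add_delta T v) h : basis) by rewrite SubK.
rewrite {1}eT LE gt_coef_sum SubK !mulr_sumr -sumrB; apply: eq_bigr => w wk.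
rewrite gt_coefZ gt_coef_vec /up_down h mulr1n; ring.
Qed.

Lemma lower_lowers : lowers_with (fun=> 1) (E k' k).
Proof.
split; first by move=> c x y; rewrite unit_actD unit_actZ.
by move=> b; rewrite lower_vec //; apply: eq_bigr => w _; rewrite mul1r.
Qed.

Lemma comm_weight b :
  E k' k (E k k' (vec (val b))) - E k k' (E k' k (vec (val b)))
    = (gt_weight (val b) k' - gt_weight (val b) k) *: vec (val b).
Proof.
rewrite unit_act_comm !eqxx !scale1r !weight_vec [RHS]scalerBl.
by set X := E k k' _; rewrite -[X + _ - _]addrA [X + _]addrC addrK.
Qed.

(** The commutator with E_(k+1)k is a scalar on the tableau [val b], so its coefficient at the
    different tableau [val b'] is 0; by [delta_inj] a single pair of moves contributes there.
    Deriving this from the relation also covers the case of an intermediate tableau outside the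
    basis. *)
Lemma up_down_comm b b' v w : vrow v == k -> vrow w == k -> v != w ->
  val b' = sub_delta (add_delta (val b) v) w -> up_down (val b) v w = down_up (val b) v w.
Proof.
move=> vk wk nvw eb'; have := coef_comm b b' lower_lowers.
rewrite (comm_weight b) gt_coefZ gt_coef_vec {}eb'; move: (val b) => T.
have -> : (sub_delta (add_delta T v) w == T) = false.
  apply/eqP => /ffunP/(_ v); rewrite !ffunE eqxx (negPf nvw) subr0 => /eqP.
  by rewrite -[X in _ == X]addr0 (inj_eq (addrI _)) oner_eq0.
rewrite mulr0 (bigD1 v) // [X in _ = X + _](bigD1 w) //= eqxx mulr1 !mul1r.
rewrite big1 => [|w' /andP[w'k nw']]; last first.
  case: eqP => [/esym/(delta_inj nvw)[_ e]|_]; last by rewrite mulr0.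
  by rewrite e eqxx in nw'.
rewrite big1 => [|v' /andP[v'k nv']]; last first.
  rewrite big1 // => w' w'k.
  case: eqP => [/esym/(delta_inj nvw)[e _]|_]; last by rewrite mulr0.
  by rewrite e eqxx in nv'.
by rewrite !addr0 => /esym/eqP; rewrite subr_eq0 => /eqP.
Qed.

(** The indicator costs nothing on the diagonal: when the intermediate tableau is dropped, [T v + 1]
    is a zero and the residue vanishes as well. *)
Lemma up_down_diag b v : vrow v == k ->
  up_down (val b) v v = - residue (row_poles (val b) k) (row_zeros (val b) k k') ((val b) v + 1).
Proof.
move=> vk; set T := val b; rewrite -(residue_raise T kk' vk) /up_down.
have [h|h] := boolP (inb (add_delta T v)); first by rewrite mulr1.
have : T v + 1 \in row_zeros T k k'.
  by apply: contraNT h; apply: (raise_in_basis adm kk' (basis_inb b) (eqP vk)).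
by rewrite (residue_raise T kk' vk) => /residue_root ->; rewrite oppr0 mulr0 mul0r.
Qed.

Lemma down_up_diag b v : vrow v == k ->
  down_up (val b) v v = residue (row_poles (val b) k) (row_zeros (val b) k k') ((val b) v).
Proof.
move=> vk; set T := val b; rewrite -(residue_lower T kk' vk) /down_up.
have [h|h] := boolP (inb (sub_delta T v)); first by rewrite mulr1.
have : T v \in row_zeros T k k'.
  by apply: contraNT h; apply: (lower_in_basis adm kk' (basis_inb b) (eqP vk)).
by rewrite (residue_lower T kk' vk) => /residue_root ->; rewrite mulr0 mul0r.
Qed.

(* The off-diagonal part cancels because it does so for [phi = 1], where the
   commutator is diagonal, and because both orders carry the same factor [phi]. *)
Lemma weighted_comm phi L b : lowers_with phi L ->
  L (E k k' (vec (val b))) - E k k' (L (vec (val b))) =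
  - (\sum_(x <- row_poles (val b) k)
       phi x * residue (row_poles (val b) k) (row_zeros (val b) k k') x) *: vec (val b).
Proof.
move=> LP; apply: gt_coef_ext => b'; rewrite (coef_comm b b' LP) gt_coefZ gt_coef_vec.
rewrite (big_poles _ _ (fun t : C =>
  phi t * residue (row_poles (val b) k) (row_zeros (val b) k k') t)).
rewrite opprD -!sumrN addrC -big_split /= mulr_suml; apply: eq_bigr => v vk.
rewrite (bigD1 v) //= add_deltaK big1 => [|w /andP[wk nw]].
  by rewrite addr0 up_down_diag // down_up_diag // ffunE eqxx; ring.
case: eqP => [e|_]; last by rewrite mulr0.
rewrite (up_down_comm vk wk _ e) 1?eq_sym // ffunE (negPf nw) addr0; ring.
Qed.

(** The residue theorem for the conventional value 0 at double poles. It is not automatic; it is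
    forced by the relation between E_k(k+1) and E_(k+1)k, and is the lever for the cancellation of
    double poles. *)
Lemma residue_sum_weight b :
  \sum_(x <- row_poles (val b) k) residue (row_poles (val b) k) (row_zeros (val b) k k') x
    = \sum_(x <- row_poles (val b) k) x - \sum_(y <- row_zeros (val b) k k') y.
Proof.
rewrite weight_diff //; have := weighted_comm b lower_lowers.
rewrite (comm_weight b) => /(congr1 (coef b)); rewrite !gt_coefZ gt_coef_vec eqxx !mulr1.
under eq_bigr do rewrite mul1r.
by move=> /eqP; rewrite -eqr_opp opprK opprB => /eqP.
Qed.

End Commutator.

End GTAction.

(** * Cancellation of double poles *)

Section DoublePoles.
Variables (C : numFieldType) (n : nat) (T0 : tableau C n).
Let G := tableau_graph T0.
Hypothesis relG : relation_graph C G.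
Let adm : admissible_graph G. Proof. by case: relG. Qed.
Let nc : noncritical G. Proof. by case: relG. Qed.
Implicit Types (T : tableau C n) (u v w : vertex n).

Lemma int_translate_refl (T : tableau C n) : int_translate T T.
Proof. by exists [ffun=> 0] => v; rewrite ffunE //= addr0. Qed.

(** [T] is used as the base point of its own module, so no relation between [T] and [T0] is
    required. *)
Lemma realization_residue_sum T (k k' : 'I_n) : k' = k.+1 :> nat -> realization G T ->
  \sum_(x <- row_poles T k) residue (row_poles T k) (row_zeros T k k') x
    = \sum_(x <- row_poles T k) x - \sum_(y <- row_zeros T k k') y.
Proof.
move=> kk' re; case: relG => _ _ /(_ T re)[a aP].
have h : in_gt_basis G T T by apply/asboolP; split=> //; exact: int_translate_refl.
by have := residue_sum_weight (V_G_model aP) adm kk' (Sub T h); rewrite SubK.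
Qed.

(** [z u] is the offset of [u] from a chosen root of its component. *)
Lemma int_coordinates T : satisfies G T -> exists z : vertex n -> int,
  forall u v, same_component G u v -> T u - T v = (z u - z v)%:~R.
Proof.
move=> sat; pose e : rel (vertex n) := [rel u v | arrow G u v || arrow G v u].
have sym : connect_sym e by apply: sym_connect_sym => u v; rewrite /e /= orbC.
have ex u : exists m : int, T u - T (fingraph.root e u) = m%:~R.
  by apply: (component_is_int sat); apply: connect_root.
have [z zE] := choice ex; exists z => u v /(fingraph.rootP sym) r.
by rewrite rmorphB /= -!zE r; ring.
Qed.

Lemma consecutive_component T u v : int_translate T0 T ->
  vrow u = (vrow v).+1 :> nat -> is_int (T u - T v) -> same_component G u v.
Proof.
move=> [z0 _ zE] row h; have/(consecutive_reachable row) : is_int (T0 u - T0 v).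
  have -> : T0 u - T0 v = (T u - T v) + (z0 v - z0 u)%:~R.
    by rewrite !zE rmorphB /=; ring.
  by apply: is_intD => //; exists (z0 v - z0 u).
by case/orP => /reachable_component //; rewrite same_component_sym.
Qed.

Lemma count_map_eq (I J : eqType) (c : J) (f : I -> J) (r : seq I) :
  count_mem c (map f r) = count (fun i => f i == c) r.
Proof. by rewrite count_map; apply: eq_count. Qed.

Variables (T : tableau C n) (k k' : 'I_n).
Hypotheses (kk' : k' = k.+1 :> nat) (tr : int_translate T0 T) (re : realization G T).

Let sat : satisfies G T. Proof. by case: re. Qed.
Let nt v : vrow v = k -> ~~ top_row v. Proof. exact: (nontop kk'). Qed.

Lemma uniq_row (T' : tableau C n) : realization G T' -> uniq [seq T' v | v <- enum (in_row k)].
Proof.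
move=> re'; rewrite map_inj_in_uniq ?enum_uniq // => u v.
rewrite !mem_enum => /eqP uk /eqP vk e; apply/eqP; apply: contraT => ne.
by have /eqP := row_distinct adm nc re' (etrans uk (esym vk)) (nt uk) ne.
Qed.

Lemma count_poles_dup (T' : tableau C n) x : realization G T' ->
  (1 < count_mem x (row_poles T' k))%N ->
  count_mem x (row_poles T' k) = 2%N /\
  exists u v, [/\ vrow u = k, vrow v = k, x = T' u & x = T' v + 1].
Proof.
move=> re' lt; have u1 := uniq_row re'.
have u2 : uniq [seq T' v + 1 | v <- enum (in_row k)].
  by have := u1; rewrite -(map_inj_uniq (@addIr _ 1)) -map_comp.
move: lt; rewrite /row_poles count_cat (count_uniq_mem _ u1) (count_uniq_mem _ u2).
case: mapP => [[u uk ->]|_]; last by case: (_ \in _).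
case: mapP => [[v vk e]|_] //= _; split=> //; exists u, v.
by move: uk vk; rewrite !mem_enum => /eqP uk /eqP vk.
Qed.

(** * Stretching a realization that has an uncancelled double pole *)

Section AdjacentPair.
Variables a b : vertex n.
Hypotheses (ak : vrow a = k) (bk : vrow b = k) (ab : T a = T b + 1).

Let num_up := count (fun w => T w + 1 == T a) (enum (in_row k')).
Let num_down := count (fun w => T w == T a) (enum (below_row k)).

Let neab : a != b.
Proof.
by apply/eqP => e; move: ab => /eqP; rewrite e addrC -subr_eq subrr eq_sym oner_eq0.
Qed.

Let reach_ab : reachable G a b.
Proof.
have row := etrans ak (esym bk).
have h : is_int (T a - T b) by rewrite ab addrC addKr; exact: (nat_is_int C 1).
case/orP: (nc row (nt ak) (re.2 _ _ row (nt ak) h)) => // r.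
have [|m] := reachable_row_pos adm sat (esym row) (nt bk) _ r.
  by rewrite eq_sym.
have -> : T b - T a = - 1 by rewrite ab; ring.
by move=> /eqP; rewrite eq_sym -addr_eq0 natr1 pnatr_eq0.
Qed.

(** The path from [a] to [b] leaves the row through a neighbour [w]. The total drop is only 1, so
    [w] is pinned: [T w = T b] if it lies above, [T w = T a] if it lies below. *)
Lemma zero_exists : (0 < num_up + num_down)%N.
Proof.
have row := etrans ak (esym bk).
have [w [m' em' lm']] := reachable_row adm sat row (nt ak) neab reach_ab.
have sum1 : T a - T b = 1 by rewrite ab addrC addKr.
case=> -[e1 [m em]]; rewrite addn_gt0 -!has_count; apply/orP; [left|right].
  apply/hasP; exists w; first by rewrite mem_enum; apply/eqP/ord_inj; rewrite e1 ak kk'.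
  have : (m.+1 + m')%:R = 1%:R :> C by rewrite natrD -em -em' -sum1; ring.
  move/eqP; rewrite eqr_nat => /eqP ee; have m'0 : m' = 0%N by lia.
  by move: em' => /eqP; rewrite m'0 subr_eq0 => /eqP ->; rewrite ab.
apply/hasP; exists w; first by rewrite mem_enum; apply/eqP; rewrite -e1 ak.
have : (m + m')%:R = 1%:R :> C by rewrite natrD -em -em' -sum1; ring.
move/eqP; rewrite eqr_nat => /eqP ee.
have m0 : m = 0%N by move: lm'; rewrite bk -ak e1; lia.
by move: em => /eqP; rewrite m0 subr_eq0 eq_sym.
Qed.

Variable z : vertex n -> int.
Hypothesis zE : forall u v, same_component G u v -> T u - T v = (z u - z v)%:~R.

Variables (c : vertex n) (e : int).
(** Tripling turns the gap 1 between [a] and [b] into 3, and a shift by 2 brings it back to 1. The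
    shifted end is one that nothing blocks: [a] goes down when no entry below equals [T a], [b] goes
    up when no entry above equals [T b]. *)
Hypothesis ce : (c = a /\ e = -2 /\ num_down = 0%N) \/ (c = b /\ e = 2 /\ num_up = 0%N).
Hypothesis one : (num_up + num_down = 1)%N.

Let p w : int := if w == c then e else 0.

(* Stretching the integral coordinates by 3 and then restoring the gap between
   [a] and [b] to 1 yields a realization in which [(a, b)] is the only adjacent
   pair of its row. *)
Let S : tableau C n := [ffun w => T w + (2 * z w + p w)%:~R].

Let ck : vrow c = k. Proof. by case: ce => -[-> _]. Qed.

Let p0 w : vrow w != k -> p w = 0.
Proof. by move=> nw; rewrite /p; case: eqP => // ew; rewrite ew ck eqxx in nw. Qed.

Let S_diff u v : S u - S v = T u - T v + (2 * (z u - z v) + (p u - p v))%:~R.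
Proof. by rewrite !ffunE !(rmorphD, rmorphB, rmorphM, rmorphN) /=; ring. Qed.

Let S_comp u v : same_component G u v -> S u - S v = (3 * (z u - z v) + (p u - p v))%:~R.
Proof.
by move=> uv; rewrite S_diff zE // -rmorphD /=; congr (_%:~R); ring.
Qed.

Let is_int_S u v : is_int (S u - S v) -> is_int (T u - T v).
Proof.
rewrite S_diff => h; rewrite -[T u - T v](addrK (2 * (z u - z v) + (p u - p v))%:~R).
by apply: is_intD => //; apply: is_intN; eexists.
Qed.

Let no_down w : num_down = 0%N -> (vrow w).+1 = k :> nat -> T w != T a.
Proof.
move=> /eqP; rewrite -leqn0 leqNgt -has_count => /hasPn h wk; apply: h.
by rewrite mem_enum; apply/eqP.
Qed.

Let no_up w : num_up = 0%N -> vrow w = k' -> T w != T b.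
Proof.
move=> /eqP; rewrite -leqn0 leqNgt -has_count => /hasPn h wk.
have := h w; rewrite mem_enum ab (inj_eq (addIr 1)); apply.
by apply/eqP.
Qed.

(** A difference [d >= 1] becomes at least [3 * d - 2 >= 1], so only arrows with [d = 0] at the
    shifted vertex are at risk. Those are excluded by [no_down] or [no_up]. *)
Let S_satisfies : satisfies G S.
Proof.
move=> x y xy; have := sat xy.
have nxy : x != y by apply/eqP => exy; move: (adm.2 _ _ xy); rewrite exy /reachable connect0.
have comp := reachable_component (connect1 xy : reachable G x y).
rewrite (S_comp comp) zE //.
set d := z x - z y; have dT : T x - T y = d%:~R := zE comp.
have intnat (m : int) : 0 <= m -> is_nat (m%:~R : C).
  by case: m => // m _; exists m.
have intpos (m : int) : 1 <= m -> is_pos_nat (m%:~R : C).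
  by case: m => // -[|m] // _; exists m.
have eqint (i : int) (m : nat) : i%:~R = m%:R :> C -> i = m%:Z.
  by move=> h; apply: (@intr_inj C); rewrite h.
case: eqP => [row|nrow] [m /eqint em].
  apply: intpos; rewrite /p; case: ce => -[_ [-> _]];
    by case: eqP => ex; case: eqP => ey; try lia; rewrite ex ey eqxx in nxy.
apply: intnat; rewrite /p.
have ge1 : T x != T y -> 1 <= d by rewrite -subr_eq0 dT intr_eq0; lia.
have down : ~~ top_row x || ~~ top_row y -> vrow x = (vrow y).+1 :> nat.
  by case/or3P: (adm.1 _ _ xy) => [/eqP|/eqP h|/andP[-> ->]] //; case: nrow.
case: ce => -[ec [-> zero]]; case: eqP => ex; case: eqP => ey;
  try by rewrite ex ey eqxx in nxy.
- have r : vrow x = (vrow y).+1 :> nat by apply: down; rewrite ex (nt ck).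
  have := ge1; rewrite eq_sym ex ec no_down //; first by move=> /(_ isT); lia.
  by rewrite -r ex ck.
- lia.
- lia.
- lia.
- have r : vrow x = (vrow y).+1 :> nat by apply: down; rewrite ey (nt ck) orbT.
  have := ge1; rewrite ey ec no_up //; first by move=> /(_ isT); lia.
  by apply: ord_inj; rewrite r ey ck kk'.
- lia.
Qed.

Let S_realization : realization G S.
Proof.
apply: (@realization_translate _ _ G T (fun w => 2 * z w + p w)) => // w.
by rewrite ffunE.
Qed.

Let zab : z a - z b = 1.
Proof.
have := zE (reachable_component reach_ab); rewrite ab addrC addKr => /esym h.
by apply: (@intr_inj C); rewrite h.
Qed.

Let S_ab : S a = S b + 1.
Proof.
apply/eqP; rewrite addrC -subr_eq (S_comp (reachable_component reach_ab)) zab.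
rewrite /p; case: ce => -[-> [-> _]]; rewrite !eqxx ?(negPf neab) //.
by rewrite [b == a]eq_sym (negPf neab).
Qed.

(** Modulo 3: the difference 1 requires [p u - p v = -2], which identifies one of the two vertices
    as [c]; the other follows because entries of a row are distinct. *)
Let S_adjacent u v : vrow u = k -> vrow v = k -> S u = S v + 1 -> u = a /\ v = b.
Proof.
move=> uk vk uv; have row := etrans uk (esym vk).
have S1 : S u - S v = 1 by rewrite uv addrC addKr.
have comp : same_component G u v.
  by apply: S_realization.2 => //; [exact: nt|rewrite S1; exact: (nat_is_int C 1)].
have e1 : 3 * (z u - z v) + (p u - p v) = 1.
  by apply: (@intr_inj C); rewrite -(S_comp comp) S1.
have Tuv : z u - z v = 1 -> T u = T v + 1.
  by move=> h; apply/eqP; rewrite addrC -subr_eq (zE comp) h.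
have inj x y : vrow x = k -> vrow y = k -> T x = T y -> x = y.
  move=> xk yk exy; apply/eqP; apply: contraT => ne.
  by have := row_distinct adm nc re (etrans xk (esym yk)) (nt xk) ne; rewrite exy eqxx.
move: e1; rewrite /p; case: ce => -[ec [-> _]]; case: eqP => eu; case: eqP => ev; try lia.
  move=> h; rewrite eu ec; split=> //; apply: inj => //; apply: (@addIr _ 1).
  by rewrite -ab -ec -eu Tuv //; lia.
move=> h; rewrite ev ec; split=> //; apply: inj => //.
by rewrite ab -ec -ev Tuv //; lia.
Qed.

Let S_zero_diff u v : vrow u = (vrow v).+1 :> nat -> S u = S v ->
  3 * (z u - z v) + (p u - p v) = 0.
Proof.
move=> row uv; have S0 : S u - S v = 0 by rewrite uv subrr.
have comp : same_component G u v.
  by apply: consecutive_component tr row _; apply: is_int_S; rewrite S0; exists 0.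
by apply: (@intr_inj C); rewrite -(S_comp comp) S0.
Qed.

Let T_zero_diff u v : vrow u = (vrow v).+1 :> nat -> T u = T v -> z u = z v.
Proof.
move=> row uv; have T0' : T u - T v = 0 by rewrite uv subrr.
have comp : same_component G u v.
  by apply: consecutive_component tr row _; rewrite T0'; exists 0.
by apply/eqP; rewrite -subr_eq0; apply/eqP/(@intr_inj C); rewrite -(zE comp).
Qed.

(** The same argument modulo 3 shows that the zeros at [S a] sit at the same vertices as those of
    [T] at [T a], so exactly one survives. *)
Let count_S : count_mem (S a) (row_zeros S k k') = 1%N.
Proof.
rewrite -one /row_zeros count_cat !count_map_eq; congr (_ + _)%N.
  apply: eq_in_count => w; rewrite mem_enum => /eqP wk.
  have row : vrow w = (vrow b).+1 :> nat by rewrite wk bk.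
  have pw : p w = 0 by apply: p0; rewrite wk; apply/eqP => h; move: kk'; rewrite h; lia.
  rewrite S_ab ab !(inj_eq (addIr 1)); apply/eqP/eqP => h.
    have := S_zero_diff row h; rewrite pw /p.
    case: ce => -[-> [-> zero]].
      rewrite eq_sym (negPf neab) => h'; have zz : z w = z b by lia.
      apply/eqP; rewrite -subr_eq0.
      have comp : same_component G w b.
        by apply: consecutive_component tr row _; apply: is_int_S; rewrite h subrr; exists 0.
      by rewrite (zE comp) zz subrr.
    by rewrite eqxx; lia.
  case: ce => -[ec [ee zero]]; last by have := no_up zero wk; rewrite h eqxx.
  apply/eqP; rewrite -subr_eq0 S_diff h (T_zero_diff row h) pw /p ec.
  rewrite [b == a]eq_sym (negPf neab) !subrr. by rewrite addr0.
apply: eq_in_count => w; rewrite mem_enum => /eqP wk.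
have row : vrow a = (vrow w).+1 :> nat by rewrite wk ak.
have pw : p w = 0 by apply: p0; apply/eqP => h; move: wk; rewrite h; lia.
apply/eqP/eqP => h.
  have := S_zero_diff row (esym h); rewrite pw /p.
  case: ce => -[-> [-> zero]]; first by rewrite eqxx; lia.
  rewrite (negPf neab) => h'; have zz : z a = z w by lia.
  apply/eqP; rewrite eq_sym -subr_eq0.
  have comp : same_component G a w.
    by apply: consecutive_component tr row _; apply: is_int_S; rewrite h subrr; exists 0.
  by rewrite (zE comp) zz subrr.
case: ce => -[ec [ee zero]]; first by have := no_down zero wk; rewrite h eqxx.
apply/eqP; rewrite eq_sym -subr_eq0 S_diff h (T_zero_diff row (esym h)) pw /p ec.
by rewrite (negPf neab) !subrr addr0.
Qed.

(** [S] has a single double pole, met by only one zero, so the residue sum fails for it; but [S] is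
    a realization of a relation graph, for which the sum must hold. *)
Lemma stretched_contradiction : False.
Proof.
have e1 := realization_residue_sum kk' S_realization.
apply: (@residue_sum0_bad _ _ _ (S a)) e1 => //.
- exact: size_poles_zeros.
- move=> x /(count_poles_dup S_realization)[_ [u [v [uk vk -> euv]]]].
  by have [-> _] := S_adjacent uk vk euv.
- have : (1 < count_mem (S a) (row_poles S k))%N; last by case/(count_poles_dup S_realization).
  rewrite /row_poles count_cat; apply: (@leq_add 1 1); rewrite -has_count has_pred1.
    by apply/mapP; exists a => //; rewrite mem_enum; apply/eqP.
  by apply/mapP; exists b => //; rewrite mem_enum; apply/eqP.
Qed.

End AdjacentPair.

(* This is where the hypothesis that [G] is a relation graph, rather than only
   that [V_G] is a module, enters. *)
Lemma row_poles_cancel : poles_cancel (row_poles T k) (row_zeros T k k').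
Proof.
move=> x /(count_poles_dup re)[-> [a [b [ak bk -> ab]]]].
rewrite leqNgt; apply/negP => lt.
have gt0 := zero_exists ak bk ab.
have [z zE] := int_coordinates sat.
move: lt; rewrite {1}/row_zeros count_cat !count_map_eq => lt.
set nu := count _ _ in lt gt0; set nd := count _ _ in lt gt0.
have one : (nu + nd = 1)%N by lia.
have [z0|z0] : nd = 0%N \/ nu = 0%N by lia.
  by apply: (stretched_contradiction ak bk ab zE (c := a) (e := -2)) => //; left.
by apply: (stretched_contradiction ak bk ab zE (c := b) (e := 2)) => //; right.
Qed.
End DoublePoles.

(** * The partial Casimir elements *)

Section PartialCasimir.
Variables (C : fieldType) (n : nat) (M : glModule C n).
Notation E i j := (@unit_act C n M i j).
Implicit Types (x y : M).

Definition partial_casimir (k : 'I_n) x : M := \sum_(j : 'I_n | (j < k)%N) E k j (E j k x).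
Definition lower_casimir (k k' : 'I_n) x : M := \sum_(j : 'I_n | (j < k')%N) E k' j (E j k x).

Lemma partial_casimirD k x y :
  partial_casimir k (x + y) = partial_casimir k x + partial_casimir k y.
Proof. by rewrite -big_split; apply: eq_bigr => j _; rewrite !unit_actD. Qed.
Lemma partial_casimirZ k c x : partial_casimir k (c *: x) = c *: partial_casimir k x.
Proof. by rewrite scaler_sumr; apply: eq_bigr => j _; rewrite !unit_actZ. Qed.
Lemma partial_casimir0 k : partial_casimir k 0 = 0.
Proof. by have := partial_casimirZ k 0 0; rewrite !scale0r. Qed.
Lemma partial_casimir_sum k (I : Type) (r : seq I) (P : pred I) (F : I -> M) :
  partial_casimir k (\sum_(i <- r | P i) F i) = \sum_(i <- r | P i) partial_casimir k (F i).
Proof. exact: (big_morph _ (@partial_casimirD k) (partial_casimir0 k)). Qed.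

Variables k k' : 'I_n.
Hypothesis kk' : k' = k.+1 :> nat.

Let ne_kk' : (k == k') = false. Proof. by apply/eqP => e; move: kk'; rewrite e; lia. Qed.
Let ne_k'k : (k' == k) = false. Proof. by rewrite eq_sym ne_kk'. Qed.

Lemma big_ltS (F : 'I_n -> M) :
  \sum_(j : 'I_n | (j < k')%N) F j = F k + \sum_(j : 'I_n | (j < k)%N) F j.
Proof.
rewrite (bigD1 k) /=; last by rewrite kk'.
congr (_ + _); apply: eq_bigl => j; rewrite kk' ltnS ltn_neqAle andbC.
by rewrite (inj_eq val_inj).
Qed.

Lemma lower_casimirE x : lower_casimir k k' x =
  E k' k (E k k x) - (partial_casimir k (E k' k x) - E k' k (partial_casimir k x)).
Proof.
rewrite /lower_casimir big_ltS; congr (_ + _).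
rewrite /partial_casimir unit_act_sum -sumrB -sumrN; apply: eq_bigr => j ltj.
have nkj : (k == j) = false by apply/eqP => e; move: ltj; rewrite e ltnn.
have njk' : (j == k') = false by apply/eqP => e; move: ltj; rewrite e kk'; lia.
rewrite [E j k (E k' k x)]unit_act_comm ne_kk' nkj !scale0r addr0 subr0.
rewrite [E k j (E k' k _)]unit_act_comm njk' eqxx scale0r scale1r addr0.
by rewrite addrAC subrr add0r opprK.
Qed.

(** Moving E_k(k+1) through each product E_(k+1)j E_jk creates the summand E_(k+1)j E_j(k+1) of the
    next element; the remaining terms are diagonal on tableaux once S_k is. *)
Lemma partial_casimir_next x : partial_casimir k' x =
  lower_casimir k k' (E k k' x) - E k k' (lower_casimir k k' x)
    - E k' k' (E k k x) + E k k (E k k x) + partial_casimir k x.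
Proof.
have term (j : 'I_n) : (j < k')%N -> E k' j (E j k (E k k' x)) = E k k' (E k' j (E j k x))
    + (j == k)%:R *: E k' k' (E j k x) - E k j (E j k x) + E k' j (E j k' x).
  move=> ltj; have nk'j : (k' == j) = false by apply/eqP => e; move: ltj; rewrite e ltnn.
  rewrite [E j k (E k k' x)]unit_act_comm nk'j eqxx scale0r scale1r subr0 unit_actD.
  by rewrite [E k' j (E k k' _)]unit_act_comm eqxx scale1r.
have diag : \sum_(j : 'I_n | (j < k')%N) (j == k)%:R *: E k' k' (E j k x) = E k' k' (E k k x).
  rewrite (bigD1 k) ?kk' //= eqxx scale1r big1 ?addr0 // => j /andP[_ /negPf ->].
  by rewrite scale0r.
rewrite {1}/lower_casimir (eq_bigr _ term) !big_split /= -unit_act_sum -/(lower_casimir k k' x).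
rewrite -/(partial_casimir k' x) sumrN diag big_ltS -/(partial_casimir k x).
set e := E k k' _; set h := E k' k' _; set hh := E k k (E k k x).
set S := partial_casimir k x; set S' := partial_casimir k' x.
rewrite opprD !addrA.
rewrite [RHS](ACl (1*6*2*7*3*8*4*9*5)) /= subrr add0r subrr sub0r addNr sub0r addNr.
by rewrite add0r.
Qed.

End PartialCasimir.

(** * Eigenvalues of the partial Casimir elements *)

Section CasimirValue.
Variables (C : numFieldType) (n : nat).
Implicit Types (T : tableau C n) (k : 'I_n) (v w : vertex n).

Definition casimir_value T k : C :=
  (\sum_(v | vrow v == k) T v ^+ 2 - \sum_(w | (vrow w).+1 == k :> nat) T w ^+ 2
    - (\sum_(v | vrow v == k) T v - \sum_(w | (vrow w).+1 == k :> nat) T w) ^+ 2) / 2.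

Lemma sum_row_sub T k v (F : C -> C) : vrow v == k ->
  \sum_(w | vrow w == k) F (sub_delta T v w)
    = \sum_(w | vrow w == k) F (T w) + (F (T v - 1) - F (T v)).
Proof.
move=> vk; rewrite (bigD1 v) //= [in RHS](bigD1 v) //= ffunE eqxx.
rewrite (eq_bigr (fun w => F (T w))) => [|w /andP[_ /negPf nw]]; first by ring.
by rewrite ffunE nw subr0.
Qed.

Lemma sum_row_add T k v (F : C -> C) : vrow v == k ->
  \sum_(w | vrow w == k) F (add_delta T v w)
    = \sum_(w | vrow w == k) F (T w) + (F (T v + 1) - F (T v)).
Proof.
move=> vk; rewrite (bigD1 v) //= [in RHS](bigD1 v) //= ffunE eqxx.
rewrite (eq_bigr (fun w => F (T w))) => [|w /andP[_ /negPf nw]]; first by ring.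
by rewrite ffunE nw addr0.
Qed.

Lemma below_neq k v w : vrow v == k -> (vrow w).+1 == k :> nat -> (w == v) = false.
Proof. by move=> /eqP vk /eqP wk; apply/eqP => e; move: wk; rewrite e vk; lia. Qed.

Lemma sum_below_sub T k v (F : C -> C) : vrow v == k ->
  \sum_(w | (vrow w).+1 == k :> nat) F (sub_delta T v w)
    = \sum_(w | (vrow w).+1 == k :> nat) F (T w).
Proof.
by move=> vk; apply: eq_bigr => w wk; rewrite ffunE (below_neq vk wk) subr0.
Qed.

Lemma sum_below_add T k v (F : C -> C) : vrow v == k ->
  \sum_(w | (vrow w).+1 == k :> nat) F (add_delta T v w)
    = \sum_(w | (vrow w).+1 == k :> nat) F (T w).
Proof.
by move=> vk; apply: eq_bigr => w wk; rewrite ffunE (below_neq vk wk) addr0.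
Qed.

(** The quadratic terms cancel, so the change depends on [v] only through [- T v]. This yields the
    factor in [lower_casimir_lowers] and the separation of neighbouring tableaux. *)
Lemma casimir_value_sub T k v : vrow v == k ->
  casimir_value (sub_delta T v) k = casimir_value T k - T v + (gt_weight T k - k%:R).
Proof.
move=> vk; rewrite /casimir_value (sum_row_sub T (fun t => t ^+ 2) vk).
rewrite (sum_below_sub T (fun t => t ^+ 2) vk) (sum_row_sub T id vk) (sum_below_sub T id vk).
by rewrite /gt_weight; field.
Qed.

Lemma casimir_value_add T k v : vrow v == k ->
  casimir_value (add_delta T v) k = casimir_value T k + T v - (gt_weight T k - k%:R).
Proof.
move=> vk; rewrite /casimir_value (sum_row_add T (fun t => t ^+ 2) vk).
rewrite (sum_below_add T (fun t => t ^+ 2) vk) (sum_row_add T id vk) (sum_below_add T id vk).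
by rewrite /gt_weight; field.
Qed.

End CasimirValue.

Section CasimirAction.
Variables (C : numFieldType) (n : nat) (T0 : tableau C n).
Let G := tableau_graph T0.
Hypothesis relG : relation_graph C G.
Let adm : admissible_graph G. Proof. by case: relG. Qed.
Variables (M : glModule C n) (vec : tableau C n -> M) (coef : gt_basis G T0 -> M -> C).
Hypothesis modelP : gt_model vec coef.
Notation inb := (in_gt_basis G T0).
Notation E i j := (@unit_act C n M i j).

(** The weight of E_kk minus the increment from [casimir_value_sub] is [T v + k]: the weight itself
    cancels. With rows numbered from 0 this is the factor l_ki + k - 1. *)
Lemma lower_casimir_lowers (k k' : 'I_n) : k' = k.+1 :> nat ->
  (forall T, partial_casimir k (vec T) = casimir_value T k *: vec T) ->
  @lowers_with C n G T0 M vec k (fun t => t + k%:R) (lower_casimir k k').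
Proof.
move=> kk' IH; split.
  move=> c x y; rewrite /lower_casimir scaler_sumr -big_split; apply: eq_bigr => j _.
  by rewrite !unit_actD !unit_actZ.
move=> b; rewrite lower_casimirE // (weight_vec modelP) unit_actZ IH unit_actZ.
rewrite (lower_vec modelP _ kk') partial_casimir_sum !scaler_sumr -!sumrB.
apply: eq_bigr => v vk; rewrite partial_casimirZ IH casimir_value_sub //.
by rewrite !scalerA -!scalerBl; congr (_ *: _); ring.
Qed.

Lemma partial_casimir_vec (k : 'I_n) T :
  partial_casimir k (vec T) = casimir_value T k *: vec T.
Proof.
case: k => m ltm; elim: m ltm T => [|m IH] ltm T.
  rewrite /partial_casimir big1 //; set k := Ordinal ltm.
  have [v0 v0P] := mem_card1 (card_row k).
  have row (F : vertex n -> C) : \sum_(v | vrow v == k) F v = F v0.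
    by apply: big_pred1 => v; exact: v0P.
  have below (F : vertex n -> C) : \sum_(w | (vrow w).+1 == k :> nat) F w = 0.
    by rewrite big_pred0.
  by rewrite /casimir_value !row !below !subr0 subrr mul0r scale0r.
have ltm' : (m < n)%N by lia.
set k := Ordinal ltm'; set k' := Ordinal ltm; have kk' : k' = k.+1 :> nat by [].
have [h|h] := boolP (inb T); last first.
  by rewrite (vec_out modelP h) partial_casimir0 scaler0.
have -> : T = val (Sub T h : gt_basis G T0) by rewrite SubK.
set b : gt_basis G T0 := Sub T h; have {}IH := IH ltm'.
have LP := lower_casimir_lowers kk' IH.
rewrite (partial_casimir_next kk') (weighted_comm modelP adm kk' b LP) IH.
rewrite !(weight_vec modelP) !unit_actZ !(weight_vec modelP) !scalerA -scalerBl -!scalerDl.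
congr (_ *: _); set S := val b.
have /asboolP[tr re] : inb S by exact: (valP b).
have dup := row_poles_cancel relG kk' tr re.
have sz := size_poles_zeros S kk'.
have s0 := residue_sum0 sz dup; have s1 := residue_sum1 sz dup.
(* The weight [x + k] splits the sum into the first moment and [k] times the zeroth; the first is
   known only doubled, whence the division by 2. *)
under eq_bigr do rewrite mulrDl; rewrite big_split /= -mulr_sumr s0.
set s1x := \sum_(x <- _) x * _ in s1 *.
have -> : s1x = (2 * s1x) / 2 by field.
rewrite s1 weight_diff //.
rewrite (big_poles S k (fun t => t ^+ 2)) (big_zeros S k k' (fun t => t ^+ 2)).
rewrite /casimir_value /gt_weight !(eq_bigl _ _ (below_next kk')).
have sq (j : 'I_n) : \sum_(v | vrow v == j) (S v + 1) ^+ 2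
    = \sum_(v | vrow v == j) S v ^+ 2 + 2 * \sum_(v | vrow v == j) S v + j.+1%:R.
  rewrite -(sum_const_row j 1) mulr_sumr -!big_split; apply: eq_bigr => v _ /=; ring.
rewrite !sq kk' -[k.+2%:R]natr1 -[k.+1%:R]natr1.
by field.
Qed.

End CasimirAction.

(** * Simplicity *)

Section Separation.
Variables (C : fieldType) (V : lmodType C) (Q : V -> Prop).
Hypotheses (Q0 : Q 0) (QP : forall c u v, Q u -> Q v -> Q (c *: u + v)).

Lemma closedZ c u : Q u -> Q (c *: u).
Proof. by move=> Qu; rewrite -[_ *: _]addr0; apply: QP. Qed.

Lemma closed_sum (I : Type) (r : seq I) (P : pred I) (F : I -> V) :
  (forall i, P i -> Q (F i)) -> Q (\sum_(i <- r | P i) F i).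
Proof.
move=> h; apply: big_ind => // u v Qu Qv.
by rewrite -[u]scale1r; apply: QP.
Qed.

(** A Vandermonde argument without determinants: the polynomial [p] vanishes at the other
    eigenvalues, so the combination with its coefficients isolates [w i]. *)
Lemma closed_separate (I : finType) (P : pred I) (s : I -> C) (w : I -> V) :
  (forall i j, P i -> P j -> s i = s j -> i = j) ->
  (forall m : nat, Q (\sum_(i | P i) s i ^+ m *: w i)) -> forall i, P i -> Q (w i).
Proof.
move=> inj h i Pi; pose p := \prod_(j | P j && (j != i)) ('X - (s j)%:P).
have e : \sum_(m < size p) p`_m *: (\sum_(j | P j) s j ^+ m *: w j) = p.[s i] *: w i.
  under eq_bigr do rewrite scaler_sumr.
  rewrite exchange_big (bigD1 i) //= [X in _ + X]big1 ?addr0 => [|j /andP[Pj ne]].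
    by rewrite horner_coef scaler_suml; apply: eq_bigr => m _; rewrite scalerA.
  have -> : \sum_(m < size p) p`_m *: (s j ^+ m *: w j) = p.[s j] *: w j.
    by rewrite horner_coef scaler_suml; apply: eq_bigr => m _; rewrite scalerA.
  by rewrite /p horner_prod (bigD1 j) ?Pj //= !hornerE subrr mul0r scale0r.
have nz : p.[s i] != 0.
  rewrite /p horner_prod; apply/prodf_neq0 => j /andP[Pj ne].
  by rewrite !hornerE subr_eq0; apply: contra ne => /eqP/(inj _ _ Pi Pj) ->.
rewrite -[w i]scale1r -(mulVf nz) -scalerA; apply: closedZ; rewrite -e.
by apply: closed_sum => m _; apply: closedZ.
Qed.

End Separation.

Section Simplicity.
Variables (C : numFieldType) (n : nat) (T0 : tableau C n).
Let G := tableau_graph T0.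
Hypothesis relG : relation_graph C G.
Hypothesis re0 : realization G T0.
Let adm : admissible_graph G. Proof. by case: relG. Qed.
Let nc : noncritical G. Proof. by case: relG. Qed.
Notation inb := (in_gt_basis G T0).
Implicit Types (T : tableau C n) (u v w : vertex n).

Lemma inb_T0 : inb T0.
Proof. by apply/asboolP; split=> //; exact: int_translate_refl. Qed.

Lemma inb_reachable T u v : inb T -> vrow u = (vrow v).+1 :> nat -> T u = T v ->
  reachable G u v || reachable G v u.
Proof.
move=> /asboolP[[z _ zE] _] row e; apply: consecutive_reachable => //.
have -> : T0 u - T0 v = (z v - z u)%:~R; last by exists (z v - z u).
by apply/eqP; rewrite -subr_eq0 rmorphB /=; move: e; rewrite !zE => /eqP;
  rewrite -subr_eq0 => /eqP e; rewrite -[X in _ == X]e; apply/eqP; ring.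
Qed.

Lemma inb_gap T u v : inb T -> reachable G u v -> gap T u v.
Proof. by move=> /asboolP[_ [sat _]]; apply: reachable_gap. Qed.

Lemma nat_neqN1 (m : nat) : - 1 <> m%:R :> C.
Proof. by move=> /eqP; rewrite eq_sym -addr_eq0 natr1 pnatr_eq0. Qed.

Lemma row_denom_neq0 T v : inb T -> ~~ top_row v -> row_denom T v != 0.
Proof.
move=> /asboolP[_ re] nt; apply/prodf_neq0 => w /andP[/eqP row ne].
rewrite subr_eq0; apply: (row_distinct adm nc re) => //.
by rewrite eq_sym.
Qed.

Section Moves.
Variables k k' : 'I_n.
Hypothesis kk' : k' = k.+1 :> nat.
Let nt v : vrow v == k -> ~~ top_row v. Proof. by move/eqP; exact: (nontop kk'). Qed.

(** If [T v = T w] with [w] above, then [G], being the graph of a tableau, joins them by a path. A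
    path from [w] to [v] is violated after raising [v]; a path from [v] up to [w] would need a
    strict inequality. *)
Lemma gt_raise_neq0 T v : vrow v == k -> inb T -> inb (add_delta T v) ->
  gt_raise T k' v != 0.
Proof.
move=> vk iT iT'; rewrite oppr_eq0 mulf_neq0 ?invr_eq0 ?row_denom_neq0 ?nt //.
apply/prodf_neq0 => w /eqP wk; rewrite subr_eq0; apply/eqP => e.
have row : vrow w = (vrow v).+1 :> nat by rewrite wk (eqP vk).
case/orP: (inb_reachable iT row (esym e)).
  move/(inb_gap iT') => [m em _]; apply: (@nat_neqN1 m); rewrite -em !ffunE eqxx e.
  have -> : (w == v) = false by apply/eqP => ev; move: row; rewrite ev; lia.
  by rewrite /=; ring.
move/(inb_gap iT) => [m em lm]; move: em; rewrite e subrr => /esym/eqP.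
by rewrite pnatr_eq0; lia.
Qed.

Lemma gt_lower_neq0 T v : vrow v == k -> inb T -> inb (sub_delta T v) ->
  gt_lower T k v != 0.
Proof.
move=> vk iT iT'; rewrite mulf_neq0 ?invr_eq0 ?row_denom_neq0 ?nt //.
apply/prodf_neq0 => w /eqP wk; rewrite subr_eq0; apply/eqP => e.
have row : vrow v = (vrow w).+1 :> nat by rewrite wk (eqP vk).
case/orP: (inb_reachable iT row e).
  move/(inb_gap iT') => [m em _]; apply: (@nat_neqN1 m); rewrite -em !ffunE eqxx e.
  have -> : (w == v) = false by apply/eqP => ev; move: row; rewrite ev; lia.
  by rewrite /=; ring.
move/(inb_gap iT) => [m em lm]; move: em; rewrite e subrr => /esym/eqP.
by rewrite pnatr_eq0; lia.
Qed.

Lemma row_inj T u v : inb T -> vrow u == k -> vrow v == k -> T u = T v -> u = v.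
Proof.
move=> /asboolP[_ re] uk vk e; apply/eqP; apply: contraT => ne.
by have := row_distinct adm nc re (etrans (eqP uk) (esym (eqP vk))) (nt uk) ne; rewrite e eqxx.
Qed.

Lemma casimir_sub_inj T u v : inb T -> vrow u == k -> vrow v == k ->
  casimir_value (sub_delta T u) k = casimir_value (sub_delta T v) k -> u = v.
Proof.
move=> iT uk vk; rewrite !casimir_value_sub // => /addIr/addrI/oppr_inj.
exact: row_inj.
Qed.

Lemma casimir_add_inj T u v : inb T -> vrow u == k -> vrow v == k ->
  casimir_value (add_delta T u) k = casimir_value (add_delta T v) k -> u = v.
Proof.
move=> iT uk vk; rewrite !casimir_value_add // => /addIr/addrI; exact: row_inj.
Qed.

End Moves.

Variables (M : glModule C n) (vec : tableau C n -> M) (coef : gt_basis G T0 -> M -> C).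
Hypothesis modelP : gt_model vec coef.
Notation E i j := (@unit_act C n M i j).
Variable Q : M -> Prop.
Hypothesis subQ : gl_submodule Q.

Let Q0 : Q 0. Proof. by case: subQ. Qed.
Let QP c (x y : M) : Q x -> Q y -> Q (c *: x + y). Proof. by case: subQ => _ h _; apply: h. Qed.
Let QE i j x : Q x -> Q (E i j x). Proof. by case: subQ => _ _ h; apply: h. Qed.

Let Qcas k m x : Q x -> Q (iter m (partial_casimir k) x).
Proof.
move=> Qx; elim: m => //= m IH; apply: (closed_sum Q0 QP) => j _.
by do 2!apply: QE.
Qed.

Let iter_cas k m T : iter m (partial_casimir k) (vec T) = casimir_value T k ^+ m *: vec T.
Proof.
elim: m => [|m IH]; first by rewrite scale1r.
by rewrite iterS IH partial_casimirZ (partial_casimir_vec relG modelP) scalerA -exprSr.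
Qed.

Let iter_cas_sum k m (I : Type) (r : seq I) (P : pred I) (F : I -> M) :
  iter m (partial_casimir k) (\sum_(i <- r | P i) F i)
    = \sum_(i <- r | P i) iter m (partial_casimir k) (F i).
Proof.
elim: m => [|m IH] //; rewrite iterS IH partial_casimir_sum.
by apply: eq_bigr => i _; rewrite -iterS.
Qed.

Let iter_casZ k m c (x : M) :
  iter m (partial_casimir k) (c *: x) = c *: iter m (partial_casimir k) x.
Proof. by elim: m => //= m ->; rewrite partial_casimirZ. Qed.

(** Powers of S_k applied to E_(k+1)k T scale each neighbour by powers of distinct eigenvalues, so
    each neighbour with its nonzero coefficient lies in [Q]. *)
Lemma generate_lower (k k' : 'I_n) T v : k' = k.+1 :> nat -> vrow v == k ->
  inb T -> inb (sub_delta T v) -> Q (vec T) -> Q (vec (sub_delta T v)).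
Proof.
move=> kk' vk iT iT' QT.
have nz := gt_lower_neq0 kk' vk iT iT'.
suff : Q (gt_lower T k v *: vec (sub_delta T v)).
  by move/(closedZ Q0 QP (gt_lower T k v)^-1); rewrite scalerA mulVf // scale1r.
apply: (closed_separate Q0 QP (P := fun v => vrow v == k)
  (s := fun v => casimir_value (sub_delta T v) k)
  (w := fun v => gt_lower T k v *: vec (sub_delta T v))) vk.
  by move=> u w uk wk; apply: (casimir_sub_inj kk').
move=> m; have := Qcas k m (QE k' k QT).
have eT : T = val (Sub T iT : gt_basis G T0) by rewrite SubK.
rewrite {1}eT (lower_vec modelP _ kk') SubK iter_cas_sum.
rewrite (eq_bigr (fun v => casimir_value (sub_delta T v) k ^+ m
  *: (gt_lower T k v *: vec (sub_delta T v)))) // => u _.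
by rewrite iter_casZ iter_cas !scalerA mulrC.
Qed.

Lemma generate_raise (k k' : 'I_n) T v : k' = k.+1 :> nat -> vrow v == k ->
  inb T -> inb (add_delta T v) -> Q (vec T) -> Q (vec (add_delta T v)).
Proof.
move=> kk' vk iT iT' QT.
have nz := gt_raise_neq0 kk' vk iT iT'.
suff : Q (gt_raise T k' v *: vec (add_delta T v)).
  by move/(closedZ Q0 QP (gt_raise T k' v)^-1); rewrite scalerA mulVf // scale1r.
apply: (closed_separate Q0 QP (P := fun v => vrow v == k)
  (s := fun v => casimir_value (add_delta T v) k)
  (w := fun v => gt_raise T k' v *: vec (add_delta T v))) vk.
  by move=> u w uk wk; apply: (casimir_add_inj kk').
move=> m; have := Qcas k m (QE k k' QT).
have eT : T = val (Sub T iT : gt_basis G T0) by rewrite SubK.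
rewrite {1}eT (raise_vec modelP _ kk') SubK iter_cas_sum.
rewrite (eq_bigr (fun v => casimir_value (add_delta T v) k ^+ m
  *: (gt_raise T k' v *: vec (add_delta T v)))) // => u _.
by rewrite iter_casZ iter_cas !scalerA mulrC.
Qed.

(** Extension of [coef] by 0 to all tableaux, so that the transposed formulas need no membership
    tests. *)
Definition tcoef T x : C := if insub T is Some b then coef b x else 0.

Lemma tcoef_in T x (h : inb T) : tcoef T x = coef (Sub T h) x.
Proof. by rewrite /tcoef insubT. Qed.

Lemma tcoef_out T x : ~~ inb T -> tcoef T x = 0.
Proof. by move=> h; rewrite /tcoef insubF //; exact: negbTE h. Qed.

Lemma tcoef_sum T (I : Type) (r : seq I) (P : pred I) (c : I -> C) (F : I -> M) :
  tcoef T (\sum_(i <- r | P i) c i *: F i) = \sum_(i <- r | P i) c i * tcoef T (F i).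
Proof.
have [h|h] := boolP (inb T).
  rewrite tcoef_in (gt_coef_sum modelP); apply: eq_bigr => i _.
  by rewrite tcoef_in (gt_coefZ modelP).
by rewrite tcoef_out // big1 // => i _; rewrite tcoef_out // mulr0.
Qed.

Lemma tcoef_vec T T' : inb T -> tcoef T (vec T') = (T == T')%:R.
Proof. by move=> h; rewrite (tcoef_in _ h) (gt_coef_vec modelP) SubK. Qed.

Lemma tcoef_raise (k k' : 'I_n) T x : k' = k.+1 :> nat -> inb T ->
  tcoef T (E k k' x)
    = \sum_(v | vrow v == k) gt_raise (sub_delta T v) k' v * tcoef (sub_delta T v) x.
Proof.
move=> kk' iT; have [r ->] := model_expand modelP x.
rewrite unit_act_sum; under eq_bigr do rewrite unit_actZ.
rewrite tcoef_sum; under [RHS]eq_bigr do rewrite tcoef_sum mulr_sumr.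
rewrite exchange_big; apply: eq_bigr => b _ /=; rewrite (raise_vec modelP _ kk') tcoef_sum.
rewrite mulr_sumr; apply: eq_bigr => v _; rewrite [RHS]mulrCA tcoef_vec //; congr (_ * _).
have [h|h] := boolP (inb (sub_delta T v)).
  rewrite tcoef_vec //; have [<-|ne] := eqVneq (sub_delta T v) (val b).
    by rewrite sub_deltaK eqxx.
  rewrite !mulr0; case: eqP => [e|_]; last by rewrite mulr0.
  by move: ne; rewrite e add_deltaK eqxx.
rewrite tcoef_out // mulr0; case: eqP => [e|_]; last by rewrite mulr0.
by move: h; rewrite e add_deltaK (basis_inb b).
Qed.

Lemma tcoef_lower (k k' : 'I_n) T x : k' = k.+1 :> nat -> inb T ->
  tcoef T (E k' k x)
    = \sum_(v | vrow v == k) gt_lower (add_delta T v) k v * tcoef (add_delta T v) x.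
Proof.
move=> kk' iT; have [r ->] := model_expand modelP x.
rewrite unit_act_sum; under eq_bigr do rewrite unit_actZ.
rewrite tcoef_sum; under [RHS]eq_bigr do rewrite tcoef_sum mulr_sumr.
rewrite exchange_big; apply: eq_bigr => b _ /=; rewrite (lower_vec modelP _ kk') tcoef_sum.
rewrite mulr_sumr; apply: eq_bigr => v _; rewrite [RHS]mulrCA tcoef_vec //; congr (_ * _).
have [h|h] := boolP (inb (add_delta T v)).
  rewrite tcoef_vec //; have [<-|ne] := eqVneq (add_delta T v) (val b).
    by rewrite add_deltaK eqxx.
  rewrite !mulr0; case: eqP => [e|_]; last by rewrite mulr0.
  by move: ne; rewrite e sub_deltaK eqxx.
rewrite tcoef_out // mulr0; case: eqP => [e|_]; last by rewrite mulr0.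
by move: h; rewrite e sub_deltaK (basis_inb b).
Qed.

Lemma tcoef_cas k m T x :
  tcoef T (iter m (partial_casimir k) x) = casimir_value T k ^+ m * tcoef T x.
Proof.
have [iT|h] := boolP (inb T); last by rewrite !tcoef_out ?mulr0.
have [r ->] := model_expand modelP x; rewrite iter_cas_sum.
under eq_bigr do rewrite iter_casZ.
rewrite !tcoef_sum mulr_sumr; apply: eq_bigr => b _; rewrite mulrCA; congr (_ * _).
rewrite iter_cas; have := tcoef_sum T [:: tt] xpredT
  (fun=> casimir_value (val b) k ^+ m) (fun=> vec (val b)).
rewrite !big_seq1 => ->; rewrite tcoef_vec //.
by case: eqP => [->|_]; rewrite ?mulr0.
Qed.

Definition vanishes T := forall x, Q x -> tcoef T x = 0.

(** The transpose of generation: the coefficient at [T] of a raised vector involves those at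
    [T - delta], so lowering the tableau uses the raising operator. *)
Lemma vanishes_lower (k k' : 'I_n) T v : k' = k.+1 :> nat -> vrow v == k ->
  inb T -> inb (sub_delta T v) -> vanishes T -> vanishes (sub_delta T v).
Proof.
move=> kk' vk iT iT' VT x Qx.
have nz : gt_raise (sub_delta T v) k' v != 0.
  by apply: (gt_raise_neq0 kk' vk iT'); rewrite sub_deltaK.
suff /eqP : gt_raise (sub_delta T v) k' v * tcoef (sub_delta T v) x = 0.
  by rewrite mulf_eq0 (negPf nz) => /eqP.
(* Separation takes place in the one-dimensional space [C^o], with the zero subspace as the closed
   predicate. *)
apply: (@closed_separate C C^o (fun t => t = 0) _ _ _ (fun v => vrow v == k)
  (fun v => casimir_value (sub_delta T v) k)
  (fun v => gt_raise (sub_delta T v) k' v * tcoef (sub_delta T v) x)) vk => //.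
- by move=> c s t -> ->; rewrite scaler0 addr0.
- by move=> u w uk wk; apply: (casimir_sub_inj kk').
move=> m; have := VT _ (QE k k' (Qcas k m Qx)); rewrite tcoef_raise //; apply: etrans.
by apply: eq_bigr => u _; rewrite tcoef_cas mulrCA.
Qed.

Lemma vanishes_raise (k k' : 'I_n) T v : k' = k.+1 :> nat -> vrow v == k ->
  inb T -> inb (add_delta T v) -> vanishes T -> vanishes (add_delta T v).
Proof.
move=> kk' vk iT iT' VT x Qx.
have nz : gt_lower (add_delta T v) k v != 0.
  by apply: (gt_lower_neq0 kk' vk iT'); rewrite add_deltaK.
suff /eqP : gt_lower (add_delta T v) k v * tcoef (add_delta T v) x = 0.
  by rewrite mulf_eq0 (negPf nz) => /eqP.
apply: (@closed_separate C C^o (fun t => t = 0) _ _ _ (fun v => vrow v == k)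
  (fun v => casimir_value (add_delta T v) k)
  (fun v => gt_lower (add_delta T v) k v * tcoef (add_delta T v) x)) vk => //.
- by move=> c s t -> ->; rewrite scaler0 addr0.
- by move=> u w uk wk; apply: (casimir_add_inj kk').
move=> m; have := VT _ (QE k' k (Qcas k m Qx)); rewrite tcoef_lower //; apply: etrans.
by apply: eq_bigr => u _; rewrite tcoef_cas mulrCA.
Qed.

End Simplicity.

(** * Connectedness of the basis under unit moves *)

Section Connectivity.
Variables (C : numFieldType) (n : nat) (T0 : tableau C n).
Let G := tableau_graph T0.
Hypothesis adm : admissible_graph G.
Hypothesis re0 : realization G T0.
Notation inb := (in_gt_basis G T0).
Implicit Types (T : tableau C n) (u v w x y : vertex n) (z : vertex n -> int).

Definition shifted T z := forall v, T v = T0 v + (z v)%:~R.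

(** Each arrow may be compared with either of two known realizations: its difference is at least
    that in [T], or at least that in [T0]. *)
Lemma translate_satisfies T T' z z' : satisfies G T -> shifted T z -> shifted T' z' ->
  (forall x y, arrow G x y -> (z x - z y <= z' x - z' y) || (0 <= z' x - z' y)) ->
  satisfies G T'.
Proof.
move=> sat zE z'E h x y xy.
have addnat (t : C) (i : int) : 0 <= i -> is_nat t -> is_nat (t + i%:~R).
  by case: i => // i _ [m ->]; exists (m + i)%N; rewrite natrD.
have addpos (t : C) (i : int) : 0 <= i -> is_pos_nat t -> is_pos_nat (t + i%:~R).
  by case: i => // i _ [m ->]; exists (m + i)%N; rewrite -addSn natrD.
case/orP: (h _ _ xy) => [le|le].
  have -> : T' x - T' y = T x - T y + ((z' x - z' y) - (z x - z y))%:~R.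
    by rewrite !zE !z'E !rmorphB /=; ring.
  have := sat _ _ xy; case: ifP => _; [apply: addpos|apply: addnat]; lia.
have -> : T' x - T' y = T0 x - T0 y + (z' x - z' y)%:~R.
  by rewrite !z'E !rmorphB /=; ring.
by have := re0.1 _ _ xy; case: ifP => _; [apply: addpos|apply: addnat].
Qed.

Lemma shifted_inb T T' z z' : inb T -> shifted T z -> shifted T' z' ->
  (forall v, top_row v -> z' v = 0) ->
  (forall x y, arrow G x y -> (z x - z y <= z' x - z' y) || (0 <= z' x - z' y)) ->
  inb T'.
Proof.
move=> /asboolP[_ re] zE z'E top h; apply/asboolP; split.
  by exists [ffun v => z' v] => v; rewrite ffunE; [exact: top|exact: z'E].
apply: (realization_translate z'E _ re0).
by apply: (translate_satisfies re.1 zE z'E).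
Qed.

(** Choose [v] with the smallest reachable set among the vertices of positive offset. By acyclicity
    every arrow out of [v] ends at a vertex with [z <= 0], so after lowering [v] the difference
    along it is still at least that in [T0]. *)
Lemma decrease_positive T z v0 : inb T -> shifted T z -> (forall v, top_row v -> z v = 0) ->
  0 < z v0 -> exists2 v, 0 < z v & inb (sub_delta T v).
Proof.
move=> iT zE top pos0.
have [v pv vmin] := @arg_minnP _ v0 (fun v => 0 < z v)
  (fun v => #|[set u | reachable G v u]|) pos0.
exists v => //; apply: (@shifted_inb T _ z (fun w => z w - (w == v)%:Z)) => // [w|w tw|x y xy].
- by rewrite ffunE zE rmorphB /= addrA; case: eqP.
- rewrite top //; case: eqP => // e; move: pv; rewrite -e top //.
have [ex|_] := eqVneq x v; have [ey|_] := eqVneq y v; try lia.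
suff : z y <= 0 by rewrite ex; lia.
rewrite leNgt; apply/negP => /vmin; apply/negP; rewrite -ltnNge.
apply: proper_card; apply/properP; split.
  apply/subsetP => u; rewrite !inE; apply: connect_trans; apply: connect1.
  by rewrite -ex.
exists v; rewrite !inE ?connect0 //; last by rewrite -ex; exact: adm.2.
exact: connect0.
Qed.

Lemma increase_negative T z v0 : inb T -> shifted T z -> (forall v, top_row v -> z v = 0) ->
  z v0 < 0 -> exists2 v, z v < 0 & inb (add_delta T v).
Proof.
move=> iT zE top neg0.
have [v pv vmin] := @arg_minnP _ v0 (fun v => z v < 0)
  (fun v => #|[set u | reachable G u v]|) neg0.
exists v => //; apply: (@shifted_inb T _ z (fun w => z w + (w == v)%:Z)) => // [w|w tw|x y xy].
- by rewrite ffunE zE rmorphD /= addrA; case: eqP.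
- rewrite top //; case: eqP => // e; move: pv; rewrite -e top //.
have [ex|_] := eqVneq x v; have [ey|_] := eqVneq y v; try lia.
suff : 0 <= z x by rewrite ey; lia.
rewrite leNgt; apply/negP => /vmin; apply/negP; rewrite -ltnNge.
apply: proper_card; apply/properP; split.
  apply/subsetP => u; rewrite !inE => ux; apply: connect_trans ux _; apply: connect1.
  by rewrite -ey.
exists v; rewrite !inE; last by rewrite -ey; exact: adm.2.
exact: connect0.
Qed.

(** Induction on the total absolute offset from [T0]. A step towards [T0] is found inside the basis,
    and the property is carried back along the reverse move. *)
Lemma basis_connected (P : tableau C n -> Prop) : P T0 ->
  (forall T v, ~~ top_row v -> inb T -> inb (add_delta T v) -> P T -> P (add_delta T v)) ->
  (forall T v, ~~ top_row v -> inb T -> inb (sub_delta T v) -> P T -> P (sub_delta T v)) ->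
  forall T, inb T -> P T.
Proof.
move=> P0 up down T iT; have := iT; case/asboolP => -[z top zE] _.
have zE' : shifted T z by [].
move: {zE}(fun_of_fin z) top zE' => {}z top zE.
have [N leN] : exists N, (\sum_v `|z v|%N <= N)%N by exists (\sum_v `|z v|%N)%N.
elim: N => [|N IH] in T z iT top zE leN *.
  suff -> : T = T0 by [].
  apply/ffunP => v; rewrite zE; suff -> : z v = 0 by rewrite addr0.
  by move: leN; rewrite leqn0 sum_nat_eq0 => /forallP/(_ v)/implyP/(_ isT); lia.
have nontop v : z v != 0 -> ~~ top_row v by apply: contra => /top ->.
have smaller v (z' : vertex n -> int) : (forall w, w != v -> z' w = z w) ->
    (`|z' v| < `|z v|)%N -> (\sum_w `|z' w|%N <= N)%N.
  move=> h lt; rewrite -ltnS; apply: leq_trans leN.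
  rewrite (bigD1 v) //= [ltnRHS](bigD1 v) //=.
  by rewrite (eq_bigr (fun w => `|z w|%N)) ?ltn_add2r // => w nw; rewrite h.
have [[v0 pos]|nopos] := pselect (exists v, 0 < z v).
  have [v pv iT'] := decrease_positive iT zE top pos.
  have nt : ~~ top_row v by apply: nontop; lia.
  rewrite -(sub_deltaK T v); apply: up; rewrite ?sub_deltaK //.
  apply: (IH _ (fun w => z w - (w == v)%:Z)) => //.
  - by move=> w tw; rewrite top //; case: eqP => // e; rewrite -e tw in nt.
  - by move=> w; rewrite ffunE zE rmorphB /= addrA; case: eqP.
  apply: (smaller v) => [w /negPf -> |]; first by rewrite subr0.
  by rewrite eqxx; lia.
have [[v0 neg]|noneg] := pselect (exists v, z v < 0).
  have [v pv iT'] := increase_negative iT zE top neg.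
  have nt : ~~ top_row v by apply: nontop; lia.
  rewrite -(add_deltaK T v); apply: down; rewrite ?add_deltaK //.
  apply: (IH _ (fun w => z w + (w == v)%:Z)) => //.
  - by move=> w tw; rewrite top //; case: eqP => // e; rewrite -e tw in nt.
  - by move=> w; rewrite ffunE zE rmorphD /= addrA; case: eqP.
  apply: (smaller v) => [w /negPf -> |]; first by rewrite addr0.
  by rewrite eqxx; lia.
suff -> : T = T0 by [].
apply/ffunP => v; rewrite zE; suff -> : z v = 0 by rewrite addr0.
have [lt|lt|//] := ltgtP (z v) 0; first by case: noneg; exists v.
by case: nopos; exists v.
Qed.

End Connectivity.

Section SimplicityConclusion.
Variables (C : numFieldType) (n : nat) (T0 : tableau C n).
Let G := tableau_graph T0.
Hypothesis relG : relation_graph C G.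
Hypothesis re0 : realization G T0.
Let adm : admissible_graph G. Proof. by case: relG. Qed.
Variables (M : glModule C n) (vec : tableau C n -> M) (coef : gt_basis G T0 -> M -> C).
Hypothesis modelP : gt_model vec coef.
Variable Q : M -> Prop.
Hypothesis subQ : gl_submodule Q.
Notation inb := (in_gt_basis G T0).

Lemma next_row (v : vertex n) : ~~ top_row v -> exists k' : 'I_n, k' = (vrow v).+1 :> nat.
Proof.
rewrite /top_row => nt; have lt : ((vrow v).+1 < n)%N by have := ltn_ord (vrow v); lia.
by exists (Ordinal lt).
Qed.

Lemma generated_by_T0 : Q (vec T0) -> forall x, Q x.
Proof.
move=> QT0 x; have QT T : inb T -> Q (vec T).
  apply: (basis_connected adm re0 (P := fun T => Q (vec T))) => // {}T v nt.
    by have [k' kk'] := next_row nt; apply: (generate_raise relG modelP subQ kk').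
  by have [k' kk'] := next_row nt; apply: (generate_lower relG modelP subQ kk').
have [r ->] := model_expand modelP x; have [Q0 QP _] := subQ.
apply: (closed_sum Q0 QP) => b _; apply: (closedZ Q0 QP); apply: QT.
exact: basis_inb.
Qed.

Lemma zero_of_coef (b0 : gt_basis G T0) : val b0 = T0 ->
  (forall x, Q x -> coef b0 x = 0) -> forall x, Q x -> x = 0.
Proof.
move=> eb0 V0 x Qx; have VT T : inb T -> vanishes coef Q T.
  apply: (basis_connected adm re0) => [y Qy|{}T v nt|{}T v nt].
  - have h : inb T0 by rewrite -[X in inb X]eb0; exact: basis_inb.
    rewrite (tcoef_in _ _ h); have -> : Sub T0 h = b0 by apply: val_inj; rewrite SubK.
    exact: V0.
  - by have [k' kk'] := next_row nt; apply: (vanishes_raise relG modelP subQ kk').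
  - by have [k' kk'] := next_row nt; apply: (vanishes_lower relG modelP subQ kk').
apply: (model_ext modelP) => b; rewrite (gt_coef0 modelP).
by have := VT _ (basis_inb b) x Qx; rewrite /tcoef valK.
Qed.

End SimplicityConclusion.

(** * The tableau T_sigma *)

Section Columns.
Variables (V : zmodType) (n : nat).
Implicit Types (u v w : vertex n) (k i r : 'I_n).

Lemma vertex_above v : ~~ top_row v -> exists u, just_above u v.
Proof.
move=> nt; have [k' ek'] := next_row nt.
have le : (vcol v <= k')%N by rewrite ek'; apply: leqW; exact: (valP v).
by exists (exist _ (k', vcol v) le); rewrite /just_above eqxx /= ek' /vrow /=.
Qed.

Lemma column_sum (F : vertex n -> V) (d : 'I_n -> 'I_n -> V) (top : 'I_n -> V) :
  (forall u v, just_above u v -> F v = F u + d (vrow u) (vcol u)) ->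
  (forall v, top_row v -> F v = top (vcol v)) ->
  forall v, F v = top (vcol v) + \sum_(r : 'I_n | (vrow v < r)%N) d r (vcol v).
Proof.
move=> step topE v; have [N eN] : exists N, (n <= N + (vrow v).+1)%N by exists n; lia.
elim: N => [|N IH] in v eN *.
  have t : top_row v by apply/eqP; have := ltn_ord (vrow v); lia.
  by rewrite topE // big_pred0 ?addr0 // => r; have := ltn_ord r; lia.
have [t|nt] := boolP (top_row v).
  rewrite topE // big_pred0 ?addr0 // => r; have := ltn_ord r; move/eqP: t; lia.
have [u uv] := vertex_above nt; have /andP[/eqP col /eqP row] := uv.
rewrite (step _ _ uv) IH; last by lia.
rewrite col [in RHS](bigD1 (vrow u)) /=; last by rewrite row.
rewrite -addrA; congr (_ + _); rewrite addrC; congr (_ + _).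
apply: eq_bigl => r; rewrite row -(inj_eq val_inj) /=; lia.
Qed.

Lemma sum_row_col k (F : 'I_n -> V) :
  \sum_(v | vrow v == k) F (vcol v) = \sum_(i : 'I_n | (i <= k)%N) F i.
Proof.
have -> : \sum_(v | vrow v == k) F (vcol v) = \sum_(i <- map (@vcol n) (enum (in_row k))) F i.
  by rewrite big_map big_enum.
rewrite -big_enum /=; apply: perm_big; apply: uniq_perm; rewrite ?enum_uniq //.
  rewrite map_inj_in_uniq ?enum_uniq // => u v; rewrite !mem_enum => /eqP uk /eqP vk e.
  by apply: vertex_eqP; rewrite ?uk ?vk.
move=> i; rewrite mem_enum; apply/mapP/idP => [[v]|le].
  by rewrite mem_enum => /eqP <- ->; exact: (valP v).
by exists (exist _ (k, i) le); rewrite ?mem_enum //; apply/eqP.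
Qed.

Lemma sum_below_col k (F : 'I_n -> V) :
  \sum_(v | (vrow v).+1 == k :> nat) F (vcol v) = \sum_(i : 'I_n | (i < k)%N) F i.
Proof.
case: k => -[|m] lt; first by rewrite !big_pred0.
have lt' : (m < n)%N by lia.
by have := sum_row_col (Ordinal lt') F; rewrite /= => <-.
Qed.

(** Column by column: a column [i < k] contributes only minus its step at row [k], while column [k]
    starts in row [k] and contributes its whole entry. It is used for [T0] and for the difference of
    two tableaux. *)
Lemma row_weight_sum (F : vertex n -> V) (d : 'I_n -> 'I_n -> V) (top : 'I_n -> V) k :
  (forall u v, just_above u v -> F v = F u + d (vrow u) (vcol u)) ->
  (forall v, top_row v -> F v = top (vcol v)) ->
  \sum_(v | vrow v == k) F v - \sum_(w | (vrow w).+1 == k :> nat) F w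
    = top k + \sum_(r : 'I_n | (k < r)%N) d r k - \sum_(i : 'I_n | (i < k)%N) d k i.
Proof.
move=> step topE; have FE := column_sum step topE.
pose Phi i := top i + \sum_(r : 'I_n | (k < r)%N) d r i.
rewrite (eq_bigr (fun v => Phi (vcol v))); last first.
  by move=> v /eqP vk; rewrite FE vk.
rewrite [X in _ - X](eq_bigr (fun v => Phi (vcol v) + d k (vcol v))); last first.
  move=> v /eqP vk; rewrite FE /Phi (bigD1 k) /=; last by rewrite -vk.
  rewrite -addrA; congr (_ + _); rewrite addrC; congr (_ + _).
  by apply: eq_bigl => r; rewrite -vk -(inj_eq val_inj) /= -vk; lia.
rewrite (sum_row_col k Phi) (sum_below_col k (fun i => Phi i + d k i)) [X in _ - X]big_split /=.
have -> : \sum_(i : 'I_n | (i <= k)%N) Phi i = Phi k + \sum_(i : 'I_n | (i < k)%N) Phi i.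
  rewrite (bigD1 k) //=; congr (_ + _); apply: eq_bigl => i.
  by rewrite -(inj_eq val_inj) /=; lia.
by rewrite opprD addrA addrK.
Qed.

End Columns.

Lemma sum_lt_ord (n : nat) (k : 'I_n) : (\sum_(i : 'I_n | (i < k)%N) 1)%N = k.
Proof. by rewrite (big_ord_narrow (ltnW (ltn_ord k))) sum1_card card_ord. Qed.

Section PermTableau.
Variables (C : numFieldType) (n : nat) (s : 'S_n) (X : 'rV[C]_n).
Let tau : 'I_n -> 'I_n := s^-1%g.
Let T0 := T_perm s X.
Let G := tableau_graph T0.
Implicit Types (u v w : vertex n).

Lemma T_perm_step u v : just_above u v ->
  T0 v = T0 u + (tau (vrow u) < tau (vcol u))%N%:R.
Proof.
move=> uv; have /andP[/eqP col /eqP row] := uv.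
rewrite !ffunE -col; have -> : (n.-1 - vrow v)%N = (n.-1 - vrow u).+1.
  by have := ltn_ord (vrow u); lia.
rewrite /=; have -> : (n.-1 - (n.-1 - vrow u))%N = vrow u.
  by have := ltn_ord (vrow u); lia.
rewrite (A_downE _ uv) (Sigma_down uv (G_permP s).2) -/tau.
have ne : tau (vcol u) != tau (vrow u) :> nat.
  apply/eqP => /val_inj/perm_inj e; have := just_above_col uv; rewrite e; lia.
by case: ltngtP ne => //; rewrite addr0.
Qed.

Lemma T_perm_top v : top_row v -> T0 v = X 0 (tau (vcol v)).
Proof. by move=> /eqP t; rewrite ffunE; have -> : (n.-1 - vrow v = 0)%N by lia. Qed.

(** A count of inversions: [k] plus the number of [r > k] with [tau r < tau k], minus the number of
    [i < k] with [tau i > tau k], equals the number of indices with smaller [tau], which is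
    [tau k]. *)
Lemma T_perm_weight k : gt_weight T0 k = X 0 (tau k) + (tau k)%:R.
Proof.
rewrite /gt_weight -addrA.
have e := @row_weight_sum C n T0 (fun r i => (tau r < tau i)%N%:R)
  (fun i => X 0 (tau i)) k T_perm_step T_perm_top.
rewrite [X in _ + X]e {e}.
have -> : k%:R = \sum_(i : 'I_n | (i < k)%N) (tau k < tau i)%N%:R
    + \sum_(i : 'I_n | (i < k)%N) (tau i < tau k)%N%:R :> C.
  rewrite -[in LHS](sum_lt_ord k) natr_sum -big_split; apply: eq_bigr => i lti /=.
  rewrite -natrD; congr _%:R.
  have ne : tau i != tau k :> nat.
    by apply/eqP => /val_inj/perm_inj e; move: lti; rewrite e; lia.
  by lia.
have -> : (tau k)%:R = \sum_(i : 'I_n | (i < k)%N) (tau i < tau k)%N%:R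
    + \sum_(r : 'I_n | (k < r)%N) (tau r < tau k)%N%:R :> C.
  have -> : (tau k)%:R = (\sum_(i : 'I_n) (tau i < tau k))%N%:R :> C.
    congr _%:R.
    have -> : (\sum_(i : 'I_n) (tau i < tau k) = \sum_(j : 'I_n) (j < tau k))%N.
      by rewrite [RHS](reindex_inj (@perm_inj _ s^-1%g)).
    have h : (\sum_(j : 'I_n) (j < tau k) = \sum_(j : 'I_n | (j < tau k)%N) 1)%N.
      by rewrite [RHS]big_mkcond /=; apply: eq_bigr => j _; case: ifP.
    by rewrite h sum_lt_ord.
  rewrite natr_sum (bigID (fun i : 'I_n => (i < k)%N)) /=; congr (_ + _).
  rewrite (bigD1 k) /=; last by rewrite ltnn.
  rewrite ltnn add0r; apply: eq_bigl => i; rewrite -(inj_eq val_inj) /=; lia.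
by ring.
Qed.

Hypothesis adm : admissible_graph G.

Lemma T_perm_column v : exists t, [/\ top_row t, vcol t = vcol v & same_component G v t].
Proof.
have [N eN] : exists N, (n <= N + (vrow v).+1)%N by exists n; lia.
elim: N => [|N IH] in v eN *.
  by exists v; split=> //; [apply/eqP; have := ltn_ord (vrow v); lia|exact: connect0].
have [t|nt] := boolP (top_row v); first by exists v; split=> //; exact: connect0.
have [u uv] := vertex_above nt; have /andP[/eqP col /eqP row] := uv.
have [|t [tt ct st]] := IH u; first by lia.
exists t; split=> //; first by rewrite ct.
apply: connect_trans st.
have h : is_int (T0 u - T0 v).
  rewrite (T_perm_step uv) opprD addrA subrr add0r; apply: is_intN; exact: nat_is_int.
case/orP: (consecutive_reachable row h) => /reachable_component //.
by rewrite same_component_sym.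
Qed.

(** Every column is tied to its top vertex since its steps are 0 or 1. An integral difference inside
    a row thus passes to the top row, where the horizontal arrows supply a connection. *)
Lemma T_perm_realization : realization G T0.
Proof.
have sat : satisfies G T0 := @tableau_graph_satisfies _ _ _.
split=> // u v row nt h; have [t [tt _ ut]] := T_perm_column u.
have [t' [tt' _ vt']] := T_perm_column v.
have h' : is_int (T0 t - T0 t').
  apply: (is_int_trans (y := T0 u)).
    by apply: (component_is_int sat); rewrite same_component_sym.
  by apply: (is_int_trans h); apply: component_is_int vt'.
apply: connect_trans ut _; rewrite -/(same_component G t v) same_component_sym.
apply: connect_trans vt' _; rewrite -/(same_component G t' t) same_component_sym.
case/orP: (top_reachable tt tt' h') => /reachable_component //.
by rewrite same_component_sym.
Qed.

Definition height (T : tableau C n) : C := \sum_k (tau k)%:R * gt_weight T k.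

Lemma height_T_perm : height T0 = \sum_(j : 'I_n) j%:R * (X 0 j + j%:R).
Proof.
rewrite [RHS](reindex_inj (@perm_inj _ s^-1%g)).
by apply: eq_bigr => k _; rewrite T_perm_weight.
Qed.

(** [T0] makes every vertical relation of its graph tight: equality where G_sigma points down,
    difference 1 where it points up. Any other basis tableau can deviate in one direction only, and
    the sign of [tau i - tau r] turns each deviation into a nonnegative contribution. *)
Lemma height_ge T : in_gt_basis G T0 T -> exists m : nat, height T = height T0 + m%:R.
Proof.
move=> /asboolP[[z top zE] re]; pose Z v := T v - T0 v.
have gapT u v : reachable G u v -> gap T u v by apply: reachable_gap => //; case: re.
(* [d (r, i)] is the change from [T0] to [T] of the step of column [i] from row [r] to the row below
   it. *)
have [d dE] : exists d : 'I_n * 'I_n -> int, forall u v, just_above u v ->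
    Z v = Z u + (d (vrow u, vcol u))%:~R.
  have ex (p : 'I_n * 'I_n) : exists m : int, forall u v, just_above u v ->
      vrow u = p.1 -> vcol u = p.2 -> Z v = Z u + m%:~R.
    have [[u [v [uv up1 up2]]]|no] := pselect (exists u v,
        [/\ just_above u v, vrow u = p.1 & vcol u = p.2]).
      exists (z v - z u) => u' v' uv' r c.
      have [-> ->] := just_above_inj uv' uv (etrans r (esym up1)) (etrans c (esym up2)).
      by rewrite /Z !zE rmorphB /=; ring.
    by exists 0 => u v uv r c; case: no; exists u, v.
  by have [d dE] := choice ex; exists d => u v uv; exact: (dE (vrow u, vcol u) u v uv).
have sgn (r i : 'I_n) : (i < r)%N -> exists m : nat,
    (d (r, i))%:~R * ((tau i)%:R - (tau r)%:R) = m%:R :> C.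
  move=> lt; have [u [v [uv ur uc]]] := just_above_pair lt.
  have := dE _ _ uv; rewrite ur uc => e; have /andP[/eqP col /eqP row] := uv.
  have st := T_perm_step uv; rewrite ur uc in st.
  have hd : is_int (T0 u - T0 v).
    by rewrite st opprD addrA subrr add0r; apply: is_intN; exact: nat_is_int.
  have eT : T v = T u + (tau r < tau i)%N%:R + (d (r, i))%:~R.
    have -> : T v = T0 v + Z v by rewrite /Z; ring.
    by rewrite e st /Z; ring.
  have [lt'|ge] := ltnP (tau r) (tau i).
    have vu : reachable G v u.
      rewrite tableau_graph_reachable; apply: connect1; rewrite /arrow inE.
      apply/or3P; apply: Or32; rewrite row eqxx; apply/asboolP; exists 0%N.
      by rewrite st lt' addrC addKr.
    have [m em lm] := gapT _ _ vu.
    exists (m.-1 * (tau i - tau r))%N; rewrite natrM natrB; last exact: ltnW.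
    have -> : (d (r, i))%:~R = T v - T u - 1 by rewrite eT lt' mulr1n; ring.
    by rewrite em -[in LHS](@prednK m) -?natr1; [ring|lia].
  have uv' : reachable G u v.
    rewrite tableau_graph_reachable; apply: connect1; rewrite /arrow inE.
    apply/or3P; apply: Or31; rewrite row eqxx; apply/asboolP; exists 0%N.
    by rewrite st ltnNge ge /= addr0 subrr.
  have [m em lm] := gapT _ _ uv'.
  exists (m * (tau r - tau i))%N; rewrite natrM natrB //.
  have -> : (d (r, i))%:~R = - (T u - T v) by rewrite eT ltnNge ge mulr0n; ring.
  by rewrite em; ring.
have wt k : gt_weight T k = gt_weight T0 k
    + (\sum_(r : 'I_n | (k < r)%N) (d (r, k))%:~R - \sum_(i : 'I_n | (i < k)%N) (d (k, i))%:~R).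
  have := @row_weight_sum C n Z (fun r i => (d (r, i))%:~R) (fun=> 0) k dE.
  rewrite add0r => <-; last first.
    by move=> v tv; rewrite /Z zE top // addr0 subrr.
  by rewrite /gt_weight /Z !sumrB; ring.
(* Summation by parts: each step enters the weight of its column with a plus sign and that of its
   row with a minus sign. *)
have -> : height T = height T0 + \sum_(r : 'I_n) \sum_(i : 'I_n | (i < r)%N)
    (d (r, i))%:~R * ((tau i)%:R - (tau r)%:R).
  rewrite /height; under eq_bigr do rewrite wt mulrDr.
  rewrite big_split /=; congr (_ + _).
  under eq_bigr do rewrite mulrBr !mulr_sumr.
  rewrite sumrB /=.
  rewrite (exchange_big_dep xpredT) //= -sumrB; apply: eq_bigr => r _.
  under [RHS]eq_bigr do rewrite mulrBr.
  by rewrite sumrB; congr (_ - _); apply: eq_bigr => i _; rewrite mulrC.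
have [f fE] : exists f : 'I_n -> 'I_n -> nat, forall r i : 'I_n, (i < r)%N ->
    (d (r, i))%:~R * ((tau i)%:R - (tau r)%:R) = (f r i)%:R :> C.
  have ex (p : 'I_n * 'I_n) : exists m : nat, (p.2 < p.1)%N ->
      (d p)%:~R * ((tau p.2)%:R - (tau p.1)%:R) = m%:R :> C.
    case: p => r i /=; have [lt|ge] := ltnP i r; last by exists 0%N.
    by have [m em] := sgn r i lt; exists m.
  by have [f fE] := choice ex; exists (fun r i => f (r, i)) => r i; exact: fE (r, i).
exists (\sum_(r : 'I_n) \sum_(i : 'I_n | (i < r)%N) f r i)%N; congr (_ + _).
rewrite natr_sum; apply: eq_bigr => r _; rewrite natr_sum; apply: eq_bigr => i lt.
exact: fE.
Qed.

Section HighestWeight.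
Variables (M : glModule C n) (vec : tableau C n -> M) (coef : gt_basis G T0 -> M -> C).
Hypothesis modelP : gt_model vec coef.
Notation E i j := (@unit_act C n M i j).

Notation height_op := (cartan_act (M := M) (fun k => (tau k)%:R)).

Lemma coef_height b x : coef b (height_op x) = height (val b) * coef b x.
Proof.
have cw k : coef b (E k k x) = gt_weight (val b) k * coef b x.
  have [r ->] := model_expand modelP x.
  rewrite unit_act_sum !(gt_coef_sum modelP) mulr_sumr; apply: eq_bigr => c _.
  rewrite unit_actZ (weight_vec modelP) !(gt_coefZ modelP) (gt_coef_vec modelP).
  by case: eqP => [->|_]; rewrite ?mulr1n ?mulr0n; ring.
rewrite (gt_coef_sum modelP) mulr_suml; apply: eq_bigr => k _.
by rewrite (gt_coefZ modelP) cw mulrA.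
Qed.

(** E_pq shifts the height by [tau p - tau q < 0], below the minimum over the basis, so every
    coefficient of the image vanishes. *)
Lemma T_perm_killed p q : (tau p < tau q)%N -> E p q (vec T0) = 0.
Proof.
move=> lt; have h : in_gt_basis G T0 T0.
  by apply/asboolP; split; [exact: int_translate_refl|exact: T_perm_realization].
have eT : T0 = val (Sub T0 h : gt_basis G T0) by rewrite SubK.
have hv : height_op (vec T0) = height T0 *: vec T0.
  rewrite /cartan_act /height scaler_suml; apply: eq_bigr => k _.
  by rewrite [in LHS]eT (weight_vec modelP) SubK scalerA.
apply: (model_ext modelP) => b; rewrite (gt_coef0 modelP).
have := coef_height b (E p q (vec T0)).
rewrite cartan_act_comm hv unit_actZ -scalerDl (gt_coefZ modelP).
have [m ->] := height_ge (basis_inb b).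
move/eqP; rewrite -subr_eq0 -mulrBl mulf_eq0 => /orP[|/eqP //].
have -> : height T0 + ((tau p)%:R - (tau q)%:R) - (height T0 + m%:R)
   = - ((tau q - tau p) + m)%:R by rewrite natrD natrB ?(ltnW lt) //; ring.
by rewrite oppr_eq0 pnatr_eq0; lia.
Qed.

Lemma T_perm_weight_vec k : E k k (vec T0) = (X 0 (tau k) + (tau k)%:R) *: vec T0.
Proof.
have h : in_gt_basis G T0 T0.
  by apply/asboolP; split; [exact: int_translate_refl|exact: T_perm_realization].
have eT : T0 = val (Sub T0 h : gt_basis G T0) by rewrite SubK.
by rewrite [in LHS]eT (weight_vec modelP) SubK T_perm_weight.
Qed.

End HighestWeight.

End PermTableau.

(** * Verma modules and their heads *)

Lemma sum_delta_scale (C : fieldType) (n : nat) (V : lmodType C) (F : 'I_n -> 'I_n -> V) i j :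
  \sum_k \sum_l (delta_mx i j : 'M[C]_n) k l *: F k l = F i j.
Proof.
rewrite (bigD1 i) //= (bigD1 j) //= mxE !eqxx scale1r.
rewrite big1 => [|l nl]; last by rewrite mxE eqxx (negPf nl) scale0r.
rewrite addr0 big1 ?addr0 // => k nk; rewrite big1 // => l _.
by rewrite mxE (negPf nk) scale0r.
Qed.

Section FreeEvaluation.
Variables (C : fieldType) (n : nat) (N : glModule C n).
Notation E i j := (@unit_act C n N i j).
Notation A := (gl_free_alg C n).
Implicit Types (f g : A) (x y : N).

Definition word_act (m : seq ('I_n * 'I_n)) x : N := foldr (fun p y => E p.1 p.2 y) x m.

(** The action extended to noncommutative polynomials in the E_ij. Words act as compositions, which
    makes products act as composites and gives the evaluation map out of the Verma module. *)
Definition free_eval f x : N :=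
  \sum_(k <- msupp f) mcoeff k f *: word_act (fmonom_val k) x.

Lemma free_evalEw (d : {fset {fmonom ('I_n * 'I_n)%type}}) f x : (msupp f `<=` d)%fset ->
  free_eval f x = \sum_(k <- d) mcoeff k f *: word_act (fmonom_val k) x.
Proof.
move=> le; rewrite [LHS](big_fset_incl _ le) //= => k _ /mcoeff_outdom ->.
by rewrite scale0r.
Qed.

Lemma free_evalP c f g x : free_eval (c *: f + g) x = c *: free_eval f x + free_eval g x.
Proof.
pose d := (msupp f `|` msupp g `|` msupp (c *: f + g)%R)%fset.
have s1 : (msupp f `<=` d)%fset by rewrite /d -fsetUA; exact: fsubsetUl.
have s2 : (msupp g `<=` d)%fset.
  by rewrite /d [(msupp f `|` _)%fset]fsetUC -fsetUA; exact: fsubsetUl.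
have s3 : (msupp (c *: f + g)%R `<=` d)%fset by exact: fsubsetUr.
rewrite (free_evalEw _ s1) (free_evalEw _ s2) (free_evalEw _ s3) scaler_sumr -big_split.
by apply: eq_bigr => k _; rewrite mcoeffD mcoeffZ scalerDl scalerA.
Qed.

Lemma free_eval0 x : free_eval 0 x = 0.
Proof. by rewrite /free_eval msupp0 big_seq_fset0. Qed.
Lemma free_evalD f g x : free_eval (f + g) x = free_eval f x + free_eval g x.
Proof. by rewrite -[f]scale1r free_evalP !scale1r. Qed.
Lemma free_evalZ c f x : free_eval (c *: f) x = c *: free_eval f x.
Proof. by rewrite -[c *: f]addr0 free_evalP free_eval0 addr0. Qed.
Lemma free_evalB f g x : free_eval (f - g) x = free_eval f x - free_eval g x.
Proof. by rewrite free_evalD -(scaleN1r g) free_evalZ scaleN1r. Qed.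
Lemma free_eval_sum x (I : Type) (r : seq I) (P : pred I) (F : I -> A) :
  free_eval (\sum_(i <- r | P i) F i) x = \sum_(i <- r | P i) free_eval (F i) x.
Proof. exact: (big_morph (free_eval^~ x) (fun f g => free_evalD f g x) (free_eval0 x)). Qed.

Lemma free_eval_monomial c k x :
  free_eval (<< c *g k >> : A) x = c *: word_act (fmonom_val k) x.
Proof. by rewrite (free_evalEw _ msuppU_le) big_seq_fset1 mcoeffUU. Qed.

Lemma word_act_sum m (I : Type) (r : seq I) (P : pred I) (c : I -> C) (F : I -> N) :
  word_act m (\sum_(i <- r | P i) c i *: F i) = \sum_(i <- r | P i) c i *: word_act m (F i).
Proof.
elim: m => [|p m IH] //=; rewrite IH unit_act_sum.
by apply: eq_bigr => i _; rewrite unit_actZ.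
Qed.

Lemma free_evalM f g x : free_eval (f * g) x = free_eval f (free_eval g x).
Proof.
rewrite (malgME f g) free_eval_sum /free_eval; apply: eq_bigr => k _.
rewrite -/(free_eval _ x) free_eval_sum /= word_act_sum scaler_sumr; apply: eq_bigr => l _.
by rewrite free_eval_monomial fmM /word_act foldr_cat scalerA.
Qed.

Lemma free_eval_comm f g h x : free_eval (f * g - g * f - h) x
  = free_eval f (free_eval g x) - free_eval g (free_eval f x) - free_eval h x.
Proof.
apply: (etrans (free_evalB _ _ x)); congr (_ - _); apply: (etrans (free_evalB _ _ x)).
by congr (_ - _); exact: free_evalM.
Qed.

Lemma free_eval1 x : free_eval 1 x = x.
Proof. by rewrite [LHS]free_eval_monomial scale1r fm1. Qed.

Lemma free_eval_gen z x : free_eval (gl_gen z) x = gl_act z x.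
Proof.
rewrite [in RHS](matrix_sum_delta z) /gl_gen free_eval_sum gl_act_suml.
apply: eq_bigr => i _; rewrite free_eval_sum gl_act_suml; apply: eq_bigr => j _.
by rewrite free_evalZ free_eval_monomial fmU scale1r gl_actZl.
Qed.

Lemma gl_gen_delta i j : gl_gen (delta_mx i j : 'M[C]_n) = << fmu (i, j) >> :> A.
Proof.
exact: (sum_delta_scale (fun i j => << fmu (i, j) >> : A)).
Qed.

Lemma verma_ideal_eval (lam : 'rV[C]_n) x :
  (forall i j : 'I_n, (i < j)%N -> E i j x = 0) ->
  (forall i, E i i x = lam 0 i *: x) ->
  forall f, verma_ideal lam f -> free_eval f x = 0.
Proof.
move=> nil wt f; elim=> {f} [|f g _ ef _ eg|f g _ eg|y z f|i j lt|i].
- exact: free_eval0.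
- by rewrite free_evalD ef eg addr0.
- by rewrite free_evalM eg -(free_eval0 x) -free_evalM mulr0.
- rewrite free_evalM; set w := free_eval f x.
  apply: (etrans (free_eval_comm (gl_gen y) (gl_gen z) (gl_gen (gl_bracket y z)) w)).
  have := free_eval_gen (gl_bracket y z) w.
  move: (gl_gen y) (free_eval_gen y) => gy ey; move: (gl_gen z) (free_eval_gen z) => gz ez.
  rewrite !(ey, ez) => ->.
  by case: (gl_actP N) => _ _ ->; rewrite subrr.
- by rewrite free_eval_gen; exact: nil.
- apply: (etrans (free_evalB (gl_gen (delta_mx i i)) (lam 0 i *: 1) x)).
  rewrite free_eval_gen [gl_act _ _]wt.
  by rewrite (etrans (free_evalZ (lam 0 i) 1 x) (congr1 _ (free_eval1 x))) subrr.
Qed.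

End FreeEvaluation.

Section QuotientLift.
Variables (C : fieldType) (V : lmodType C) (K : {pred V}) (KP : submod_closed K).
Variables (W : lmodType C) (phi : V -> W).
Hypotheses (phi_lin : linear phi) (phi0 : forall v, v \in K -> phi v = 0).

Definition quot_lift (q : lquot KP) : W := phi (lrepr q).

Lemma quot_liftE v : quot_lift (lpi KP v) = phi v.
Proof.
rewrite /quot_lift; have /lpi_eq/phi0 : lpi KP (lrepr (lpi KP v)) = lpi KP v by exact: lreprK.
rewrite -[lrepr _]scale1r; have -> : - v = (-1) *: v by rewrite scaleN1r.
rewrite addrC phi_lin scale1r scaleN1r => /eqP; rewrite addrC subr_eq0 => /eqP.
by [].
Qed.

Lemma quot_lift_linear : linear quot_lift.
Proof.
move=> c q r; rewrite -[q]lreprK -[r]lreprK -lpi_is_linear !quot_liftE.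
exact: phi_lin.
Qed.

End QuotientLift.

(** * The top component of a highest weight module *)

Section TopComponent.
Variables (C : numFieldType) (n : nat) (lam : 'rV[C]_n) (M : glModule C n) (v : M).
Notation E i j := (@unit_act C n M i j).
Hypothesis hw_nil : forall i j : 'I_n, (i < j)%N -> E i j v = 0.
Hypothesis hw_wt : forall i, E i i v = lam 0 i *: v.
Hypothesis hw_gen : forall Q : M -> Prop, gl_submodule Q -> Q v -> forall x, Q x.
Implicit Types (x y u : M).

Definition grading x : M := cartan_act (fun j => j%:R) x.
Definition top_degree : C := \sum_(j : 'I_n) j%:R * lam 0 j.

Lemma gradingP c x y : grading (c *: x + y) = c *: grading x + grading y.
Proof.
rewrite /grading /cartan_act scaler_sumr -big_split; apply: eq_bigr => j _ /=.
by rewrite unit_actD unit_actZ scalerDr !scalerA mulrC.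
Qed.

Lemma grading_comm i j x :
  grading (E i j x) = E i j (grading x) + (i%:R - j%:R) *: E i j x.
Proof. exact: cartan_act_comm. Qed.

Lemma grading_top : grading v = top_degree *: v.
Proof.
by rewrite /top_degree scaler_suml; apply: eq_bigr => j _; rewrite hw_wt scalerA.
Qed.

Inductive lowering_span : M -> Prop :=
| lowering_span0 : lowering_span 0
| lowering_span_lin c x y :
    lowering_span x -> lowering_span y -> lowering_span (c *: x + y)
| lowering_span_top : lowering_span v
| lowering_span_act (i j : 'I_n) x :
    (j < i)%N -> lowering_span x -> lowering_span (E i j x).

(** The grading of the top vector is [top_degree], and E_ij with [j < i] adds [i - j] to it; hence
    degrees strictly above [top_degree] correspond to weights below the highest one. *)
Inductive off_top : M -> Prop :=
| off_top0 : off_top 0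
| off_top_lin c x y : off_top x -> off_top y -> off_top (c *: x + y)
| off_top_eigen (m : nat) u : grading u = (top_degree + m.+1%:R) *: u -> off_top u.

(** A substitute for PBW: moving an operator past the leading lowering one leaves commutator terms
    acting on a shorter word, which the induction covers for all matrix units. *)
Lemma lowering_spanE x : lowering_span x -> forall i j, lowering_span (E i j x).
Proof.
have lin0 c y : lowering_span y -> lowering_span (c *: y).
  by move=> h; rewrite -[_ *: _]addr0; apply: lowering_span_lin => //; exact: lowering_span0.
elim=> {x} [|c x y _ IHx _ IHy|//|k l x lt Sx IH] i j.
- by have := unit_actZ i j 0 (0 : M); rewrite !scale0r => ->; exact: lowering_span0.
- by rewrite unit_actD unit_actZ; apply: lowering_span_lin.
- have [h|h|/val_inj ->] := ltngtP i j.
  + by rewrite hw_nil //; exact: lowering_span0.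
  + by apply: lowering_span_act => //; exact: lowering_span_top.
  + by rewrite hw_wt; apply: lin0; exact: lowering_span_top.
rewrite unit_act_comm -scaleNr addrC; apply: lowering_span_lin => //.
by rewrite addrC; apply: lowering_span_lin => //; exact: lowering_span_act.
Qed.

Lemma lowering_spanT x : lowering_span x.
Proof.
apply: (hw_gen (Q := lowering_span)); last exact: lowering_span_top.
split; [exact: lowering_span0|exact: lowering_span_lin|move=> z y Sy].
rewrite (matrix_sum_delta z) gl_act_suml.
apply: (closed_sum lowering_span0 lowering_span_lin) => i _; rewrite gl_act_suml.
apply: (closed_sum lowering_span0 lowering_span_lin) => j _; rewrite gl_actZl.
by apply: (closedZ lowering_span0 lowering_span_lin); exact: lowering_spanE.
Qed.

Lemma off_top_act x (i j : 'I_n) : (j < i)%N -> off_top x -> off_top (E i j x).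
Proof.
move=> lt; elim=> {x} [|c x y _ IHx _ IHy|m u eu].
- by have := unit_actZ i j 0 (0 : M); rewrite !scale0r => ->; exact: off_top0.
- by rewrite unit_actD unit_actZ; apply: off_top_lin.
apply: (@off_top_eigen (m + (i - j))).
rewrite grading_comm eu unit_actZ -scalerDl; congr (_ *: _).
by rewrite -addSn natrD natrB ?(ltnW lt) //; ring.
Qed.

Lemma top_decomposition x : exists c, off_top (x - c *: v).
Proof.
elim: (lowering_spanT x) => {x} [|c x y _ [a xa] _ [b yb]||i j x lt _ [a xa]].
- by exists 0; rewrite scale0r subr0; exact: off_top0.
- exists (c * a + b).
  have -> : c *: x + y - (c * a + b) *: v = c *: (x - a *: v) + (y - b *: v).
    by rewrite scalerBr scalerA scalerDl opprD addrACA.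
  exact: off_top_lin.
- by exists 1; rewrite scale1r subrr; exact: off_top0.
exists 0; rewrite scale0r subr0.
have -> : E i j x = E i j (x - a *: v) + a *: E i j v.
  by rewrite unit_actB unit_actZ subrK.
rewrite addrC; apply: off_top_lin; last exact: off_top_act.
apply: (@off_top_eigen (i - j).-1); rewrite grading_comm grading_top unit_actZ -scalerDl.
by congr (_ *: _); rewrite prednK ?natrB ?(ltnW lt) //; lia.
Qed.

(* [kill k] annihilates the eigenvectors of [grading] of degree at most [k]
   above the top one, and multiplies [v] by [(-1)^k k!]. *)
Fixpoint kill (k : nat) x : M :=
  if k is k'.+1 then grading (kill k' x) - (top_degree + k%:R) *: kill k' x else x.

Lemma killP k c x y : kill k (c *: x + y) = c *: kill k x + kill k y.
Proof.
elim: k => //= k ->; rewrite gradingP scalerDr opprD addrACA scalerBr !scalerA.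
by rewrite mulrC.
Qed.

Lemma kill_eigen k d u : grading u = (top_degree + d) *: u ->
  kill k u = (\prod_(i < k) (d - i.+1%:R)) *: u.
Proof.
move=> eu; elim: k => [|k IH] /=; first by rewrite big_ord0 scale1r.
have g0 : grading 0 = 0 by have := gradingP (-1) 0 0; rewrite !scaleN1r oppr0 addr0 addNr.
rewrite IH -[X in grading X]addr0 gradingP g0 addr0 eu big_ord_recr /= !scalerA -scalerBl.
by congr (_ *: _); ring.
Qed.

Lemma kill_off_top x : off_top x -> exists k, forall l, (k <= l)%N -> kill l x = 0.
Proof.
have k0 k : kill k 0 = 0.
  by have := killP k (-1) 0 0; rewrite !scaleN1r oppr0 addr0 addNr.
elim=> {x} [|c x y _ [k kx] _ [l ly]|m u eu].
- by exists 0%N => l _; exact: k0.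
- exists (maxn k l) => i; rewrite geq_max => /andP[ki li].
  by rewrite killP kx // ly // scaler0 addr0.
exists m.+1 => l lt; rewrite (kill_eigen _ eu) (bigD1 (Ordinal lt)) //= subrr mul0r.
by rewrite scale0r.
Qed.

(** If [x] had a nonzero top coefficient [c], then [kill k] would erase the rest of [x] and leave a
    nonzero multiple of [v] in [P], which would then be everything. *)
Lemma proper_off_top (P : M -> Prop) x : gl_proper_submodule P -> P x -> off_top x.
Proof.
move=> [subP [y0 nPy0]] Px; have [P0 PP Pact] := subP.
have [c xc] := top_decomposition x.
have [k kE] := kill_off_top xc.
suff c0 : c = 0 by rewrite c0 scale0r subr0 in xc.
apply/eqP; apply: contraT => nc; case: nPy0; apply: (hw_gen subP).
have Pgr y : P y -> P (grading y).
  move=> Py; apply: (closed_sum P0 PP) => j _; apply: (closedZ P0 PP); exact: Pact.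
have Pk : P (kill k x).
  elim: (k) => //= l Pl; rewrite addrC -scaleNr; apply: PP => //; exact: Pgr.
have ev : grading v = (top_degree + 0) *: v by rewrite addr0 grading_top.
have : kill k x = (c * \prod_(i < k) (0 - i.+1%:R)) *: v.
  have -> : x = c *: v + (x - c *: v) by rewrite addrC subrK.
  by rewrite killP kE // addr0 (kill_eigen _ ev) scalerA.
set d := _ * _ => e; have nd : d != 0.
  rewrite /d mulf_neq0 //; apply/prodf_neq0 => i _.
  by rewrite sub0r oppr_eq0 pnatr_eq0.
by rewrite -[v]scale1r -(mulVf nd) -scalerA -e; apply: (closedZ P0 PP).
Qed.

End TopComponent.

Section VermaHighestWeight.
Variables (C : fieldType) (n : nat) (lam : 'rV[C]_n).
Notation A := (gl_free_alg C n).

Definition verma_pi (f : A) : verma lam := lpi (verma_pred_closed lam) f.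

Lemma verma_act z f : gl_act z (verma_pi f) = verma_pi (gl_gen z * f).
Proof.
exact: (quot_actE (verma_pred_closed lam) (@free_act_linr C n) (@free_act_stable C n lam)).
Qed.

Lemma verma_piP c f g : verma_pi (c *: f + g) = c *: verma_pi f + verma_pi g.
Proof. exact: lpi_is_linear. Qed.

Lemma verma_pi0 : verma_pi 0 = 0.
Proof. by have := verma_piP (-1) 0 0; rewrite !scaleN1r oppr0 addr0 addNr. Qed.

Lemma verma_pi_eq f g : verma_ideal lam (f - g) -> verma_pi f = verma_pi g.
Proof. by move=> h; apply/lpi_eq/asboolP. Qed.

Lemma verma_nil (i j : 'I_n) : (i < j)%N -> unit_act i j (verma_pi 1) = 0.
Proof.
move=> lt; rewrite /unit_act verma_act mulr1 -verma_pi0; apply: verma_pi_eq.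
by rewrite subr0; exact: verma_ideal_nil.
Qed.

Lemma verma_wt i : unit_act i i (verma_pi 1) = lam 0 i *: verma_pi 1.
Proof.
rewrite /unit_act verma_act mulr1 -[RHS]addr0 -verma_pi0 -verma_piP addr0.
by apply: verma_pi_eq; exact: verma_ideal_cartan.
Qed.

Lemma verma_pi_surj q : exists f, q = verma_pi f.
Proof. by exists (lrepr q); rewrite /verma_pi lreprK. Qed.

Lemma verma_gen (Q : verma lam -> Prop) : gl_submodule Q -> Q (verma_pi 1) -> forall q, Q q.
Proof.
move=> [Q0 QP Qact] Q1 q; have [f ->] := verma_pi_surj q.
have mon c (s : seq ('I_n * 'I_n)) : Q (verma_pi << c *g FMonom s >>).
  elim: s => [|[i j] s IH].
    have -> : << c *g FMonom [::] >> = c *: 1 + 0 :> A.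
      apply/malgP => k; rewrite addr0 mcoeffZ mcoeff1 mcoeffU -fmoneE eq_sym.
      by rewrite mulr_natr.
    by rewrite verma_piP; apply: QP => //; rewrite verma_pi0.
  have -> : << c *g FMonom ((i, j) :: s) >> = gl_gen (delta_mx i j) * << c *g FMonom s >> :> A.
    rewrite gl_gen_delta malgM_def fgmulUU mul1r; congr (mkmalgU _ _).
    by rewrite [RHS]fmmulE fmU.
  by rewrite -verma_act; exact: Qact.
have lin (r : seq {fmonom ('I_n * 'I_n)%type}) (F : {fmonom ('I_n * 'I_n)%type} -> A) :
    (forall k, Q (verma_pi (F k))) -> Q (verma_pi (\sum_(k <- r) F k)).
  move=> h; elim: r => [|k r IH]; first by rewrite big_nil verma_pi0.
  by rewrite big_cons -[F k]scale1r verma_piP; apply: QP.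
rewrite (monalgE f); apply: lin => k.
by rewrite -[k in mkmalgU k]fmK; exact: mon.
Qed.

End VermaHighestWeight.

(** * A criterion for being the head of a Verma module *)

Section HighestWeightIso.
Variables (C : numFieldType) (n : nat) (lam : 'rV[C]_n) (N : glModule C n) (v0 : N).
Variable xi : N -> C.
Hypothesis hw_nil : forall i j : 'I_n, (i < j)%N -> unit_act i j v0 = 0.
Hypothesis hw_wt : forall i, unit_act i i v0 = lam 0 i *: v0.
Hypothesis hw_gen : forall Q : N -> Prop, gl_submodule Q -> Q v0 -> forall x, Q x.
Hypothesis xiP : forall c x y, xi (c *: x + y) = c * xi x + xi y.
Hypothesis xi_top : xi v0 = 1.
Hypothesis xi_grading : forall x, xi (grading x) = top_degree lam * xi x.
Hypothesis xi_faithful : forall Q : N -> Prop, gl_submodule Q ->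
  (forall x, Q x -> xi x = 0) -> forall x, Q x -> x = 0.

Notation V := (verma lam).

Let ev f := free_eval f v0.
Let ev_lin : linear ev. Proof. by move=> c f g; exact: free_evalP. Qed.
Let ev0 f : f \in verma_pred lam -> ev f = 0.
Proof. by move=> /asboolP; exact: verma_ideal_eval. Qed.

Definition verma_map : V -> N := @quot_lift C _ _ (verma_pred_closed lam) N ev.

Lemma verma_mapE f : verma_map (verma_pi lam f) = free_eval f v0.
Proof. exact: quot_liftE. Qed.

Lemma verma_mapP c q r : verma_map (c *: q + r) = c *: verma_map q + verma_map r.
Proof. exact: quot_lift_linear. Qed.

Lemma verma_map0 : verma_map 0 = 0.
Proof. by have := verma_mapP (-1) 0 0; rewrite !scaleN1r oppr0 addr0 addNr. Qed.

Lemma verma_map_act z q : verma_map (gl_act z q) = gl_act z (verma_map q).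
Proof.
have [f ->] := verma_pi_surj q; rewrite verma_act !verma_mapE free_evalM.
exact: free_eval_gen.
Qed.

Lemma verma_map_top : verma_map (verma_pi lam 1) = v0.
Proof. by rewrite verma_mapE free_eval1. Qed.

Lemma verma_map_surj x : exists q, verma_map q = x.
Proof.
apply: (hw_gen (Q := fun x => exists q, verma_map q = x)); last first.
  by exists (verma_pi lam 1); exact: verma_map_top.
split; first by exists 0; exact: verma_map0.
  by move=> c _ _ [q <-] [r <-]; exists (c *: q + r); rewrite verma_mapP.
by move=> z _ [q <-]; exists (gl_act z q); rewrite verma_map_act.
Qed.

Lemma verma_map_sum (I : Type) (r : seq I) (P : pred I) (F : I -> V) :
  verma_map (\sum_(i <- r | P i) F i) = \sum_(i <- r | P i) verma_map (F i).
Proof.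
apply: (big_morph _ _ verma_map0) => q t.
by rewrite -[q]scale1r verma_mapP !scale1r.
Qed.

(** [xi] is an eigenfunctional of the grading with eigenvalue [top_degree]; the degree of an off-top
    eigenvector differs by [m.+1], which is nonzero in characteristic 0. *)
Lemma xi_verma_off_top q : off_top lam q -> xi (verma_map q) = 0.
Proof.
have xi0 : xi 0 = 0 by have := xiP (-1) 0 0; rewrite scaleN1r oppr0 addr0 mulN1r addNr.
elim=> {q} [|c x y _ ex _ ey|m u eu]; first by rewrite verma_map0.
  by rewrite verma_mapP xiP ex ey mulr0 addr0.
have gr : grading (verma_map u) = verma_map (grading u).
  rewrite /grading /cartan_act verma_map_sum; apply: eq_bigr => j _.
  by rewrite -[_ *: unit_act _ _ u]addr0 verma_mapP verma_map0 addr0 verma_map_act.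
have := xi_grading (verma_map u); rewrite gr eu -[_ *: u]addr0 verma_mapP verma_map0 xiP xi0.
rewrite addr0 mulrDl => /eqP; rewrite -[X in _ == X]addr0 (inj_eq (addrI _)) mulf_eq0 pnatr_eq0.
by move=> /eqP.
Qed.

Lemma verma_map_proper (P : V -> Prop) q : gl_proper_submodule P -> P q -> verma_map q = 0.
Proof.
move=> properP Pq; have [[P0 PP Pact] _] := properP.
apply: (xi_faithful (Q := fun x => exists2 p, P p & verma_map p = x)); last by exists q.
  split; first by exists 0 => //; exact: verma_map0.
    move=> c _ _ [p Pp <-] [r Pr <-]; exists (c *: p + r); first exact: PP.
    by rewrite verma_mapP.
  by move=> z _ [p Pp <-]; exists (gl_act z p); [exact: Pact|rewrite verma_map_act].
move=> _ [p Pp <-]; apply: xi_verma_off_top.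
by apply: (proper_off_top (@verma_nil C n lam) (@verma_wt C n lam) (@verma_gen C n lam) properP).
Qed.

(** The kernel is itself a proper submodule, as [v0] is not 0, so the one-element list [[:: q]]
    witnesses membership in the radical. Conversely each summand dies because [xi] vanishes on
    images of proper submodules. *)
Lemma verma_map_rad q : (q \in @gl_rad C n V) <-> verma_map q = 0.
Proof.
split=> [/asboolP[r [rP ->]]|e].
  rewrite verma_map_sum big1_seq // => u /= ur.
  by have [P properP Pu] := rP u ur; exact: verma_map_proper properP Pu.
apply/asboolP; exists [:: q]; split; last by rewrite big_seq1.
move=> u; rewrite inE => /eqP ->; exists (fun p => verma_map p = 0) => //; split.
  split; first exact: verma_map0.
    by move=> c p r ep er; rewrite verma_mapP ep er scaler0 addr0.
  by move=> z p ep; rewrite verma_map_act ep gl_act0.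
exists (verma_pi lam 1); rewrite verma_map_top => ev0'.
have := xi_top; rewrite ev0'; have := xiP (-1) 0 0.
by rewrite scaleN1r oppr0 addr0 mulN1r addNr => -> /esym/eqP; rewrite oner_eq0.
Qed.

Lemma simple_hw_iso : gl_iso (simple_hw lam) N.
Proof.
pose g : simple_hw lam -> N := @quot_lift C _ _ (gl_rad_closed V) N verma_map.
have map_lin : linear verma_map := verma_mapP.
have rad0 q : q \in @gl_rad C n V -> verma_map q = 0 by move/verma_map_rad.
have gE q : g (lpi (gl_rad_closed V) q) = verma_map q by exact: quot_liftE.
have g_lin : linear g by exact: quot_lift_linear.
pose f : {linear simple_hw lam -> N} := HB.pack g (GRing.isLinear.Build C _ _ *:%R g g_lin).
have fE q : f (lpi (gl_rad_closed V) q) = verma_map q by exact: gE.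
exists f.
  have surj x : exists q, f q == x.
    by have [q <-] := verma_map_surj x; exists (lpi (gl_rad_closed V) q); rewrite fE.
  have inj : injective f.
    move=> q r; rewrite -[q]lreprK -[r]lreprK !fE => e; apply/lpi_eq/verma_map_rad.
    by rewrite -scaleN1r addrC verma_mapP e scaleN1r addNr.
  exists (fun x => xchoose (surj x)) => [q|x]; last exact/eqP/(xchooseP (surj x)).
  by apply: inj; exact/eqP/(xchooseP (surj (f q))).
move=> z q; rewrite -[q]lreprK.
have -> : gl_act z (lpi (gl_rad_closed V) (lrepr q) : simple_hw lam)
    = lpi (gl_rad_closed V) (gl_act z (lrepr q)).
  exact: (quot_actE (gl_rad_closed V) (@gl_actP_r C n V) (@gl_rad_stable C n V)).
by rewrite !fE verma_map_act.
Qed.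

End HighestWeightIso.

(** * The twisted module *)

Section Twisted.
Variables (C : numFieldType) (n : nat) (s : 'S_n).

Lemma phi_perm_delta i j : phi_perm s (delta_mx i j) = delta_mx (s i) (s j) :> 'M[C]_n.
Proof. exact: (sum_delta_scale (fun i j => delta_mx (s i) (s j))). Qed.

Lemma phi_perm_surj (x : 'M[C]_n) : exists y, phi_perm s y = x.
Proof.
exists (\matrix_(i, j) x (s i) (s j)); apply/matrixP => k l.
by rewrite -[k](permKV s) -[l](permKV s) phi_permE mxE.
Qed.

Lemma twist_unit_act (M : glModule C n) i j (x : M) :
  @unit_act C n (gl_twist s M) i j x = @unit_act C n M (s i) (s j) x.
Proof. by rewrite /unit_act /= phi_perm_delta. Qed.

(** Twisting permutes the acting matrices bijectively, so both structures have the same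
    submodules. *)
Lemma twist_submodule (M : glModule C n) (Q : gl_twist s M -> Prop) :
  gl_submodule Q -> @gl_submodule C n M Q.
Proof.
move=> [Q0 QP Qact]; split=> // x v Qv; have [y <-] := phi_perm_surj x.
exact: (Qact y v).
Qed.

Variable lam : 'rV[C]_n.
Let T0 := T_perm s (lam_bar lam).
Let G := tableau_graph T0.
Hypothesis relG : relation_graph C G.
Let adm : admissible_graph G. Proof. by case: relG. Qed.
Variables (M : glModule C n) (vec : tableau C n -> M) (coef : gt_basis G T0 -> M -> C).
Hypothesis modelP : gt_model vec coef.

Lemma lam_barK j : lam_bar lam 0 j + j%:R = lam 0 j.
Proof. by rewrite mxE subrK. Qed.

Lemma twisted_iso : gl_iso (simple_hw lam) (gl_twist s M).
Proof.
have re0 : realization G T0 := @T_perm_realization _ _ _ _.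
have h0 : in_gt_basis G T0 T0 := inb_T0 re0.
pose b0 : gt_basis G T0 := Sub T0 h0; have eb0 : val b0 = T0 by rewrite SubK.
apply: (@simple_hw_iso C n lam (gl_twist s M) (vec T0) (coef b0)).
- by move=> i j lt; rewrite twist_unit_act (T_perm_killed adm modelP) // !permK.
- move=> i; rewrite twist_unit_act (T_perm_weight_vec modelP) permK.
  by rewrite lam_barK.
- by move=> Q /twist_submodule subQ; exact: (generated_by_T0 relG re0 modelP subQ).
- exact: (model_coefP modelP).
- by rewrite (gt_coef_vec modelP) eb0 eqxx.
- move=> x; have -> : top_degree lam = height s T0.
    rewrite height_T_perm; apply: eq_bigr => j _.
    by rewrite lam_barK.
  have := coef_height modelP b0 x; rewrite eb0 => <-; congr (coef b0 _).
  (* Reindexing by [s] turns the height operator on [M] into the standard grading of the twisted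
     module. *)
  rewrite /grading /cartan_act [RHS](reindex_inj (@perm_inj _ s)).
  by apply: eq_bigr => j _; rewrite twist_unit_act permK.
- move=> Q /twist_submodule subQ h x Qx.
  exact: (zero_of_coef relG re0 modelP subQ eb0 h Qx).
Qed.

End Twisted.

Lemma gl_iso_refl (C : fieldType) (n : nat) (M : glModule C n) : gl_iso M M.
Proof. by exists (GRing.Linear.clone _ _ _ _ idfun _) => //; exists id. Qed.

Theorem theorem5p2 (R : realType) (n : nat) (hn : (2 <= n)%N)
  (lam : 'rV[R[i]]_n) (s : 'S_n) :
  perm_relation_weight s lam ->
  let T := T_perm s (lam_bar lam) in
  let G := tableau_graph T in
  perm_relation_module s (simple_hw lam) /\
  (realization G T /\
   exists (a : 'M[R[i]]_n -> V_G G T -> V_G G T) (aP : is_gt_action a),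
     gl_iso (simple_hw lam) (gl_twist s (V_G_module aP))).
Proof.
move=> relG T G; have re : realization G T := @T_perm_realization _ _ _ _.
have [_ _ /(_ T re)[a aP]] := relG.
have iso := twisted_iso relG (V_G_model aP).
split; last by split=> //; exists a, aP.
exists (V_G_module aP) => //; exists G, T; split=> //.
by exists a, aP; exact: gl_iso_refl.
Qed.
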